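(* The two sequences $$0\longrightarrow B_{h0}^3\xrightarrow{\ \nabla_h\ }\mathbf{G}_{h0}^2\xrightarrow{\ \mathrm{rot}_h\ }\mathbb{P}^1_{h0}\longrightarrow 0$$ and $$0\longrightarrow B_{ht}^3\xrightarrow{\ \nabla_h\ }\mathbf{G}_{ht}^2\xrightarrow{\ \mathrm{rot}_h\ }\mathbb{P}^1_{h0}\longrightarrow 0$$ are (well-defined) exact complexes; that is, in each case $\nabla_h$ is injective, its range is exactly the kernel of $\mathrm{rot}_h$, and $\mathrm{rot}_h$ maps onto $\mathbb{P}^1_{h0}$ (the functions of $\mathbb{P}^1_{h0}$ being annihilated by the final map $\int_\Omega\cdot$).
   Context: $\Omega\subset\mathbb{R}^2$ is a simply connected polygonal domain and $\mathcal{T}_h$ is a shape-regular triangulation of $\Omega$. $\mathcal{E}_h^i,\mathcal{E}_h^b$ are the interior and boundary edges; $\mathcal{X}_h,\mathcal{X}_h^b$ all vertices and boundary vertices. For an edge $e$, $\mathbf{n}_e,\mathbf{t}_e$ are unit normal and tangential vectors, $\partial_{\mathbf n}$ the normal derivative, $[\![\cdot]\!]$ the jump across $e$. $P_k(T)$, $P_k(e)$ are polynomials of degree at most $k$. A subscript $h$ on a differential operator means it is applied cell by cell; $\mathrm{rot}\,\mathbf{v}=\partial_x v^2-\partial_y v^1$. Spaces: $\mathbb{P}^k_h:=\{w\in L^2(\Omega): w|_T\in P_k(T)\ \forall T\in\mathcal{T}_h\}$, $\mathbb{P}^k_{h0}:=\{w\in\mathbb{P}^k_h:\int_\Omega w=0\}$;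 $\mathbf{G}_h^2:=\{\mathbf{v}\in(\mathbb{P}^2_h)^2:\int_e p_e[\![v^j]\!]=0\ \forall p_e\in P_1(e),\ \forall e\in\mathcal{E}_h^i,\ j=1,2\}$; $\mathbf{G}_{ht}^2:=\{\mathbf{v}\in\mathbf{G}_h^2:\int_e p_e\,\mathbf{v}\cdot\mathbf{t}_e=0\ \forall e\in\mathcal{E}_h^b,\ p_e\in P_1(e)\}$; $\mathbf{G}_{h0}^2:=\{\mathbf{v}\in\mathbf{G}_h^2:\int_e p_e v^j=0\ \forall e\in\mathcal{E}_h^b,\ p_e\in P_1(e),\ j=1,2\}$; $B_h^3:=\{v\in\mathbb{P}^3_h: v$ is continuous at every $a\in\mathcal{X}_h$; $\int_e[\![v]\!]=0$ and $\int_e p_e[\![\partial_{\mathbf n}v]\!]=0$ for all $p_e\in P_1(e)$, $e\in\mathcal{E}_h^i\}$; $B_{ht}^3:=\{v\in B_h^3: v(a)=0\ \forall a\in\mathcal{X}_h^b;\ \int_e v=0\ \forall e\in\mathcal{E}_h^b\}$; $B_{h0}^3:=\{v\in B_{ht}^3: \int_e p_e\,\partial_{\mathbf n}v=0\ \forall p_e\in P_1(e),\ \forall e\in\mathcal{E}_h^b\}$. *)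

(* Defs.v *)
From HB Require Import structures.
From mathcomp Require Import all_boot all_order all_algebra.
From mathcomp Require Import all_classical all_reals all_analysis.
(* The notations of mpoly clash with those of MathComp-Analysis. *)
From mathcomp Require Import -(notations) mpoly.

Set Implicit Arguments.
Unset Strict Implicit.
Unset Printing Implicit Defensive.

Import Order.TTheory GRing.Theory Num.Theory.
Import numFieldNormedType.Exports.

Local Open Scope classical_set_scope.
Local Open Scope ring_scope.

Section Plane.
Context {R : realType}.
Local Notation pt := (R * R)%type.
Implicit Types (Omega : set pt).

Definition along (a b : pt) (t : R) : pt :=
  ((1 - t) * a.1 + t * b.1, (1 - t) * a.2 + t * b.2).

Definition segment (a b : pt) : set pt := [set along a b t | t in `[0, 1]].

(* The norm that MathComp-Analysis puts on R * R is the sup norm. *)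
Definition edist (a b : pt) : R :=
  Num.sqrt ((b.1 - a.1) ^+ 2 + (b.2 - a.2) ^+ 2).

Definition utangent (a b : pt) : pt :=
  ((b.1 - a.1) / edist a b, (b.2 - a.2) / edist a b).

Definition unormal (a b : pt) : pt := ((utangent a b).2, - (utangent a b).1).

Definition boundary Omega : set pt := closure Omega `\` interior Omega.

(* Regularity of the open set ([interior (closure Omega) = Omega]) says that
   Omega does not lie on both sides of a piece of its boundary (no slits). *)
Definition polygonal_domain Omega : Prop :=
  [/\ Omega !=set0, open Omega, connected Omega & bounded_set Omega]
  /\ interior (closure Omega) = Omega
  /\ exists s : seq (pt * pt),
       boundary Omega = \bigcup_(e in [set` s]) segment e.1 e.2.

Definition path_in Omega (g : R -> pt) : Prop :=
  {within `[0, 1], continuous g} /\ g @` `[0, 1] `<=` Omega.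

(* Every loop in Omega is homotopic in Omega, relative to its base point,
   to a constant loop; the homotopy is H (s, t), with t the loop parameter. *)
Definition simply_connected Omega : Prop :=
  (forall x y, Omega x -> Omega y ->
     exists g, [/\ path_in Omega g, g 0 = x & g 1 = y])
  /\ (forall g, path_in Omega g -> g 0 = g 1 ->
     exists H : pt -> pt,
       [/\ {within `[0, 1] `*` `[0, 1], continuous H},
           H @` (`[0, 1] `*` `[0, 1]) `<=` Omega,
           forall t, 0 <= t <= 1 -> H (0, t) = g t,
           forall t, 0 <= t <= 1 -> H (1, t) = g 0
         & forall s, 0 <= s <= 1 -> H (s, 0) = g 0 /\ H (s, 1) = g 0]).

Definition hull (V : finType) (pos : V -> pt) (S : {set V}) : set pt :=
  [set x | exists l : V -> R,
     [/\ forall a, 0 <= l a, \sum_(a in S) l a = 1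
       & x = (\sum_(a in S) l a * (pos a).1, \sum_(a in S) l a * (pos a).2)]].

(* Integral over the segment [a, b] with respect to arc length; the integrand
   is given in the affine parameter t of [along a b]. *)
Definition edge_int (a b : pt) (f : R -> R) : R :=
  edist a b * Rintegral lebesgue_measure `[0, 1] f.

Definition area_int (A : set pt) (f : pt -> R) : R :=
  Rintegral (@lebesgue_measure R \x @lebesgue_measure R)%E A f.

End Plane.

(* Conforming: two triangles meet in the hull of their common vertices, i.e.
   in a common edge, a common vertex, or not at all (the hull of the empty
   set being empty). *)
Record triangulation (R : realType) := Triangulation {
  vertex : finType;
  pos : vertex -> R * R;
  triangles : {set {set vertex}};
  card_triangle : forall K, K \in triangles -> #|K| = 3;
  nondegenerate : forall K, K \in triangles -> forall l : vertex -> R,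
    \sum_(a in K) l a = 0 ->
    \sum_(a in K) l a * (pos a).1 = 0 ->
    \sum_(a in K) l a * (pos a).2 = 0 ->
    forall a, a \in K -> l a = 0;
  conforming : forall K K', K \in triangles -> K' \in triangles ->
    hull pos K `&` hull pos K' = hull pos (K :&: K');
  vertex_used : forall a, exists2 K, K \in triangles & a \in K }.

Section Spaces.
Context {R : realType}.
Variables (Omega : set (R * R)) (Th : triangulation R).

Definition cell := {K : {set vertex Th} | K \in triangles Th}.

Definition cell_set (K : cell) : set (R * R) := hull (@pos R Th) (val K).

Definition triangulates : Prop :=
  closure Omega = \bigcup_(K in [set: cell]) cell_set K.

Definition diameter (K : cell) : R :=
  \big[Num.max/0]_(a in val K) \big[Num.max/0]_(b in val K)
    edist (pos a) (pos b).

(* h_K <= kappa * rho_K with rho_K the diameter of the largest disc in K. *)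
Definition shape_regular (kappa : R) : Prop :=
  0 < kappa /\ forall K : cell, exists c : R * R,
    [set x | edist c x <= diameter K / (2 * kappa)] `<=` cell_set K.

(* An edge is given by its two endpoints, hence occurs with both orientations;
   all the conditions below are invariant under change of orientation. *)
Definition edge_of (a b : vertex Th) (K : cell) : Prop :=
  [/\ a != b, a \in val K & b \in val K].

Definition bdry_edge (a b : vertex Th) : Prop :=
  (exists K, edge_of a b K) /\ segment (pos a) (pos b) `<=` boundary Omega.

Definition int_edge (a b : vertex Th) : Prop :=
  (exists K, edge_of a b K) /\ ~ segment (pos a) (pos b) `<=` boundary Omega.

Definition bdry_vertex (a : vertex Th) : Prop := boundary Omega (pos a).

(* Elements of L^2(Omega) that are polynomial on each triangle: a triangle has
   nonempty interior and the edges are negligible, so that such a class is the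
   same thing as a family of polynomials indexed by the triangles. *)
Definition pw := {ffun cell -> mpoly 2 R}.
HB.instance Definition _ := GRing.Lmodule.on pw.

Definition ev (p : mpoly 2 R) (x : R * R) : R :=
  meval (fun i : 'I_2 => if i == ord0 then x.1 else x.2) p.

Definition dx (p : mpoly 2 R) : mpoly 2 R := mderiv ord0 p.
Definition dy (p : mpoly 2 R) : mpoly 2 R := mderiv ord_max p.

Definition grad_h (w : pw) : (pw * pw)%type :=
  ([ffun K => dx (w K)], [ffun K => dy (w K)]).

Definition rot_h (v : pw * pw) : pw := [ffun K => dx (v.2 K) - dy (v.1 K)].

Lemma grad_h_is_linear : linear grad_h.
Proof.
move=> c u v; rewrite /grad_h /dx /dy.
by congr pair; apply/ffunP => K /=; rewrite !ffunE linearP.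
Qed.

HB.instance Definition _ :=
  GRing.isLinear.Build R pw (pw * pw)%type *:%R grad_h grad_h_is_linear.

Lemma rot_h_is_linear : linear rot_h.
Proof.
move=> c u v; apply/ffunP => K; rewrite /rot_h /dx /dy !ffunE.
by rewrite [mderiv ord0 _]linearP [mderiv ord_max _]linearP /= scalerBr opprD addrACA.
Qed.

HB.instance Definition _ :=
  GRing.isLinear.Build R (pw * pw)%type pw *:%R rot_h rot_h_is_linear.

Definition int_Omega (w : pw) : R :=
  \sum_(K : cell) area_int (cell_set K) (ev (w K)).

Definition trace (w : pw) (a b : vertex Th) (K : cell) (t : R) : R :=
  ev (w K) (along (pos a) (pos b) t).

Definition trace_t (v : pw * pw) (a b : vertex Th) (K : cell) (t : R) : R :=
  trace v.1 a b K t * (utangent (pos a) (pos b)).1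
  + trace v.2 a b K t * (utangent (pos a) (pos b)).2.

Definition trace_dn (w : pw) (a b : vertex Th) (K : cell) (t : R) : R :=
  trace (grad_h w).1 a b K t * (unormal (pos a) (pos b)).1
  + trace (grad_h w).2 a b K t * (unormal (pos a) (pos b)).2.

(* P_1(e), written in the affine parameter of the edge. *)
Definition P1edge (p : {poly R}) : Prop := (size p <= 2)%N.

Definition int_on (a b : vertex Th) (f : R -> R) : R :=
  edge_int (pos a) (pos b) f.

(* [f K] is the trace taken from inside K on the edge with endpoints a, b. *)
Definition jump0 (f : vertex Th -> vertex Th -> cell -> R -> R) : Prop :=
  forall a b, int_edge a b -> forall K K', edge_of a b K -> edge_of a b K' ->
    K != K' -> int_on a b (fun t => f a b K t - f a b K' t) = 0.

Definition jump1 (f : vertex Th -> vertex Th -> cell -> R -> R) : Prop :=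
  forall a b, int_edge a b -> forall K K', edge_of a b K -> edge_of a b K' ->
    K != K' -> forall p, P1edge p ->
    int_on a b (fun t => p.[t] * (f a b K t - f a b K' t)) = 0.

Definition bdry0 (f : vertex Th -> vertex Th -> cell -> R -> R) : Prop :=
  forall a b, bdry_edge a b -> forall K, edge_of a b K ->
    int_on a b (f a b K) = 0.

Definition bdry1 (f : vertex Th -> vertex Th -> cell -> R -> R) : Prop :=
  forall a b, bdry_edge a b -> forall K, edge_of a b K ->
    forall p, P1edge p -> int_on a b (fun t => p.[t] * f a b K t) = 0.

(* [msize] is one more than the total degree. *)
Definition Pk (k : nat) : set pw :=
  [set w | forall K, (msize (w K) <= k.+1)%N].

Definition Pk0 (k : nat) : set pw := [set w | Pk k w /\ int_Omega w = 0].

Definition G2 : set (pw * pw)%type :=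
  [set v | [/\ Pk 2 v.1, Pk 2 v.2, jump1 (trace v.1) & jump1 (trace v.2)]].

Definition G2t : set (pw * pw)%type := [set v | G2 v /\ bdry1 (trace_t v)].

Definition G20 : set (pw * pw)%type :=
  [set v | [/\ G2 v, bdry1 (trace v.1) & bdry1 (trace v.2)]].

Definition vertex_continuous (w : pw) : Prop :=
  forall (a : vertex Th) (K K' : cell), a \in val K -> a \in val K' ->
    ev (w K) (pos a) = ev (w K') (pos a).

Definition B3 : set pw :=
  [set w | [/\ Pk 3 w, vertex_continuous w, jump0 (trace w)
             & jump1 (trace_dn w)]].

Definition B3t : set pw :=
  [set w | [/\ B3 w,
      forall a (K : cell), bdry_vertex a -> a \in val K ->
        ev (w K) (pos a) = 0
    & bdry0 (trace w)]].

Definition B30 : set pw := [set w | B3t w /\ bdry1 (trace_dn w)].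

End Spaces.

Arguments Pk {R} Th k _ : rename.
Arguments Pk0 {R} Th k _ : rename.
Arguments G2 {R} Omega Th _ : rename.
Arguments G2t {R} Omega Th _ : rename.
Arguments G20 {R} Omega Th _ : rename.
Arguments B3 {R} Omega Th _ : rename.
Arguments B3t {R} Omega Th _ : rename.
Arguments B30 {R} Omega Th _ : rename.

Definition subspace (R : realType) (U : lmodType R) (A : set U) : Prop :=
  A 0 /\ forall (c : R) u v, A u -> A v -> A (c *: u + v).

(* Exactness of 0 -> A -f-> B -g-> C -> 0. *)
Definition short_exact (R : realType) (U V W : lmodType R)
    (A : set U) (B : set V) (C : set W)
    (f : {linear U -> V}) (g : {linear V -> W}) : Prop :=
  [/\ subspace A, subspace B & subspace C] /\
  [/\ f @` A `<=` B /\ g @` B `<=` C, set_inj A f,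
      f @` A = B `&` g @^-1` [set 0] & g @` B = C].
Arguments short_exact R U V W A B C f g : clear implicits.

(* Main.v *)
From HB Require Import structures.
From mathcomp Require Import all_boot all_order all_algebra.
From mathcomp Require Import all_classical all_reals all_analysis.
From mathcomp Require Import measurable_realfun.
From mathcomp Require Import ring lra.
From mathcomp Require Import -(notations) mpoly.
Require Import Defs.

(** For an edge ab and a discrete field v with vanishing moments, the
    circulation s(a,b) of v along ab does not depend on the triangle in which it
    is computed, and it is zero on boundary edges.

    Kernel of rot_h. If rot_h v = 0 then s has zero circulation around every
    triangle. That s is the gradient of a vertex function psi vanishing on the
    boundary is, by linear duality, the statement that jumps across the interior
    edges summing to zero around every interior vertex are the differences of a
    function on triangles. Such jumps are a locally trivial additive cocycle on
    Omega, so this follows from simple connectedness alone; the topology of the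
    closure of Omega, which may be pinched at boundary vertices, never enters.
    On each triangle, v has a cubic potential, which is normalised to interpolate
    psi; the remaining conditions are integrations by parts along edges.

    Surjectivity of rot_h. Conforming edge bubbles realise all families of cell
    integrals with zero sum, because the dual graph is connected; the
    Fortin-Soulie bubbles, quadratics vanishing at the Gauss points of the edges,
    then correct the mean-free affine part triangle by triangle. *)

Set Implicit Arguments.
Unset Strict Implicit.
Unset Printing Implicit Defensive.

Import Order.TTheory GRing.Theory Num.Theory.
Import numFieldNormedType.Exports.

Local Open Scope classical_set_scope.
Local Open Scope ring_scope.

(** * Duality, Lebesgue numbers and primitives of local cocycles *)

(** All edge conditions are rewritten in the frame of tangential and normal traces. The normal
    moments of [grad_h w] are literally the conditions on the normal derivative of [w], so only the
    tangential moments need work, and they see [w] only through its vertex values and edge means.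

    The two sequences share their proofs: injectivity is shown on the larger [B3t], the mean-zero
    property of [rot_h] on the larger [G2t], surjectivity on the smaller [G20]; in the middle, the
    smaller pair only has to transport the normal boundary moments.

    The obstacle is that simple connectedness speaks of homotopies of loops, whereas the unknowns
    live on vertices and triangles. Choosing for every point of [Omega] a triangle that contains it
    turns data on triangles into functions of points. Duality is needed because the vertex function
    is not of this kind, while the jumps of its dual problem are.

    No general integration theory is used beyond exact formulas: all edge integrands are
    polynomials, and the integrands on triangles are affine. *)

Lemma dual_solve (F : fieldType) (I J : finType) (g : I -> J -> F) (s : J -> F) :
  (forall t : J -> F, (forall i, \sum_j g i j * t j = 0) ->
     \sum_j s j * t j = 0) ->
  exists psi : I -> F, forall j, s j = \sum_i psi i * g i j.
Proof.
move=> H.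
pose A := \matrix_(i < #|I|, j < #|J|) g (enum_val i) (enum_val j).
pose S := \row_(j < #|J|) s (enum_val j).
have sum_enum (K : finType) (f : K -> F) :
    \sum_(k < #|K|) f (enum_val k) = \sum_k f k.
  by rewrite [RHS](big_enum_val (A := predT)).
(* The columns of [cokermx A] are test vectors annihilated by every row of [A]. The hypothesis says
   that [S] annihilates them too, which places [S] in the row space; its coefficients there are
   [psi]. *)
have SA : (S <= A)%MS.
  rewrite submxE; apply/eqP/rowP => k; rewrite !mxE.
  have := H (fun j => cokermx A (enum_rank j) k).
  rewrite -(sum_enum J).
  under eq_bigr do rewrite enum_valK.
  move=> H'; under eq_bigr => j _ do rewrite mxE.
  apply: H' => i.
  have /matrixP/(_ (enum_rank i) k) := mulmx_coker A.
  rewrite !mxE; apply: etrans; rewrite -(sum_enum J); apply: eq_bigr => j _.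
  by rewrite enum_valK; congr (_ * _); rewrite mxE enum_rankK.
have /submxP [D SE] := SA.
exists (fun i => D 0 (enum_rank i)) => j.
have /rowP/(_ (enum_rank j)) := SE; rewrite !mxE enum_rankK => ->.
rewrite -(sum_enum I); apply: eq_bigr => i _.
by rewrite enum_valK mxE enum_rankK.
Qed.

(** Stated for a property inherited by subsets rather than for an open cover, so that [Q A] can
    express that an identity holds throughout [A]. The radius is halved to let the centre move. *)
Lemma lebesgue_number {R : realType} {X : pseudoMetricType R} (K : set X)
    (Q : set X -> Prop) :
  (forall A B, A `<=` B -> Q B -> Q A) -> compact K ->
  (forall x, K x -> exists2 r, 0 < r & Q (ball x r)) ->
  exists2 e, 0 < e & forall x, K x -> Q (ball x e).
Proof.
move=> Qsub /compact_near_coveringP cK KQ.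
have /cK : forall x, K x ->
    \forall x' \near x & e \near (0 : R)^'+, Q (ball x' e).
  move=> x /KQ [r r0 Qr].
  exists (ball x (r / 2), [set e | e < r / 2]) => /=.
    split; first by apply: nbhsx_ballx; rewrite divr_gt0.
    by apply: nbhs_right_lt; rewrite divr_gt0.
  move=> [x' e] /= [xx' er]; apply: Qsub Qr => y x'y.
  by apply: (@ball_split _ _ x') => //; apply: le_ball x'y; apply: ltW.
move=> H.
near (0 : R)^'+ => e.
exists e => // x Kx.
suff KQe : K `<=` (fun x => Q (ball x e)) by exact: KQe.
by near: e; exact: H.
Unshelve. all: by end_near.
Qed.

(* The primitive is the sum of [E] along the radius, cut into short steps. *)
Lemma star_primitive {R : realType} {V : normedModType R} (K : set V)
    (E : V -> V -> R) :
  compact K -> (forall x t, K x -> 0 <= t <= 1 -> K (t *: x)) ->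
  (forall x, K x -> exists2 r, 0 < r & forall p q s,
     K p -> K q -> K s -> ball x r p -> ball x r q -> ball x r s ->
     E p q + E q s = E p s) ->
  exists phi, exists2 e, 0 < e & forall p q, K p -> K q -> ball p e q ->
    phi q - phi p = E p q.
Proof.
move=> cK starK locE.
pose Q A := forall p q s, K p -> K q -> K s -> A p -> A q -> A s ->
  E p q + E q s = E p s.
have [||e e0 QE] := @lebesgue_number R V K Q _ cK.
- by move=> A B AB QB p q s *; apply: QB => //; apply: AB.
- by move=> x /locE.
have [M [_ /(_ (M + 1)) ]] := compact_bounded cK.
rewrite ltrDl ltr01 => /(_ isT); set M1 := M + 1 => boundK.
(* The number of steps is uniform in the endpoint because [K] is bounded; each step is then shorter
   than [e / 2]. *)
pose N := (Num.truncn (`|M1| / (e / 2))).+1.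
have N0 : 0 < N%:R :> R by rewrite ltr0n.
have stepN x : K x -> `|x| / N%:R < e / 2.
  move=> Kx; rewrite ltr_pdivrMr// mulrC -ltr_pdivrMr ?divr_gt0//.
  apply: le_lt_trans (truncnS_gt _); rewrite ler_pM2r ?invr_gt0 ?divr_gt0//.
  exact: le_trans (boundK _ Kx) (ler_norm _).
pose pt (x : V) i := (i%:R / N%:R) *: x.
have Kpt x i : K x -> (i <= N)%N -> K (pt x i).
  move=> Kx iN; apply: starK => //.
  by rewrite divr_ge0 ?ler0n//= ler_pdivrMr// mul1r ler_nat.
exists (fun x => \sum_(i < N) E (pt x i) (pt x i.+1)), (e / 2).
  by rewrite divr_gt0.
move=> p q Kp Kq; rewrite -ball_normE /= => pq.
have ptS x i : pt x i.+1 = pt x i + N%:R^-1 *: x.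
  by rewrite /pt -scalerDl -natr1 mulrDl mul1r.
have nearS x i : K x -> `|pt x i - pt x i.+1| < e / 2.
  move=> Kx; rewrite ptS opprD addrA subrr sub0r normrN normrZ.
  by rewrite ger0_norm ?invr_ge0 ?ler0n// mulrC stepN.
have near_pq i : (i <= N)%N -> `|pt p i - pt q i| < e / 2.
  move=> iN; rewrite /pt -scalerBr normrZ; apply: le_lt_trans pq.
  rewrite ler_piMl// ger0_norm ?divr_ge0 ?ler0n//.
  by rewrite ler_pdivrMr// mul1r ler_nat.
have ballpt (x y : V) : `|x - y| < e -> ball x e y by rewrite -ball_normE.
have e2e : e / 2 < e by lra.
(* Both routes from [pt p i] to [pt q i.+1] around a thin quadrilateral have the value
   [E (pt p i) (pt q i.+1)]. The increments telescope to [E p q - E 0 0], and the cocycle identity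
   gives [E 0 0 = 0]. *)
have inc (i : 'I_N) : E (pt q i) (pt q i.+1) - E (pt p i) (pt p i.+1) =
    E (pt p i.+1) (pt q i.+1) - E (pt p i) (pt q i).
  have iN := ltn_ord i; have iN' := ltnW iN.
  have B0 : ball (pt p i) e (pt p i) by apply: ballxx.
  have B1 : ball (pt p i) e (pt p i.+1) by apply/ballpt/(lt_trans _ e2e)/nearS.
  have B2 : ball (pt p i) e (pt q i) by apply/ballpt/(lt_trans _ e2e)/near_pq.
  have B3 : ball (pt p i) e (pt q i.+1).
    apply/ballpt; rewrite -(subrKA (pt p i.+1)) (splitr e).
    by apply: le_lt_trans (ler_normD _ _) _; rewrite ltrD ?nearS ?near_pq.
  have T1 := QE _ (Kpt _ _ Kp iN') _ _ _
    (Kpt _ _ Kp iN') (Kpt _ _ Kp iN) (Kpt _ _ Kq iN) B0 B1 B3.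
  have T2 := QE _ (Kpt _ _ Kp iN') _ _ _
    (Kpt _ _ Kp iN') (Kpt _ _ Kq iN') (Kpt _ _ Kq iN) B0 B2 B3.
  lra.
rewrite -sumrB (eq_bigr _ (fun i _ => inc i)).
rewrite -(big_mkord xpredT
  (fun i => E (pt p i.+1) (pt q i.+1) - E (pt p i) (pt q i))).
rewrite (telescope_sumr (fun i => E (pt p i) (pt q i)))// /pt mul0r !scale0r.
rewrite divff ?gt_eqF// !scale1r.
have K0 : K 0 by rewrite -(scale0r p); apply: starK => //; rewrite lexx ler01.
have B : ball (0 : V) e 0 by apply: ballxx.
have := QE _ K0 _ _ _ K0 K0 K0 B B B.
lra.
Qed.

(** * Holonomy of locally trivial cocycles on a simply connected open set *)

Section Monodromy.
Context {R : realType}.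
Local Notation pt := (R * R)%type.

Lemma locally_constant_segment (psi : R -> R) (e : R) : 0 < e ->
  (forall s t, 0 <= s <= 1 -> 0 <= t <= 1 -> `|s - t| < e -> psi s = psi t) ->
  psi 0 = psi 1.
Proof.
move=> e0 psiP.
pose N := (Num.truncn e^-1).+1.
have N0 : 0 < N%:R :> R by rewrite ltr0n.
have stepN : N%:R^-1 < e.
  by rewrite invf_plt ?posrE//; exact: truncnS_gt.
have H i : (i <= N)%N -> psi (i%:R / N%:R) = psi 0.
  elim: i => [|i IH] iN; first by rewrite mul0r.
  rewrite -IH ?(ltnW iN)//; apply: psiP.
  - by rewrite divr_ge0 ?ler0n//= ler_pdivrMr// mul1r ler_nat.
  - by rewrite divr_ge0 ?ler0n//= ler_pdivrMr// mul1r ler_nat ltnW.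
  - rewrite -natr1 mulrDl mul1r addrAC subrr add0r.
    by rewrite ger0_norm ?invr_ge0 ?ler0n.
by rewrite -(H N)// divff// gt_eqF.
Qed.

Variables (Omega : set pt) (d : pt -> pt -> R).
Hypothesis d_cocycle : forall x, Omega x -> exists2 r, 0 < r &
  ball x r `<=` Omega /\ forall p q s, ball x r p -> ball x r q -> ball x r s ->
    d p q + d q s = d p s.

Lemma cocycle_diag x : Omega x -> d x x = 0.
Proof.
move=> /d_cocycle [r r0 [_ H]].
by have := H x x x (ballxx _ r0) (ballxx _ r0) (ballxx _ r0); lra.
Qed.

(** [K] is any compact set that is star-shaped about 0, so that one statement covers paths, with [K]
    the unit interval, and homotopies, with [K] the unit square. *)
Lemma pullback_primitive (V : normedModType R) (K : set V) (G : V -> pt) :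
  compact K -> (forall x t, K x -> 0 <= t <= 1 -> K (t *: x)) ->
  {within K, continuous G} -> G @` K `<=` Omega ->
  exists phi, exists2 e, 0 < e & forall p q, K p -> K q -> ball p e q ->
    phi q - phi p = d (G p) (G q).
Proof.
move=> cK starK /subspace_continuousP cG GO.
apply: (star_primitive (E := fun p q => d (G p) (G q)) cK starK) => x Kx.
have [r r0 [_ dr]] : exists2 r, 0 < r & ball (G x) r `<=` Omega /\
    forall p q s, ball (G x) r p -> ball (G x) r q -> ball (G x) r s ->
    d p q + d q s = d p s by apply: d_cocycle; apply: GO; exists x.
have /nbhs_ballP [e e0 eP] := cG x Kx _ (nbhsx_ballx (G x) r r0).
by exists e => // p q s Kp Kq Ks bp bq bs; apply: dr; apply: eP.
Qed.

Definition path_primitive (g : R -> pt) (phi : R -> R) :=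
  exists2 e, 0 < e & forall s t, 0 <= s <= 1 -> 0 <= t <= 1 -> `|s - t| < e ->
    phi t - phi s = d (g s) (g t).

(** The analogue of the integral of a closed 1-form along [g]. It is a relation, so that no
    primitive has to be chosen; [holonomy_unique] makes it single-valued. *)
Definition holonomy (g : R -> pt) (v : R) :=
  exists2 phi, path_primitive g phi & v = phi 1 - phi 0.

Lemma path_primitive_exists g : path_in Omega g ->
  exists phi, path_primitive g phi.
Proof.
move=> [cg gO].
have [||phi [e e0 phiP]] := @pullback_primitive R^o `[0, 1] g _ _ cg gO.
- exact: segment_compact.
- move=> x t; rewrite /= !in_itv /= => /andP[x0 x1] /andP[t0 t1].
  rewrite /GRing.scale /=.
  by rewrite mulr_ge0//= -(mulr1 1) ler_pM.
by exists phi, e => // s t s01 t01 st; apply: phiP => //=; rewrite ?in_itv.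
Qed.

Lemma holonomy_unique g u v : holonomy g u -> holonomy g v -> u = v.
Proof.
move=> [phi [e e0 phiP] ->] [psi [e' e'0 psiP] ->].
have m0 : 0 < Num.min e e' by rewrite lt_min e0 e'0.
suff : phi 0 - psi 0 = phi 1 - psi 1 by lra.
apply: (@locally_constant_segment (fun t => phi t - psi t) _ m0) => s t s01 t01.
rewrite lt_min => /andP[st st'].
have := phiP _ _ s01 t01 st; have := psiP _ _ s01 t01 st'; lra.
Qed.

(** The retraction of the line onto the unit interval: composing with it makes a path continuous on
    the whole line. *)
Definition clamp (t : R) : R := Num.max 0 (Num.min 1 t).

Lemma clamp_itv t : 0 <= clamp t <= 1.
Proof. by rewrite /clamp le_max lexx /= ge_max ler01 ge_min lexx. Qed.

Lemma clamp_le0 t : t <= 0 -> clamp t = 0.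
Proof.
move=> t0; rewrite /clamp min_r; last by apply: le_trans ler01.
by rewrite max_l.
Qed.

Lemma clamp_ge1 t : 1 <= t -> clamp t = 1.
Proof. by move=> t1; rewrite /clamp min_l// max_r. Qed.

Lemma clampE t : 0 <= t <= 1 -> clamp t = t.
Proof. by case/andP=> t0 t1; rewrite /clamp min_r// max_r. Qed.

Lemma continuous_clamp : continuous clamp.
Proof.
move=> t; rewrite /clamp.
apply: continuous_max; first exact: cvg_cst.
by apply: continuous_min; [exact: cvg_cst|exact: cvg_id].
Qed.

Lemma path_clamp_continuous g : path_in Omega g -> continuous (g \o clamp).
Proof.
move=> [/subspace_continuousP cg _] t U.
have I01 : (`[0, 1]%classic : set R) (clamp t) by rewrite /= in_itv /= clamp_itv.
move=> /(cg _ I01) /continuous_clamp cU.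
change (nbhs t ((g \o clamp) @^-1` U)); move: cU.
apply: (@filterS _ (nbhs t)) => s /=; apply.
by rewrite /= in_itv /= clamp_itv.
Qed.

(* Written as a sum, so that continuity needs no gluing. *)
Definition path_cat (g h : R -> pt) (t : R) : pt :=
  g (clamp (2 * t)) + h (clamp (2 * t - 1)) - g 1.

Lemma path_cat_l g h t : g 1 = h 0 -> 0 <= t <= 1 ->
  path_cat g h (t / 2) = g t.
Proof.
move=> gh t01; rewrite /path_cat mulrC divfK ?pnatr_eq0// (clamp_le0 (t := _ - 1)).
  by rewrite -gh clampE// addrK.
by lra.
Qed.

Lemma path_cat_r g h t : g 1 = h 0 -> 0 <= t <= 1 ->
  path_cat g h ((t + 1) / 2) = h t.
Proof.
move=> gh t01; rewrite /path_cat mulrC divfK ?pnatr_eq0// clamp_ge1; last by lra.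
by rewrite addrK clampE// [g 1 + _]addrC addrK.
Qed.

Lemma path_in_cat g h : g 1 = h 0 -> path_in Omega g -> path_in Omega h ->
  path_in Omega (path_cat g h).
Proof.
move=> gh pg ph; split.
  apply: continuous_subspaceT => t.
  have c2 : continuous (fun t : R => 2 * t : R).
    by move=> u; apply: cvgM; [exact: cvg_cst|exact: cvg_id].
  have c21 : continuous (fun t : R => 2 * t - 1 : R).
    by move=> u; apply: cvgB; [exact: c2|exact: cvg_cst].
  apply: cvgB; last exact: cvg_cst.
  apply: cvgD.
    apply: (@continuous_comp _ _ _ (fun t : R => 2 * t : R) (g \o clamp)).
      exact: c2.
    exact: path_clamp_continuous.
  apply: (@continuous_comp _ _ _ (fun t : R => 2 * t - 1 : R) (h \o clamp)).
    exact: c21.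
  exact: path_clamp_continuous.
move=> _ [t + <-]; rewrite /= in_itv /= => t01.
have [t2|t2] := leP t (1 / 2).
  have -> : t = (2 * t) / 2 by field.
  rewrite path_cat_l//; last by lra.
  by apply: pg.2; exists (2 * t) => //; rewrite /= in_itv /=; lra.
have -> : t = (2 * t - 1 + 1) / 2 by field.
rewrite path_cat_r//; last by lra.
by apply: ph.2; exists (2 * t - 1) => //; rewrite /= in_itv /=; lra.
Qed.

(** A primitive along the concatenation restricts, after reparametrisation, to primitives along both
    halves; uniqueness identifies their increments with [u] and [v]. *)
Lemma holonomy_cat g h u v : g 1 = h 0 -> path_in Omega g -> path_in Omega h ->
  holonomy g u -> holonomy h v -> holonomy (path_cat g h) (u + v).
Proof.
move=> gh pg ph gu hv.
have [phi [e e0 phiP]] := path_primitive_exists (path_in_cat gh pg ph).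
have gu' : holonomy g (phi (1 / 2) - phi (0 / 2)).
  exists (fun t => phi (t / 2)) => //; exists e => // s t s01 t01 st.
  rewrite phiP ?path_cat_l//; [lra|lra|].
  rewrite -mulrBl normrM; apply: le_lt_trans st.
  by rewrite ler_piMr// ger0_norm; lra.
have hv' : holonomy h (phi ((1 + 1) / 2) - phi ((0 + 1) / 2)).
  exists (fun t => phi ((t + 1) / 2)) => //; exists e => // s t s01 t01 st.
  rewrite phiP ?path_cat_r//; [lra|lra|].
  rewrite -mulrBl normrM opprD addrACA subrr addr0; apply: le_lt_trans st.
  by rewrite ler_piMr// ger0_norm; lra.
rewrite (holonomy_unique gu gu') (holonomy_unique hv hv').
exists phi; first by exists e.
rewrite mul0r add0r (_ : (1 + 1) / 2 = 1 :> R); first by lra.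
by rewrite divff// pnatr_eq0.
Qed.

Definition path_rev (g : R -> pt) (t : R) : pt := g (1 - t).

Lemma path_in_rev g : path_in Omega g -> path_in Omega (path_rev g).
Proof.
move=> pg; split.
  have /(@continuous_subspaceT _ _ (`[0, 1]%classic : set R)) : continuous
      ((g \o clamp) \o (fun t : R => 1 - t : R)).
    move=> t; apply: continuous_comp; last exact: path_clamp_continuous.
    by apply: cvgB; [exact: cvg_cst|exact: cvg_id].
  apply: subspace_eq_continuous => t; rewrite inE /= in_itv /= => t01.
  by rewrite /from_subspace /path_rev /= clampE//; lra.
move=> _ [t + <-]; rewrite /= in_itv /= => t01.
by apply: pg.2; exists (1 - t) => //; rewrite /= in_itv /=; lra.
Qed.

Lemma holonomy_rev g v : path_in Omega g ->
  holonomy g v -> holonomy (path_rev g) (- v).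
Proof.
move=> pg [phi [e e0 phiP] ->].
exists (fun t => phi (1 - t)); last by rewrite subrr subr0; lra.
exists e => // s t s01 t01 st.
have s01' : 0 <= 1 - s <= 1 by lra.
have t01' : 0 <= 1 - t <= 1 by lra.
by rewrite phiP// (_ : _ - _ = t - s) 1?distrC//; ring.
Qed.

Lemma ball_along (x y z : pt) (r t : R) : 0 <= t <= 1 -> ball x r y ->
  ball x r z -> ball x r (along y z t).
Proof.
have H (a b c : R) : 0 <= t <= 1 -> ball a r b -> ball a r c ->
    ball a r ((1 - t) * b + t * c).
  rewrite -!ball_normE /= => t01.
  rewrite !ltr_norml => /andP[h1 h2] /andP[h3 h4].
  by have [t2|t2] := leP t (1 / 2); apply/andP; split; nra.
by move=> t01 [y1 y2] [z1 z2]; split; apply: H.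
Qed.

Lemma along_continuous (y z : pt) : continuous (along y z).
Proof.
have c1 : continuous (fun t : R => 1 - t : R).
  by move=> t; apply: cvgB; [exact: cvg_cst|exact: cvg_id].
have H (a b : R) : continuous (fun t : R => (1 - t) * a + t * b : R).
  move=> t; apply: cvgD; apply: cvgM; try exact: cvg_cst; first exact: c1.
  exact: cvg_id.
by move=> t; exact: (cvg_pair (H y.1 z.1 t) (H y.2 z.2 t)).
Qed.

Lemma along0 (y z : pt) : along y z 0 = y.
Proof. by rewrite /along subr0 !mul1r !mul0r !addr0 -surjective_pairing. Qed.

Lemma along1 (y z : pt) : along y z 1 = z.
Proof. by rewrite /along subrr !mul1r !mul0r !add0r -surjective_pairing. Qed.

(** Inside a ball where the cocycle identity holds, [d y] itself is a primitive along every segment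
    issuing from [y]. *)
Lemma holonomy_along x r y z : ball x r `<=` Omega ->
  (forall p q s, ball x r p -> ball x r q -> ball x r s -> d p q + d q s = d p s) ->
  ball x r y -> ball x r z ->
  path_in Omega (along y z) /\ holonomy (along y z) (d y z).
Proof.
move=> xO dr xy xz; split; [split|].
- by apply: continuous_subspaceT; exact: along_continuous.
- move=> _ [t + <-]; rewrite /= in_itv /= => t01; apply: xO.
  exact: ball_along.
- exists (fun t => d y (along y z t)).
    exists 1 => // s t s01 t01 _.
    by rewrite -(dr y (along y z s)) 1?addrC ?addKr//; exact: ball_along.
  by rewrite along0 along1 (cocycle_diag (xO _ xy)) subr0.
Qed.

Hypothesis Omega_sc : simply_connected Omega.

(** The cocycle, pulled back by the homotopy, has a primitive [phi] on the unit square. On three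
    sides of the square the homotopy is constant, hence so is [phi]; the increment of [phi] along
    the fourth side is the holonomy of [g]. *)
Lemma loop_holonomy g v : path_in Omega g -> g 0 = g 1 -> holonomy g v -> v = 0.
Proof.
move=> pg g01 gv; have [H [cH HO H0 H1 Hs]] := Omega_sc.2 g pg g01.
have Og : Omega (g 0) by apply: pg.2; exists 0 => //; rewrite /= in_itv /= lexx ler01.
have I0 : 0 <= (0 : R) <= 1 by rewrite lexx ler01.
have I1 : 0 <= (1 : R) <= 1 by rewrite lexx ler01.
have [||phi [e e0 phiP]] := pullback_primitive (K := (`[0, 1]%classic : set R^o) `*` (`[0, 1]%classic : set R^o)) _ _ cH HO.
- by apply: compact_setX; exact: segment_compact.
- move=> x t [] /=; rewrite !in_itv /= => /andP[x0 x1] /andP[y0 y1] /andP[t0 t1].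
  split; rewrite /GRing.scale /=.
    by rewrite mulr_ge0//= -(mulr1 1) ler_pM.
  by rewrite mulr_ge0//= -(mulr1 1) ler_pM.
have phiE s t s' t' : 0 <= s <= 1 -> 0 <= t <= 1 -> 0 <= s' <= 1 ->
    0 <= t' <= 1 -> `|s - s'| < e -> `|t - t'| < e ->
    phi (s', t') - phi (s, t) = d (H (s, t)) (H (s', t')).
  move=> *; apply: phiP; [by split; rewrite /= in_itv|by split; rewrite /= in_itv|].
  by split; rewrite -ball_normE.
have dg0 := cocycle_diag Og.
have E0 (a : R) : `|a - a| < e by rewrite subrr normr0.
have P1 : phi (0, 0) = phi (1, 0).
  apply: (@locally_constant_segment (fun s => phi (s, 0)) e) => // s t s01 t01 st.
  by have := phiE s 0 t 0 s01 I0 t01 I0 st (E0 0); rewrite (Hs s s01).1 (Hs t t01).1 dg0; lra.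
have P2 : phi (0, 1) = phi (1, 1).
  apply: (@locally_constant_segment (fun s => phi (s, 1)) e) => // s t s01 t01 st.
  by have := phiE s 1 t 1 s01 I1 t01 I1 st (E0 1); rewrite (Hs s s01).2 (Hs t t01).2 dg0; lra.
have P3 : phi (1, 0) = phi (1, 1).
  apply: (@locally_constant_segment (fun s => phi (1, s)) e) => // s t s01 t01 st.
  by have := phiE 1 s 1 t I1 s01 I1 t01 (E0 1) st; rewrite !H1// dg0; lra.
suff gv' : holonomy g (phi (0, 1) - phi (0, 0)).
  by rewrite (holonomy_unique gv gv') P2 P1 P3 subrr.
exists (fun t => phi (0, t)) => //; exists e => // s t s01 t01 st.
by rewrite phiE// !H0.
Qed.

(** The primitive at [y] is the holonomy of a chosen path from a base point to [y]. For nearby [y]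
    and [z], the path to [y], the segment from [y] to [z] and the reversed path to [z] form a loop,
    whose holonomy vanishes. *)
Lemma simply_connected_primitive : exists f : pt -> R,
  forall x, Omega x -> exists2 r, 0 < r & ball x r `<=` Omega /\
    forall p q, ball x r p -> ball x r q -> f q - f p = d p q.
Proof.
have [[x0 Ox0]|O0] := pselect (Omega !=set0); last first.
  by exists (fun=> 0) => x Ox; case: O0; exists x.
have pathP y : exists gv : (R -> pt) * R, Omega y ->
    [/\ path_in Omega gv.1, gv.1 0 = x0, gv.1 1 = y & holonomy gv.1 gv.2].
  have [Oy|nOy] := pselect (Omega y); last by exists ((fun=> 0), 0).
  have [g [pg g0 g1]] := Omega_sc.1 x0 y Ox0 Oy.
  have [phi phiP] := path_primitive_exists pg.
  by exists (g, phi 1 - phi 0) => _; split => //; exists phi.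
have [gv gvP] := choice pathP.
exists (fun y => (gv y).2) => x Ox.
have [r r0 [xO dr]] := d_cocycle Ox.
exists r => //; split => // y z xy xz.
have [pgy gy0 gy1 hy] := gvP y (xO _ xy).
have [pgz gz0 gz1 hz] := gvP z (xO _ xz).
have [ps hs] := holonomy_along xO dr xy xz.
have gs : (gv y).1 1 = along y z 0 by rewrite gy1 along0.
have pc := path_in_cat gs pgy ps; have hc := holonomy_cat gs pgy ps hy hs.
have I0 : 0 <= (0 : R) <= 1 by rewrite lexx ler01.
have I1 : 0 <= (1 : R) <= 1 by rewrite lexx ler01.
have hc0 : path_cat (gv y).1 (along y z) 0 = x0.
  by rewrite -(mul0r 2^-1) path_cat_l.
have hc1 : path_cat (gv y).1 (along y z) 1 = z.
  rewrite -[X in path_cat _ _ X](_ : (1 + 1) / 2 = 1) ?path_cat_r ?along1//.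
  by rewrite divff// pnatr_eq0.
have gr : path_cat (gv y).1 (along y z) 1 = path_rev (gv z).1 0.
  by rewrite hc1 /path_rev subr0 gz1.
have pl := path_in_cat gr pc (path_in_rev pgz).
have hl := holonomy_cat gr pc (path_in_rev pgz) hc (holonomy_rev pgz hz).
have := loop_holonomy pl _ hl; rewrite -{1}(mul0r 2^-1) path_cat_l// hc0.
rewrite -[X in path_cat _ _ X](_ : (1 + 1) / 2 = 1); last first.
  by rewrite divff// pnatr_eq0.
rewrite path_cat_r// /path_rev subrr gz0 => /(_ erefl); lra.
Qed.

End Monodromy.

(** * Polynomials on edges and in the plane *)

Section PolynomialIntegral.
Context {R : realType}.
Notation mu := (@lebesgue_measure R).
Implicit Types (p q : {poly R}) (a b c : R).

Lemma poly_antiderivative p : {q : {poly R} | q^`() = p}.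
Proof.
exists (\poly_(i < (size p).+1) (p`_i.-1 / i%:R)).
apply/polyP => i; rewrite coef_deriv coef_poly ltnS /=.
case: ltnP => [ip|pi]; last by rewrite mul0rn nth_default.
by rewrite -[LHS]mulr_natr divfK// pnatr_eq0.
Qed.

Lemma integral_deriv p a b : a <= b ->
  (\int[mu]_(x in `[a, b]) (p^`().[x])%:E = (p.[b] - p.[a])%:E)%E.
Proof.
rewrite le_eqVlt => /predU1P[->|ab].
  by rewrite set_itv1 integral_set1 subrr.
rewrite (@continuous_FTC2 _ _ (horner p))//.
- by apply: continuous_subspaceT => x; exact: continuous_horner.
- split=> [x _| |]; first exact: derivable_horner.
  + by apply: cvg_at_right_filter; exact: continuous_horner.
  + by apply: cvg_at_left_filter; exact: continuous_horner.
- by move=> x _; rewrite derivE.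
Qed.

Definition int01 p : R := Rintegral mu `[0, 1] (horner p).

Lemma int01_deriv p : int01 p^`() = p.[1] - p.[0].
Proof. by rewrite /int01 /Rintegral integral_deriv. Qed.

Lemma int01D p q : int01 (p + q) = int01 p + int01 q.
Proof.
have [P <-] := poly_antiderivative p; have [Q <-] := poly_antiderivative q.
by rewrite -derivD !int01_deriv !hornerD; ring.
Qed.

Lemma int01Z c p : int01 (c *: p) = c * int01 p.
Proof.
have [P <-] := poly_antiderivative p.
by rewrite -derivZ !int01_deriv !hornerZ; ring.
Qed.

Lemma int01_0 : int01 0 = 0.
Proof. by rewrite -(scale0r 0) int01Z mul0r. Qed.

Lemma int01N p : int01 (- p) = - int01 p.
Proof. by rewrite -scaleN1r int01Z mulN1r. Qed.

Lemma int01B p q : int01 (p - q) = int01 p - int01 q.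
Proof. by rewrite int01D int01N. Qed.

Lemma int01_parts p q :
  int01 (p * q^`()) = p.[1] * q.[1] - p.[0] * q.[0] - int01 (p^`() * q).
Proof.
have := int01_deriv (p * q); rewrite derivM int01D !hornerE; lra.
Qed.

(** Degree three suffices for the explicit computations: the trace of a quadratic, possibly times an
    affine weight. *)
Lemma int01_cubic a b c d (f : R -> R) :
  (forall t, f t = a + b * t + c * t ^+ 2 + d * t ^+ 3) ->
  Rintegral mu `[0, 1] f = a + b / 2 + c / 3 + d / 4.
Proof.
move=> fE.
pose P := a%:P * 'X + (b / 2)%:P * 'X^2 + (c / 3)%:P * 'X^3 + (d / 4)%:P * 'X^4.
have -> : f = horner P^`().
  by apply/funext => t; rewrite fE /P !poly.derivE !hornerE /=; field.
by have := int01_deriv P; rewrite /int01 => ->; rewrite /P !hornerE /=; field.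
Qed.

Lemma edge_intE (x y : R * R) (f : R -> R) p : (forall t, f t = p.[t]) ->
  edge_int x y f = edist x y * int01 p.
Proof. by move=> fE; rewrite /edge_int /int01; congr (_ * _); congr Rintegral; apply/funext. Qed.

Lemma edist_gt0 (x y : R * R) : x <> y -> 0 < edist x y.
Proof.
move=> xy; rewrite sqrtr_gt0 lt_neqAle eq_sym addr_ge0 ?sqr_ge0// andbT.
rewrite paddr_eq0 ?sqr_ge0// !sqrf_eq0 !subr_eq0; apply/negP => /andP[/eqP e1 /eqP e2].
by apply: xy; rewrite (surjective_pairing x) -e1 -e2 -surjective_pairing.
Qed.

Lemma edge_int_eq0 (x y : R * R) (f : R -> R) p : x <> y ->
  (forall t, f t = p.[t]) -> edge_int x y f = 0 <-> int01 p = 0.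
Proof.
move=> xy fE; rewrite (edge_intE x y fE); split=> [/eqP|->]; last by rewrite mulr0.
by rewrite mulf_eq0 gt_eqF ?edist_gt0//= => /eqP.
Qed.

End PolynomialIntegral.

(** * Bivariate polynomials: restriction to edges, potentials, normal forms *)

Section PlanePolynomials.
Context {R : realType}.
Local Notation pt := (R * R)%type.
Implicit Types (p q : mpoly 2 R) (a b x : pt).

Definition mpX : mpoly 2 R := mpolyX R (mnm1 ord0).
Definition mpY : mpoly 2 R := mpolyX R (mnm1 ord_max).

Lemma mpolyX2 (m : multinom 2) : mpolyX R m = mpX ^+ (m ord0) * mpY ^+ (m ord_max).
Proof.
rewrite mpolyXE_id big_ord_recl big_ord1.
by rewrite (_ : lift ord0 ord0 = ord_max)//; exact: val_inj.
Qed.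

Lemma mdeg2 (m : multinom 2) : mdeg m = (m ord0 + m ord_max)%N.
Proof.
rewrite mdegE big_ord_recl big_ord1.
by rewrite (_ : lift ord0 ord0 = ord_max)//; exact: val_inj.
Qed.

Lemma ord2 (i : 'I_2) : i = ord0 \/ i = ord_max.
Proof. by case: i => [[|[|]]] // H; [left|right]; exact: val_inj. Qed.

Lemma mpoly_ring_ind (P : mpoly 2 R -> Prop) :
  (forall c, P (mpolyC 2 c)) -> P mpX -> P mpY ->
  (forall p q, P p -> P q -> P (p + q)) ->
  (forall p q, P p -> P q -> P (p * q)) -> forall p, P p.
Proof.
move=> PC PX PY PD PM p; rewrite (mpolyE p); elim/big_ind: _ => //.
  by rewrite -mpolyC0; exact: PC.
have PE q k : P q -> P (q ^+ k).
  move=> Pq; elim: k => [|k IH]; first by rewrite expr0 -mpolyC1; exact: PC.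
  by rewrite exprS; exact: PM.
by move=> m _; rewrite -mul_mpolyC mpolyX2; apply: (PM) => //; apply: PM; exact: PE.
Qed.

Lemma evC c x : ev (mpolyC 2 c) x = c. Proof. exact: mevalC. Qed.
Lemma evX x : ev mpX x = x.1. Proof. by rewrite /ev mevalXU. Qed.
Lemma evY x : ev mpY x = x.2. Proof. by rewrite /ev mevalXU. Qed.
Lemma evD p q x : ev (p + q) x = ev p x + ev q x. Proof. exact: mevalD. Qed.
Lemma evB p q x : ev (p - q) x = ev p x - ev q x. Proof. exact: mevalB. Qed.
Lemma evN p x : ev (- p) x = - ev p x. Proof. exact: mevalN. Qed.
Lemma evM p q x : ev (p * q) x = ev p x * ev q x. Proof. exact: mevalM. Qed.
Lemma evZ c p x : ev (c *: p) x = c * ev p x. Proof. exact: mevalZ. Qed.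
Lemma ev0 x : ev 0 x = 0. Proof. by rewrite -mpolyC0 evC. Qed.

Lemma dxC c : dx (mpolyC 2 c) = 0 :> mpoly 2 R. Proof. exact: mderivC. Qed.
Lemma dyC c : dy (mpolyC 2 c) = 0 :> mpoly 2 R. Proof. exact: mderivC. Qed.

Lemma mderivU (i j : 'I_2) : mderiv i (mpolyX R (mnm1 j)) = mpolyC 2 (i == j)%:R.
Proof.
rewrite mderivX mnm1E eq_sym; case: eqP => [->|_]; last by rewrite scale0r mpolyC0.
by rewrite scale1r mpolyC1 -mpolyX0; congr mpolyX; apply/mnmP => k; rewrite mnmBE subnn mnm0E.
Qed.

Lemma dxX : dx mpX = mpolyC 2 1. Proof. exact: mderivU. Qed.
Lemma dxY : dx mpY = mpolyC 2 0. Proof. exact: mderivU. Qed.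
Lemma dyX : dy mpX = mpolyC 2 0. Proof. exact: mderivU. Qed.
Lemma dyY : dy mpY = mpolyC 2 1. Proof. exact: mderivU. Qed.
Lemma dxD p q : dx (p + q) = dx p + dx q. Proof. exact: mderivD. Qed.
Lemma dyD p q : dy (p + q) = dy p + dy q. Proof. exact: mderivD. Qed.
Lemma dxM p q : dx (p * q) = dx p * q + p * dx q. Proof. exact: mderivM. Qed.
Lemma dyM p q : dy (p * q) = dy p * q + p * dy q. Proof. exact: mderivM. Qed.
Lemma dxZ c p : dx (c *: p) = c *: dx p. Proof. exact: mderivZ. Qed.
Lemma dyZ c p : dy (c *: p) = c *: dy p. Proof. exact: mderivZ. Qed.

Definition evE := (evC, evX, evY, evD, evN, evM, evZ).
Definition dxyE := (dxC, dyC, dxX, dxY, dyX, dyY, dxD, dyD, dxM, dyM, dxZ, dyZ).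

(** The restriction to the edge as a univariate polynomial in the parameter of [along]; edge
    integrals thereby become algebra on [{poly R}]. *)
Definition etrace p a b : {poly R} :=
  mmap (@polyC R) (fun i : 'I_2 => if i == ord0 then a.1%:P + (b.1 - a.1)%:P * 'X
                          else a.2%:P + (b.2 - a.2)%:P * 'X) p.

Lemma etraceC c a b : etrace (mpolyC 2 c) a b = c%:P. Proof. exact: mmapC. Qed.
Lemma etraceD p q a b : etrace (p + q) a b = etrace p a b + etrace q a b.
Proof. exact: mmapD. Qed.
Lemma etraceM p q a b : etrace (p * q) a b = etrace p a b * etrace q a b.
Proof. exact: rmorphM. Qed.
Lemma etraceZ (k : R) p a b : etrace (k *: p) a b = k *: etrace p a b.
Proof. by rewrite -mul_mpolyC etraceM etraceC mul_polyC. Qed.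

Lemma etraceX a b : etrace mpX a b = a.1%:P + (b.1 - a.1)%:P * 'X.
Proof. by rewrite /etrace mmapX mmap1U. Qed.
Lemma etraceY a b : etrace mpY a b = a.2%:P + (b.2 - a.2)%:P * 'X.
Proof. by rewrite /etrace mmapX mmap1U. Qed.

Lemma etraceE p a b t : ev p (along a b t) = (etrace p a b).[t].
Proof.
elim/mpoly_ring_ind: p => [c||| p q Hp Hq|p q Hp Hq].
- by rewrite evC etraceC hornerC.
- by rewrite evX etraceX !hornerE /along /=; ring.
- by rewrite evY etraceY !hornerE /along /=; ring.
- by rewrite evD etraceD hornerD Hp Hq.
- by rewrite evM etraceM hornerM Hp Hq.
Qed.

Lemma deriv_etrace p a b : (etrace p a b)^`() =
  (b.1 - a.1) *: etrace (dx p) a b + (b.2 - a.2) *: etrace (dy p) a b.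
Proof.
elim/mpoly_ring_ind: p => [c||| p q Hp Hq|p q Hp Hq].
- by rewrite !dxyE -mpolyC0 !etraceC derivC !scaler0 addr0.
- by rewrite !dxyE !etraceC etraceX !poly.derivE -!mul_polyC polyC0; ring.
- by rewrite !dxyE !etraceC etraceY !poly.derivE -!mul_polyC polyC0; ring.
- by rewrite !dxyE !etraceD derivD Hp Hq -!mul_polyC; ring.
- by rewrite !dxyE !(etraceD, etraceM) derivM Hp Hq -!mul_polyC; ring.
Qed.

Lemma msize_mderiv (i : 'I_2) p k : (msize p <= k.+1)%N -> (msize (mderiv i p) <= k)%N.
Proof.
move=> pk; rewrite msizeE; apply/bigmax_leqP_seq => m + _.
rewrite mcoeff_msupp mcoeff_deriv => mp.
have : (mnm_add m (mnm1 i)) \in msupp p.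
  by rewrite mcoeff_msupp; apply: contraNneq mp => ->; rewrite mul0rn.
by move=> /msize_mdeg_lt; rewrite mdegD mdeg1 addn1 => H; rewrite -ltnS (leq_trans H).
Qed.

(** The Poincaré lemma on coefficients: a monomial that contains the first variable is obtained by
    integrating [p] in that variable, the others by integrating [q] in the second variable. *)
Lemma potential_exists p q k : (msize p <= k.+1)%N -> (msize q <= k.+1)%N ->
  dx q = dy p -> exists w, [/\ (msize w <= k.+2)%N, dx w = p & dy w = q].
Proof.
move=> pk qk cf.
pose E (m : multinom 2) : R :=
  if (0 < m ord0)%N then mcoeff (mnm_sub m (mnm1 ord0)) p / (m ord0)%:R
  else mcoeff (mnm_sub m (mnm1 ord_max)) q / (m ord_max)%:R.
pose w := \sum_(m : bmultinom 2 k.+2) E m *: mpolyX R m.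
have wE m : (mdeg m < k.+2)%N -> mcoeff m w = E m by exact: mcoeff_mpoly.
have wk : (msize w <= k.+2)%N.
  apply: leq_trans (msize_sum _ _ _) _; apply/bigmax_leqP => m _.
  by apply: leq_trans (msizeZ_le _ _) _; rewrite msizeX; exact: bmdeg.
have U01 : (mnm1 ord0 : multinom 2) ord_max = 0%N by rewrite mnm1E.
have U10 : (mnm1 ord_max : multinom 2) ord0 = 0%N by rewrite mnm1E.
have w0 m : (k.+1 < mdeg m)%N -> mcoeff m w = 0.
  move=> km; apply/eqP; rewrite mcoeff_eq0; apply: msize_mdeg_ge.
  exact: leq_trans wk km.
have small r m : (msize r <= k.+1)%N -> (k < mdeg m)%N -> mcoeff m r = 0.
  move=> rk km; apply/eqP; rewrite mcoeff_eq0; apply: msize_mdeg_ge.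
  exact: leq_trans rk km.
exists w; split=> //; apply/mpolyP => m; rewrite mcoeff_deriv.
  have [mk|km] := leqP (mdeg m) k; last first.
    by rewrite w0 ?mul0rn ?small// mdegD mdeg1 addn1.
  rewrite wE; last by rewrite mdegD mdeg1 addn1 !ltnS.
  rewrite /E mnmDE mnm1E eqxx addn1 /= -[LHS]mulr_natr divfK ?pnatr_eq0//.
  by rewrite addmK.
have [mk|km] := leqP (mdeg m) k; last first.
  by rewrite w0 ?mul0rn ?small// mdegD mdeg1 addn1.
rewrite wE; last by rewrite mdegD mdeg1 addn1 !ltnS.
rewrite /E !mnmDE U10 !mnm1E eqxx addn0 addn1 addmK.
case: ltnP => [m0|_]; last by rewrite -[LHS]mulr_natr divfK// pnatr_eq0.
set n := (mnm_sub m (mnm1 ord0)).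
have mE : m = (mnm_add n (mnm1 ord0)).
  apply/mnmP => i; rewrite mnmDE mnmBE subnK// mnm1E.
  by case: eqP => // <-.
have -> : (mnm_sub (mnm_add m (mnm1 ord_max)) (mnm1 ord0)) = (mnm_add n (mnm1 ord_max)).
  by rewrite mE -addmA [mnm_add (mnm1 ord0) _]addmC addmA addmK.
(* A mixed monomial was integrated from [p]; the hypothesis [dx q = dy p], read at the exponent [n],
   converts its coefficient into the one that [q] requires. *)
have /mpolyP/(_ n) := cf; rewrite !mcoeff_deriv -mE.
have -> : (n ord_max).+1 = (m ord_max).+1 by rewrite mnmBE U01 subn0.
have -> : (n ord0).+1 = m ord0.
  by rewrite mnmBE mnm1E eqxx subn1 prednK.
move=> H; rewrite -[LHS]mulr_natr mulrAC mulr_natr -H -[X in X / _]mulr_natr mulfK//.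
by rewrite pnatr_eq0 -lt0n.
Qed.

Lemma grad_eq0 p : dx p = 0 -> dy p = 0 -> p = mpolyC 2 (mcoeff (@mnm0 2) p).
Proof.
move=> dx0 dy0; apply/mpolyP => m; rewrite mcoeffC.
case: eqP => [->|m0]; first by rewrite mulr1.
rewrite mulr0; have [i mi] : exists i, (0 < m i)%N.
  apply: contra_notP m0 => m0; apply/mnmP => i; apply/eqP.
  by rewrite mnm0E -leqn0 leqNgt; apply/negP => mi; apply: m0; exists i.
have /mpolyP/(_ (mnm_sub m (mnm1 i))) : mderiv i p = 0.
  by case: (ord2 i) => ->.
rewrite mcoeff_deriv mcoeff0.
have -> : (mnm_add (mnm_sub m (mnm1 i)) (mnm1 i)) = m.
  by apply/mnmP => j; rewrite mnmDE mnmBE subnK// mnm1E; case: eqP => // <-.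
by move/eqP; rewrite mulrn_eq0 /= => /eqP.
Qed.

(** A normal form with named coefficients: identities between quadratics, their derivatives and
    their integrals reduce to [field]. *)
Definition quad c0 c1 c2 c3 c4 c5 : mpoly 2 R :=
  mpolyC 2 c0 + c1 *: mpX + c2 *: mpY + c3 *: (mpX * mpX) + c4 *: (mpX * mpY)
  + c5 *: (mpY * mpY).

Lemma ev_quad c0 c1 c2 c3 c4 c5 x : ev (quad c0 c1 c2 c3 c4 c5) x =
  c0 + c1 * x.1 + c2 * x.2 + c3 * x.1 ^+ 2 + c4 * x.1 * x.2 + c5 * x.2 ^+ 2.
Proof. by rewrite !evE; ring. Qed.

Lemma quadD c0 c1 c2 c3 c4 c5 d0 d1 d2 d3 d4 d5 :
  quad c0 c1 c2 c3 c4 c5 + quad d0 d1 d2 d3 d4 d5 =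
  quad (c0 + d0) (c1 + d1) (c2 + d2) (c3 + d3) (c4 + d4) (c5 + d5).
Proof. by rewrite /quad mpolyCD !scalerDl; ring. Qed.

Lemma dx_quad c0 c1 c2 c3 c4 c5 :
  dx (quad c0 c1 c2 c3 c4 c5) = quad c1 (2 * c3) c4 0 0 0.
Proof.
by rewrite /quad !dxyE -!mul_mpolyC !mpolyCM !mpolyC0 (mpolyC_nat 2); ring.
Qed.

Lemma dy_quad c0 c1 c2 c3 c4 c5 :
  dy (quad c0 c1 c2 c3 c4 c5) = quad c2 c4 (2 * c5) 0 0 0.
Proof.
by rewrite /quad !dxyE -!mul_mpolyC !mpolyCM !mpolyC0 (mpolyC_nat 2); ring.
Qed.

Lemma quadP p : (msize p <= 3)%N ->
  exists c0 c1 c2 c3 c4 c5, p = quad c0 c1 c2 c3 c4 c5.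
Proof.
move=> p3; rewrite (mpolyE p) big_seq_cond; elim/big_rec: _.
  by exists 0, 0, 0, 0, 0, 0; rewrite /quad mpolyC0 !scale0r !addr0.
move=> m q; rewrite andbT => /msize_mdeg_lt/leq_trans/(_ p3) m3.
case=> [d0 [d1 [d2 [d3 [d4 [d5 ->]]]]]]; move: (mcoeff m p) => c.
suff [c0 [c1 [c2 [c3 [c4 [c5 ->]]]]]] : exists c0 c1 c2 c3 c4 c5,
    c *: mpolyX R m = quad c0 c1 c2 c3 c4 c5 by rewrite quadD; do 6!eexists.
move: m3; rewrite mdeg2 mpolyX2 /quad -mul_mpolyC.
case: (m ord0) => [|[|[|]]]; case: (m ord_max) => [|[|[|]]] // _.
- by exists c, 0, 0, 0, 0, 0; rewrite -?mul_mpolyC ?mpolyC0; ring.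
- by exists 0, 0, c, 0, 0, 0; rewrite -?mul_mpolyC ?mpolyC0; ring.
- by exists 0, 0, 0, 0, 0, c; rewrite -?mul_mpolyC ?mpolyC0; ring.
- by exists 0, c, 0, 0, 0, 0; rewrite -?mul_mpolyC ?mpolyC0; ring.
- by exists 0, 0, 0, 0, c, 0; rewrite -?mul_mpolyC ?mpolyC0; ring.
- by exists 0, 0, 0, c, 0, 0; rewrite -?mul_mpolyC ?mpolyC0; ring.
Qed.

Lemma affineP p : (msize p <= 2)%N -> exists c0 c1 c2, p = quad c0 c1 c2 0 0 0.
Proof.
move=> p2; rewrite (mpolyE p) big_seq_cond; elim/big_rec: _.
  by exists 0, 0, 0; rewrite /quad mpolyC0 !scale0r !addr0.
move=> m q; rewrite andbT => /msize_mdeg_lt/leq_trans/(_ p2) m2.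
case=> [d0 [d1 [d2 ->]]]; move: (mcoeff m p) => c.
suff [c0 [c1 [c2 ->]]] : exists c0 c1 c2, c *: mpolyX R m = quad c0 c1 c2 0 0 0.
  by rewrite quadD !addr0; do 3!eexists.
move: m2; rewrite mdeg2 mpolyX2 /quad -mul_mpolyC.
case: (m ord0) => [|[|]]; case: (m ord_max) => [|[|]] // _.
- by exists c, 0, 0; rewrite -?mul_mpolyC ?mpolyC0; ring.
- by exists 0, 0, c; rewrite -?mul_mpolyC ?mpolyC0; ring.
- by exists 0, c, 0; rewrite -?mul_mpolyC ?mpolyC0; ring.
Qed.

Lemma msize_quad c0 c1 c2 c3 c4 c5 : (msize (quad c0 c1 c2 c3 c4 c5) <= 3)%N.
Proof.
have H (c : R) p : (msize p <= 3)%N -> (msize (c *: p) <= 3)%N.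
  by apply: leq_trans; exact: msizeZ_le.
have HD p q : (msize p <= 3)%N -> (msize q <= 3)%N -> (msize (p + q) <= 3)%N.
  by move=> Hp Hq; apply: leq_trans (msizeD_le _ _) _; rewrite geq_max Hp.
rewrite /quad -!mpolyXD; do !apply: (HD); try apply: H;
  rewrite ?msizeX ?mdegD ?mdeg1//.
by rewrite msizeC; case: (_ != _).
Qed.

Lemma msize_affine c0 c1 c2 : (msize (quad c0 c1 c2 0 0 0) <= 2)%N.
Proof.
have H (c : R) p : (msize p <= 2)%N -> (msize (c *: p) <= 2)%N.
  by apply: leq_trans; exact: msizeZ_le.
have HD p q : (msize p <= 2)%N -> (msize q <= 2)%N -> (msize (p + q) <= 2)%N.
  by move=> Hp Hq; apply: leq_trans (msizeD_le _ _) _; rewrite geq_max Hp.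
rewrite /quad !scale0r !addr0; do !apply: (HD); try apply: H;
  rewrite ?msizeX ?mdegD ?mdeg1//.
by rewrite msizeC; case: (_ != _).
Qed.

End PlanePolynomials.

(** * Integrals over a triangle and Green's formula *)

Section TriangleIntegral.
Context {R : realType}.
Local Notation pt := (R * R)%type.
Local Notation mu := (@lebesgue_measure R).
Implicit Types (a b c p : pt).

(** Twice the signed area of the triangle, positive when the vertices are listed
    counterclockwise. *)
Definition orient a b c : R :=
  (b.1 - a.1) * (c.2 - a.2) - (b.2 - a.2) * (c.1 - a.1).

(** The signs of the three barycentric coordinates, cleared of denominators. Multiplying by
    [orient a b c] instead of dividing makes the set independent of the orientation. *)
Definition tri a b c : set pt := [set p |
  [/\ 0 <= orient p b c * orient a b c, 0 <= orient a p c * orient a b c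
    & 0 <= orient a b p * orient a b c]].

Lemma tri_swap12 a b c : tri b a c = tri a b c.
Proof.
by apply/seteqP; split=> p [h1 h2 h3]; split; move: h1 h2 h3;
  rewrite /orient => h1 h2 h3; lra.
Qed.

Lemma tri_swap23 a b c : tri a c b = tri a b c.
Proof.
by apply/seteqP; split=> p [h1 h2 h3]; split; move: h1 h2 h3;
  rewrite /orient => h1 h2 h3; lra.
Qed.

Lemma measure_between (l h D : R) : D != 0 -> 0 <= (h - l) * D ->
  mu [set y | 0 <= (y - l) * D /\ 0 <= (h - y) * D] = `|h - l|%:E.
Proof.
move=> D0 hl.
have itvE (u v : R) : u <= v -> mu `[u, v] = (v - u)%:E.
  rewrite lebesgue_measure_itv/= lte_fin le_eqVlt => /predU1P[->|->//].
  by rewrite ltxx subrr.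
have [Dp|Dn|D0'] := ltrgt0P D; last by rewrite D0' eqxx in D0.
- have lh : l <= h by move: hl; rewrite pmulr_lge0// subr_ge0.
  rewrite ger0_norm ?subr_ge0// -itvE//; congr mu; apply/seteqP.
  by split=> y; rewrite /= in_itv /= !pmulr_lge0// !subr_ge0; [case=> -> ->|case/andP].
- have lh : h <= l by move: hl; rewrite nmulr_lge0// subr_le0.
  rewrite distrC ger0_norm ?subr_ge0// -itvE//; congr mu; apply/seteqP.
  by split=> y; rewrite /= in_itv /= !nmulr_lge0// !subr_le0; [case=> -> ->|case/andP=> -> ->].
Qed.

(** Over the abscissae between [a] and [b], a vertical slice runs between the lines [ab] and [ac];
    its length grows linearly from 0 at [a]. *)
Lemma section_left a b c x : a.1 < b.1 -> b.1 <= c.1 -> orient a b c != 0 ->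
  a.1 <= x <= b.1 -> mu [set y | tri a b c (x, y)] =
    (`|orient a b c| * (x - a.1) / ((b.1 - a.1) * (c.1 - a.1)))%:E.
Proof.
move=> ab bc D0 /andP[ax xb]; set D := orient a b c.
have ba0 : 0 < b.1 - a.1 by lra.
have ca0 : 0 < c.1 - a.1 by lra.
pose l := a.2 + (x - a.1) * (b.2 - a.2) / (b.1 - a.1).
pose h := a.2 + (x - a.1) * (c.2 - a.2) / (c.1 - a.1).
have hlE : h - l = D * ((x - a.1) / ((b.1 - a.1) * (c.1 - a.1))).
  by rewrite /h /l /D /orient; field; rewrite !gt_eqF.
have rate0 : 0 <= (x - a.1) / ((b.1 - a.1) * (c.1 - a.1)).
  by rewrite divr_ge0 ?subr_ge0// mulr_ge0 ?ltW.
have -> : [set y | tri a b c (x, y)] = [set y | 0 <= (y - l) * D /\ 0 <= (h - y) * D].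
  have lE y : orient a b (x, y) = (b.1 - a.1) * (y - l).
    by rewrite /orient /l /=; field; rewrite gt_eqF.
  have hE y : orient a (x, y) c = (c.1 - a.1) * (h - y).
    by rewrite /orient /h /=; field; rewrite gt_eqF.
  apply/seteqP; split=> y /=.
    rewrite /tri /= -/D lE hE -!mulrA => -[_].
    by rewrite (pmulr_rge0 _ ca0) (pmulr_rge0 _ ba0).
  move=> [y1 y2]; rewrite /tri /= -/D.
  have h2 : 0 <= orient a (x, y) c * D by rewrite hE -mulrA pmulr_rge0.
  have h3 : 0 <= orient a b (x, y) * D by rewrite lE -mulrA pmulr_rge0.
  split=> //.
  (* The third inequality follows from the others in this range of [x]: up to a positive factor it
     is a combination with nonnegative coefficients. *)
  have : (b.1 - a.1) * (orient (x, y) b c * D) =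
     (b.1 - x) * (D * D) + (c.1 - b.1) * (orient a b (x, y) * D).
    by rewrite /D /orient /=; ring.
  move=> E; rewrite -(pmulr_rge0 _ ba0) E addr_ge0// mulr_ge0 ?subr_ge0//.
  by rewrite -expr2 sqr_ge0.
rewrite measure_between//; last first.
  by rewrite hlE mulrAC mulr_ge0// -expr2 sqr_ge0.
by rewrite hlE normrM (ger0_norm rate0) mulrA.
Qed.

(** The reflection in the vertical axis exchanges the roles of [a] and [c]; the reflection and the
    reversal of the vertices each change the sign of [orient], so it is preserved. *)
Lemma section_right a b c x : a.1 <= b.1 -> b.1 < c.1 -> orient a b c != 0 ->
  b.1 <= x <= c.1 -> mu [set y | tri a b c (x, y)] =
    (`|orient a b c| * (c.1 - x) / ((c.1 - b.1) * (c.1 - a.1)))%:E.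
Proof.
move=> ab bc D0 /andP[bx xc].
pose m (p : pt) : pt := (- p.1, p.2).
have mE p q r : orient (m p) (m q) (m r) = - orient p q r.
  by rewrite /orient /m /=; ring.
have cba p q r : orient r q p = - orient p q r by rewrite /orient; ring.
have := @section_left (m c) (m b) (m a) (- x).
rewrite mE cba opprK /= => /(_ _ _ _ _) H.
rewrite (_ : [set y | tri a b c (x, y)] =
  [set y | tri (m c) (m b) (m a) (- x, y)]); last first.
  by apply/seteqP; split=> y [h1 h2 h3]; split; move: h1 h2 h3;
    rewrite /orient /m /= => h1 h2 h3; lra.
rewrite H ?lerN2 ?ltrN2 ?bx ?xc//; congr (_%:E); congr (_ * _ / (_ * _)); ring.
Qed.

Lemma tri_section_itv a b c x y : a.1 <= b.1 <= c.1 -> orient a b c != 0 ->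
  tri a b c (x, y) -> a.1 <= x <= c.1.
Proof.
move=> /andP[ab bc] D0 [h1 h2 h3]; have D2 : 0 < orient a b c ^+ 2.
  by rewrite exprn_even_gt0.
apply/andP; split.
  rewrite -subr_ge0 -(pmulr_lge0 _ D2).
  have -> : (x - a.1) * orient a b c ^+ 2 =
      (b.1 - a.1) * (orient a (x, y) c * orient a b c) +
      (c.1 - a.1) * (orient a b (x, y) * orient a b c) by rewrite /orient /=; ring.
  by rewrite addr_ge0// mulr_ge0//; lra.
rewrite -subr_ge0 -(pmulr_lge0 _ D2).
have -> : (c.1 - x) * orient a b c ^+ 2 =
    (c.1 - b.1) * (orient a (x, y) c * orient a b c) +
    (c.1 - a.1) * (orient (x, y) b c * orient a b c) by rewrite /orient /=; ring.
by rewrite addr_ge0// mulr_ge0//; lra.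
Qed.

Lemma measurable_affine (c0 c1 c2 : R) :
  measurable_fun setT (fun p : pt => c0 + c1 * p.1 + c2 * p.2).
Proof.
apply: measurable_funD; first apply: measurable_funD.
- exact: measurable_cst.
- by apply: measurable_funM; [exact: measurable_cst|exact: measurable_fst].
- by apply: measurable_funM; [exact: measurable_cst|exact: measurable_snd].
Qed.

Lemma measurable_tri a b c : measurable (tri a b c).
Proof.
have H (c0 c1 c2 : R) : measurable [set p : pt | 0 <= c0 + c1 * p.1 + c2 * p.2].
  have := measurable_affine c0 c1 c2 measurableT (measurable_itv `[0, +oo[).
  by rewrite setTI; congr measurable; apply/seteqP; split=> p /=; rewrite in_itv /= andbT.
have -> : tri a b c =
  [set p | 0 <= (b.1 * c.2 - b.2 * c.1) * orient a b c
    + ((b.2 - c.2) * orient a b c) * p.1 + ((c.1 - b.1) * orient a b c) * p.2]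
  `&` [set p | 0 <= (c.1 * a.2 - c.2 * a.1) * orient a b c
    + ((c.2 - a.2) * orient a b c) * p.1 + ((a.1 - c.1) * orient a b c) * p.2]
  `&` [set p | 0 <= (a.1 * b.2 - a.2 * b.1) * orient a b c
    + ((a.2 - b.2) * orient a b c) * p.1 + ((b.1 - a.1) * orient a b c) * p.2].
  have E1 p (D : R) : orient p b c * D =
      (b.1 * c.2 - b.2 * c.1) * D + (b.2 - c.2) * D * p.1 + (c.1 - b.1) * D * p.2.
    by rewrite /orient; ring.
  have E2 p (D : R) : orient a p c * D =
      (c.1 * a.2 - c.2 * a.1) * D + (c.2 - a.2) * D * p.1 + (a.1 - c.1) * D * p.2.
    by rewrite /orient; ring.
  have E3 p (D : R) : orient a b p * D =
      (a.1 * b.2 - a.2 * b.1) * D + (a.2 - b.2) * D * p.1 + (b.1 - a.1) * D * p.2.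
    by rewrite /orient; ring.
  by apply/seteqP; split=> p; rewrite /tri /= E1 E2 E3; [case|case=> -[]].
by apply: measurableI; [apply: measurableI|]; exact: H.
Qed.

Let slice a b c x := mu [set y | tri a b c (x, y)].

Lemma xsection_tri a b c x : xsection (tri a b c) x = [set y | tri a b c (x, y)].
Proof. by apply/seteqP; split=> y; rewrite /xsection /= inE. Qed.

Lemma measurable_slice a b c : measurable_fun setT (slice a b c).
Proof.
rewrite (_ : slice a b c = mu \o xsection (tri a b c)).
  by apply: measurable_fun_xsection; exact: measurable_tri.
by apply/funext => x; rewrite /slice -xsection_tri.
Qed.

Section Sorted.
Variables (a b c : pt) (al be : R).
Hypotheses (ab : a.1 <= b.1) (bc : b.1 <= c.1) (D0 : orient a b c != 0).
Let h x := ((al + be * x)%:E * slice a b c x)%E.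
Let D := `|orient a b c|.

Let ac : a.1 < c.1.
Proof.
rewrite lt_neqAle (le_trans ab bc) andbT; apply: contraNneq D0 => ac.
have ba : b.1 = a.1 by apply/eqP; rewrite eq_le ab ac bc.
by rewrite /orient ba ac !subrr mul0r mulr0 subrr.
Qed.

Let int_left : (\int[mu]_(x in `[a.1, b.1]) h x =
  (D / (c.1 - a.1) * ((al + be * a.1) * (b.1 - a.1) / 2 + be * (b.1 - a.1) ^+ 2 / 3))%:E)%E.
Proof.
have [<-|/eqP nab] := eqVneq a.1 b.1.
  by rewrite set_itv1 integral_set1 subrr !(mulr0, mul0r, expr0n, addr0).
have ab' : a.1 < b.1 by rewrite lt_neqAle ab andbT; apply/eqP.
pose U : {poly R} := 'X - a.1%:P.
(* An antiderivative of weight times slice length, with the weight expanded at [a.1] as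
   [(al + be * a.1) + be * U]. *)
pose P := (D / ((b.1 - a.1) * (c.1 - a.1))) *:
  (((al + be * a.1) / 2) *: U ^+ 2 + (be / 3) *: U ^+ 3).
transitivity (\int[mu]_(x in `[a.1, b.1]) (P^`().[x])%:E)%E; last first.
  rewrite integral_deriv// /P /U !hornerE /=; congr (_%:E).
  by field; rewrite !subr_eq0 !gt_eqF.
apply: eq_integral => x; rewrite inE /= in_itv /= => xab.
rewrite /h /slice section_left// -EFinM; congr (_%:E).
rewrite /P /U !poly.derivE !hornerE /= /D.
by field; rewrite !subr_eq0 !gt_eqF.
Qed.

Let int_right : (\int[mu]_(x in `[b.1, c.1]) h x =
  (D / (c.1 - a.1) * ((al + be * c.1) * (c.1 - b.1) / 2 - be * (c.1 - b.1) ^+ 2 / 3))%:E)%E.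
Proof.
have [<-|/eqP nbc] := eqVneq b.1 c.1.
  by rewrite set_itv1 integral_set1 subrr !(mulr0, mul0r, expr0n, subr0).
have bc' : b.1 < c.1 by rewrite lt_neqAle bc andbT; apply/eqP.
pose U : {poly R} := 'X - c.1%:P.
pose P := (- D / ((c.1 - b.1) * (c.1 - a.1))) *:
  (((al + be * c.1) / 2) *: U ^+ 2 + (be / 3) *: U ^+ 3).
transitivity (\int[mu]_(x in `[b.1, c.1]) (P^`().[x])%:E)%E; last first.
  rewrite integral_deriv// /P /U !hornerE /=; congr (_%:E).
  by field; rewrite !subr_eq0 !gt_eqF.
apply: eq_integral => x; rewrite inE /= in_itv /= => xbc.
rewrite /h /slice section_right// -EFinM; congr (_%:E).
rewrite /P /U !poly.derivE !hornerE /= /D.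
by field; rewrite !subr_eq0 !gt_eqF.
Qed.

(** The weight is nonnegative over the triangle, so the integral may be cut at [b.1] without
    integrability. The result is the area times the weight at the centroid. *)
Lemma integral_slice_sorted : 0 <= al + be * a.1 -> 0 <= al + be * c.1 ->
  (\int[mu]_x ((al + be * x)%:E * slice a b c x) =
  (D / 2 * (al + be * (a.1 + b.1 + c.1) / 3))%:E)%E.
Proof.
move=> ga gc; rewrite -/h.
have h0 x : a.1 <= x <= c.1 -> (0 <= h x)%E.
  move=> /andP[ax xc]; rewrite /h mule_ge0// lee_fin.
  rewrite -(pmulr_rge0 _ (_ : 0 < c.1 - a.1)) ?subr_gt0//.
  have -> : (c.1 - a.1) * (al + be * x) = (x - a.1) * (al + be * c.1)
     + (c.1 - x) * (al + be * a.1) by ring.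
  by rewrite addr_ge0// mulr_ge0// subr_ge0.
have mh A : measurable A -> measurable_fun A h.
  move=> mA; apply: measurable_funTS; apply: emeasurable_funM.
    apply/measurable_EFinP; apply: measurable_funD; first exact: measurable_cst.
    by apply: measurable_funM; [exact: measurable_cst|exact: measurable_id].
  exact: measurable_slice.
have -> : (\int[mu]_x h x = \int[mu]_(x in `[a.1, c.1]) h x)%E.
  rewrite [RHS]integral_mkcond; apply: eq_integral => x _; rewrite patchE.
  case: ifPn => //; rewrite notin_setE /= in_itv /= => nx.
  rewrite /h /slice (_ : [set y | _] = set0) ?measure0 ?mule0//.
  apply/seteqP; split=> y //= ty; apply: nx.
  by apply: tri_section_itv ty => //; rewrite ab.
have itvU : `[a.1, c.1]%classic = `[a.1, b.1]%classic `|` `]b.1, c.1]%classic.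
  by rewrite -itv_bndbnd_setU// bnd_simp.
rewrite itvU ge0_integral_setU//; last 3 first.
- by apply: mh; exact: measurableU.
- by rewrite -itvU => x; rewrite /= in_itv /=; exact: h0.
- apply/disj_setPS => x []; rewrite /= !in_itv /= => /andP[_ xb] /andP[bx _].
  by move: bx; rewrite ltNge xb.
rewrite (@integral_itv_obnd_cbnd _ _ _ _); last exact: mh.
rewrite int_left int_right -EFinD; congr (_%:E).
by field; rewrite subr_eq0 gt_eqF.
Qed.

End Sorted.

Lemma orient_swap12 a b c : orient b a c = - orient a b c.
Proof. by rewrite /orient; ring. Qed.

Lemma orient_swap23 a b c : orient a c b = - orient a b c.
Proof. by rewrite /orient; ring. Qed.

(** Both sides are symmetric in the vertices, which may therefore be sorted by abscissa. *)
Lemma integral_slice a b c al be : orient a b c != 0 ->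
  0 <= al + be * a.1 -> 0 <= al + be * b.1 -> 0 <= al + be * c.1 ->
  (\int[mu]_x ((al + be * x)%:E * slice a b c x) =
  (`|orient a b c| / 2 * (al + be * (a.1 + b.1 + c.1) / 3))%:E)%E.
Proof.
pose P a b c := orient a b c != 0 ->
  0 <= al + be * a.1 -> 0 <= al + be * b.1 -> 0 <= al + be * c.1 ->
  (\int[mu]_x ((al + be * x)%:E * slice a b c x) =
  (`|orient a b c| / 2 * (al + be * (a.1 + b.1 + c.1) / 3))%:E)%E.
have P12 u v w : P u v w -> P v u w.
  move=> H; rewrite /P orient_swap12 oppr_eq0 normrN => D0 gv gu gw.
  rewrite [v.1 + u.1]addrC -(H D0 gu gv gw); apply: eq_integral => x _.
  by rewrite /slice tri_swap12.
have P23 u v w : P u v w -> P u w v.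
  move=> H; rewrite /P orient_swap23 oppr_eq0 normrN => D0 gu gw gv.
  rewrite [u.1 + w.1 + v.1]addrAC -(H D0 gu gv gw); apply: eq_integral => x _.
  by rewrite /slice tri_swap23.
have sorted u v w : u.1 <= v.1 -> v.1 <= w.1 -> P u v w.
  by move=> uv vw D0 gu _ gw; exact: integral_slice_sorted.
rewrite -/(P a b c).
have [ab|/ltW ba] := leP a.1 b.1; have [bc|/ltW cb] := leP b.1 c.1;
  have [ac|/ltW ca] := leP a.1 c.1.
- exact: sorted.
- by apply: sorted.
- by apply: P23; exact: sorted.
- by apply: P23; apply: P12; exact: sorted.
- by apply: P12; exact: sorted.
- by apply: P12; apply: P23; exact: sorted.
- by apply: (P12); apply: (P23); apply: P12; exact: sorted.
- by apply: (P12); apply: (P23); apply: P12; exact: sorted.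
Qed.

Lemma tri_affine_ge0 a b c p al be ga : orient a b c != 0 -> tri a b c p ->
  0 <= al + be * a.1 + ga * a.2 -> 0 <= al + be * b.1 + ga * b.2 ->
  0 <= al + be * c.1 + ga * c.2 -> 0 <= al + be * p.1 + ga * p.2.
Proof.
move=> D0 [h1 h2 h3] fa fb fc.
rewrite -(pmulr_lge0 _ (_ : 0 < orient a b c ^+ 2)) ?exprn_even_gt0//.
have -> : (al + be * p.1 + ga * p.2) * orient a b c ^+ 2 =
  (al + be * a.1 + ga * a.2) * (orient p b c * orient a b c) +
  (al + be * b.1 + ga * b.2) * (orient a p c * orient a b c) +
  (al + be * c.1 + ga * c.2) * (orient a b p * orient a b c).
  by rewrite /orient; ring.
by rewrite !addr_ge0// mulr_ge0.
Qed.

Section Fubini.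
Variables (a b c : pt) (al be : R).
Hypothesis D0 : orient a b c != 0.
Let mT := measurable_tri a b c.

Lemma integral_tri_fst : 0 <= al + be * a.1 -> 0 <= al + be * b.1 ->
  0 <= al + be * c.1 ->
  (\int[mu \x mu]_(p in tri a b c) (al + be * p.1)%:E =
  (`|orient a b c| / 2 * (al + be * (a.1 + b.1 + c.1) / 3))%:E)%E.
Proof.
move=> ga gb gc; rewrite -integral_slice// integral_mkcond fubini_tonelli1//.
- apply: eq_integral => x _; rewrite /fubini_F /slice.
  rewrite -integral_cst; last by rewrite -xsection_tri; exact: measurable_xsection.
  rewrite [RHS]integral_mkcond; apply: eq_integral => y _.
  rewrite !patchE /=; set u := _ \in tri a b c; set v := _ \in mkset _.
  by have -> : u = v by apply/idP/idP; rewrite /u /v !inE.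
- apply/(measurable_restrictT _ _).1 => //; apply: measurable_funTS.
  apply/measurable_EFinP.
  rewrite (_ : (fun _ => _) = (fun p => al + be * p.1 + 0 * p.2)).
    exact: measurable_affine.
  by apply/funext => p; rewrite mul0r addr0.
- move=> p; rewrite patchE; case: ifPn => //; rewrite inE lee_fin => pT.
  have := @tri_affine_ge0 a b c p al be 0 D0 pT.
  by rewrite !mul0r !addr0; apply.
Qed.

Lemma integral_tri_snd : 0 <= al + be * a.2 -> 0 <= al + be * b.2 ->
  0 <= al + be * c.2 ->
  (\int[mu \x mu]_(p in tri a b c) (al + be * p.2)%:E =
  (`|orient a b c| / 2 * (al + be * (a.2 + b.2 + c.2) / 3))%:E)%E.
Proof.
move=> ga gb gc; pose m (p : pt) : pt := (p.2, p.1).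
have mE p q r : orient (m p) (m q) (m r) = - orient p q r.
  by rewrite /orient /m /=; ring.
have := @integral_slice (m a) (m b) (m c) al be.
rewrite mE oppr_eq0 normrN => /(_ D0 ga gb gc) <-.
rewrite integral_mkcond fubini_tonelli2//.
- apply: eq_integral => y _; rewrite /fubini_G /slice.
  have sE : [set x | tri (m a) (m b) (m c) (y, x)] = [set x | tri a b c (x, y)].
    by apply/seteqP; split=> x; rewrite /tri /= -[(y, x)]/(m (x, y)) !mE !mulrNN.
  rewrite -integral_cst; last by rewrite -xsection_tri; apply: measurable_xsection; exact: measurable_tri.
  rewrite [RHS]integral_mkcond sE; apply: eq_integral => x _.
  rewrite !patchE /=; set u := _ \in tri a b c; set v := _ \in mkset _.
  by have -> : u = v by apply/idP/idP; rewrite /u /v !inE.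
- apply/(measurable_restrictT _ _).1 => //; apply: measurable_funTS.
  apply/measurable_EFinP.
  rewrite (_ : (fun _ => _) = (fun p => al + 0 * p.1 + be * p.2)).
    exact: measurable_affine.
  by apply/funext => p; rewrite mul0r addr0.
- move=> p; rewrite patchE; case: ifPn => //; rewrite inE lee_fin => pT.
  have := @tri_affine_ge0 a b c p al 0 be D0 pT.
  by rewrite !mul0r !addr0; apply.
Qed.

End Fubini.

(* On the triangle an affine function is a linear combination of nonnegative
   ones, to which Tonelli applies. *)
Lemma area_int_affine a b c (c0 c1 c2 : R) : orient a b c != 0 ->
  area_int (tri a b c) (fun p => c0 + c1 * p.1 + c2 * p.2) =
  `|orient a b c| / 6 * ((c0 + c1 * a.1 + c2 * a.2) + (c0 + c1 * b.1 + c2 * b.2)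
    + (c0 + c1 * c.1 + c2 * c.2)).
Proof.
move=> D0; have mT := measurable_tri a b c.
pose m1 := `|a.1| + `|b.1| + `|c.1|; pose m2 := `|a.2| + `|b.2| + `|c.2|.
have int_of (f : pt -> R) r : measurable_fun setT f ->
    (forall p, tri a b c p -> 0 <= f p) ->
    (\int[mu \x mu]_(p in tri a b c) (f p)%:E = r%:E)%E ->
    (mu \x mu)%E.-integrable (tri a b c) (EFin \o f) /\
    Rintegral (mu \x mu)%E (tri a b c) f = r.
  move=> mf f0 fr; split; last by rewrite /Rintegral fr.
  apply/integrableP; split; first by apply/measurable_EFinP; exact: measurable_funTS.
  rewrite (_ : (\int[_]_(x in _) _)%E = r%:E) ?ltry// -fr.
  by apply: eq_integral => p; rewrite inE => /f0 fp /=; rewrite ger0_norm.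
have bnd (x y z : R) : [/\ 0 <= `|x| + `|y| + `|z| + 1 * x,
   0 <= `|x| + `|y| + `|z| + 1 * y & 0 <= `|x| + `|y| + `|z| + 1 * z].
  have h1 := ler_norm (- x); have h2 := ler_norm (- y); have h3 := ler_norm (- z).
  have h4 := normr_ge0 x; have h5 := normr_ge0 y; have h6 := normr_ge0 z.
  by rewrite !normrN in h1 h2 h3; split; lra.
have [x1 x2 x3] := bnd a.1 b.1 c.1; have [y1 y2 y3] := bnd a.2 b.2 c.2.
rewrite -/m1 in x1 x2 x3; rewrite -/m2 in y1 y2 y3.
have meas (f : pt -> R) (d0 d1 d2 : R) : (forall p, f p = d0 + d1 * p.1 + d2 * p.2) ->
    measurable_fun setT f.
  by move=> fE; rewrite (_ : f = fun p => d0 + d1 * p.1 + d2 * p.2);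
    [exact: measurable_affine|apply/funext].
pose f0 (p : pt) := 1 + 0 * p.1; pose f1 (p : pt) := m1 + 1 * p.1.
pose f2 (p : pt) := m2 + 1 * p.2.
have [I0 E0] : (mu \x mu)%E.-integrable (tri a b c) (EFin \o f0) /\
    Rintegral (mu \x mu)%E (tri a b c) f0 = `|orient a b c| / 2.
  apply: int_of.
  - by apply: (meas _ 1 0 0) => p; rewrite /f0; ring.
  - by move=> p _; rewrite /f0 mul0r addr0 ler01.
  - by rewrite integral_tri_fst ?mul0r ?addr0 ?ler01// mulr1.
have [I1 E1] : (mu \x mu)%E.-integrable (tri a b c) (EFin \o f1) /\
    Rintegral (mu \x mu)%E (tri a b c) f1 =
    `|orient a b c| / 2 * (m1 + 1 * (a.1 + b.1 + c.1) / 3).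
  apply: int_of.
  - by apply: (meas _ m1 1 0) => p; rewrite /f1; ring.
  - move=> p pT; have := @tri_affine_ge0 a b c p m1 1 0 D0 pT.
    by rewrite !mul0r !addr0; apply.
  - by rewrite integral_tri_fst.
have [I2 E2] : (mu \x mu)%E.-integrable (tri a b c) (EFin \o f2) /\
    Rintegral (mu \x mu)%E (tri a b c) f2 =
    `|orient a b c| / 2 * (m2 + 1 * (a.2 + b.2 + c.2) / 3).
  apply: int_of.
  - by apply: (meas _ m2 0 1) => p; rewrite /f2; ring.
  - move=> p pT; have := @tri_affine_ge0 a b c p m2 0 1 D0 pT.
    by rewrite !mul0r !addr0; apply.
  - by rewrite integral_tri_snd.
have intZ k (f : pt -> R) : (mu \x mu)%E.-integrable (tri a b c) (EFin \o f) ->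
    (mu \x mu)%E.-integrable (tri a b c) (EFin \o (fun p => k * f p)).
  move=> If; rewrite (_ : EFin \o _ = (fun p => k%:E * (EFin \o f) p)%E)//.
  exact: integrableZl.
have intD (f g : pt -> R) : (mu \x mu)%E.-integrable (tri a b c) (EFin \o f) ->
    (mu \x mu)%E.-integrable (tri a b c) (EFin \o g) ->
    (mu \x mu)%E.-integrable (tri a b c) (EFin \o (fun p => f p + g p)).
  move=> If Ig.
  rewrite (_ : EFin \o _ = ((EFin \o f) \+ (EFin \o g))%E)//.
  exact: integrableD.
rewrite /area_int (_ : (fun p => _) = (fun p =>
  (c0 - c1 * m1 - c2 * m2) * f0 p + c1 * f1 p + c2 * f2 p)); last first.
  by apply/funext => p; rewrite /f0 /f1 /f2; ring.
rewrite RintegralD//; [|by apply: (intD); exact: intZ|exact: intZ].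
rewrite RintegralD//; [|exact: intZ..].
by rewrite !RintegralZl// E0 E1 E2; field.
Qed.

(** The work of the field along the directed segment, not normalised by its length. *)
Definition circ (v : mpoly 2 R * mpoly 2 R) a b : R :=
  (b.1 - a.1) * int01 (etrace v.1 a b) + (b.2 - a.2) * int01 (etrace v.2 a b).

Lemma int01_quad (c0 c1 c2 c3 c4 c5 : R) a b :
  int01 (etrace (quad c0 c1 c2 c3 c4 c5) a b) =
  c0 + c1 * (a.1 + b.1) / 2 + c2 * (a.2 + b.2) / 2
  + c3 * (a.1 ^+ 2 + a.1 * b.1 + b.1 ^+ 2) / 3
  + c4 * (2 * a.1 * a.2 + a.1 * b.2 + b.1 * a.2 + 2 * b.1 * b.2) / 6
  + c5 * (a.2 ^+ 2 + a.2 * b.2 + b.2 ^+ 2) / 3.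
Proof.
pose d1 := b.1 - a.1; pose d2 := b.2 - a.2.
rewrite /int01 (@int01_cubic _
  (c0 + c1 * a.1 + c2 * a.2 + c3 * a.1 ^+ 2 + c4 * a.1 * a.2 + c5 * a.2 ^+ 2)
  (c1 * d1 + c2 * d2 + 2 * c3 * a.1 * d1 + c4 * (a.1 * d2 + a.2 * d1) + 2 * c5 * a.2 * d2)
  (c3 * d1 ^+ 2 + c4 * d1 * d2 + c5 * d2 ^+ 2) 0).
  by rewrite /d1 /d2; field.
by move=> t; rewrite -etraceE ev_quad /along /d1 /d2 /=; ring.
Qed.

(** The field is quadratic and its rotation affine, so both sides are explicit in the twelve
    coefficients and agree by [field]; the sign accounts for the orientation of the boundary. *)
Lemma green (p q : mpoly 2 R) a b c : (msize p <= 3)%N -> (msize q <= 3)%N ->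
  orient a b c != 0 -> area_int (tri a b c) (ev (dx q - dy p)) =
  Num.sg (orient a b c) * (circ (p, q) a b + circ (p, q) b c + circ (p, q) c a).
Proof.
move=> /quadP[p0 [p1 [p2 [p3 [p4 [p5 ->]]]]]] /quadP[q0 [q1 [q2 [q3 [q4 [q5 ->]]]]]] D0.
rewrite /circ /= !int01_quad dx_quad dy_quad.
rewrite (_ : ev _ = (fun x => (q1 - p2) + (2 * q3 - p4) * x.1 + (q4 - 2 * p5) * x.2)).
  rewrite area_int_affine// normrEsg; move: (Num.sg _) => s; rewrite /orient.
  by field.
by apply/funext => x; rewrite evB !ev_quad; ring.
Qed.

Lemma int01_etraceC (p : mpoly 2 R) a b : (msize p <= 3)%N ->
  int01 (etrace p b a) = int01 (etrace p a b).
Proof.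
by move=> /quadP[c0 [c1 [c2 [c3 [c4 [c5 ->]]]]]]; rewrite !int01_quad; field.
Qed.

Lemma circC (v : mpoly 2 R * mpoly 2 R) a b : (msize v.1 <= 3)%N ->
  (msize v.2 <= 3)%N -> circ v b a = - circ v a b.
Proof. by move=> v1 v2; rewrite /circ !(int01_etraceC a)//; ring. Qed.

End TriangleIntegral.

(** * Geometry of the triangulation *)

Section LocallyConstant.
Context {R : realType}.
Local Notation pt := (R * R)%type.

(** A Lebesgue number on the parameter interval makes the composite with [g] constant at a uniform
    scale. Local constancy is relative to [A], which will be [Omega], a punctured ball or the
    interior of a triangle. *)
Lemma path_locally_constant (A : set pt) (g : R -> pt) (f : pt -> R) :
  path_in A g ->
  (forall x, A x -> exists2 r, 0 < r & forall y, A y -> ball x r y -> f y = f x) ->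
  f (g 0) = f (g 1).
Proof.
move=> [/subspace_continuousP cg gA] fP.
pose Q (B : set R) := forall s t, 0 <= s <= 1 -> 0 <= t <= 1 -> B s -> B t ->
  f (g s) = f (g t).
have [||e e0 eQ] := @lebesgue_number R R (`[0, 1]%classic) Q _ (@segment_compact _ 0 1).
- by move=> B C BC QC s t s01 t01 /BC Cs /BC Ct; exact: QC.
- move=> t t01; have At : A (g t) by apply: gA; exists t.
  have [r r0 rP] := fP _ At.
  have /nbhs_ballP [e e0 eP] := cg t t01 _ (nbhsx_ballx (g t) r r0).
  exists e => // s u s01 u01 ts tu.
  have H v : 0 <= v <= 1 -> ball t e v -> f (g v) = f (g t).
    move=> v01 tv; have v01' : `[0, 1]%classic v by rewrite /= in_itv.
    by apply: rP; [apply: gA; exists v|exact: eP].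
  by rewrite !H.
apply: (@locally_constant_segment _ (f \o g) e) => // s t s01 t01 st.
apply: (eQ s) => //=.
exact: ballxx.
Qed.

End LocallyConstant.

(** * Oriented triangles, barycentric coordinates and conformity *)

Section Cells.
Context {R : realType} {Th : triangulation R}.
Local Notation pt := (R * R)%type.
Local Notation V := (vertex Th).
Implicit Types (K : cell Th) (a b c : V) (p : pt).

Definition ccw K a b c : bool :=
  (val K == [set a; b; c]%SET) && (0 < orient (pos a) (pos b) (pos c)).

(** [K] lies to the left of the directed edge from [a] to [b]. The two triangles at an interior edge
    are told apart by the direction in which each sees the edge on its boundary. *)
Definition left K a b : bool := [exists c, ccw K a b c].

Lemma sum_set3 a b c (f : V -> R) : a != b -> a != c -> b != c ->
  \sum_(x in [set a; b; c]%SET) f x = f a + f b + f c.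
Proof.
move=> ab ac bc; rewrite finset.setUC big_setU1 ?big_setU1 ?big_set1 /=.
- by rewrite addrC.
- by rewrite inE.
- by rewrite !inE negb_or eq_sym ac eq_sym bc.
Qed.

Lemma orientC p q r : @orient R q r p = orient p q r.
Proof. by rewrite /orient; ring. Qed.

Lemma orient_rot2 p q r : @orient R r p q = orient p q r.
Proof. by rewrite /orient; ring. Qed.

Lemma orient_pp p q : @orient R p p q = 0.
Proof. by rewrite /orient; ring. Qed.

Lemma orient_pqq p q : @orient R p q q = 0.
Proof. by rewrite /orient; ring. Qed.

Lemma orient_pqp p q : @orient R p q p = 0.
Proof. by rewrite /orient; ring. Qed.

Lemma orient_neq0 K a b c : val K = [set a; b; c]%SET -> a != b -> a != c ->
  b != c -> orient (pos a) (pos b) (pos c) != 0.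
Proof.
move=> KE ab ac bc; apply/eqP => D0.
have ND la lb lc : la + lb + lc = 0 ->
    la * (pos a).1 + lb * (pos b).1 + lc * (pos c).1 = 0 ->
    la * (pos a).2 + lb * (pos b).2 + lc * (pos c).2 = 0 -> lb = 0 /\ lc = 0.
  move=> s0 s1 s2; pose l x := if x == a then la else if x == b then lb else lc.
  have la' : l a = la by rewrite /l eqxx.
  have lb' : l b = lb by rewrite /l eq_sym (negbTE ab) eqxx.
  have lc' : l c = lc by rewrite /l eq_sym (negbTE ac) eq_sym (negbTE bc).
  have H := @nondegenerate _ _ _ (valP K) l.
  rewrite KE !sum_set3// la' lb' lc' in H; have {}H := H s0 s1 s2.
  by rewrite -lb' -lc'; split; apply: H; rewrite !inE eqxx ?orbT.
move: D0; rewrite /orient => D0.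
(* If the area vanishes, the coordinates of the two edge vectors at [a] give affine relations
   between the vertices. Nondegeneracy forces these coordinates to be 0, so that [a] and [b]
   coincide, and this is again a forbidden relation. *)
have [h1 h2] := ND (- ((pos c).1 - (pos a).1) + ((pos b).1 - (pos a).1))
  ((pos c).1 - (pos a).1) (- ((pos b).1 - (pos a).1))
  ltac:(ring) ltac:(ring) ltac:(lra).
have [h3 h4] := ND (- ((pos c).2 - (pos a).2) + ((pos b).2 - (pos a).2))
  ((pos c).2 - (pos a).2) (- ((pos b).2 - (pos a).2))
  ltac:(ring) ltac:(lra) ltac:(ring).
have [h5 _] := ND (-1) 1 0 ltac:(ring) ltac:(lra) ltac:(lra).
by move/eqP: h5; rewrite oner_eq0.
Qed.

Lemma ccw_neq K a b c : ccw K a b c -> [/\ a != b, a != c & b != c].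
Proof.
move=> /andP[_ D0]; split; apply: contraTneq D0 => ->;
  by rewrite ?orient_pp ?orient_pqp ?orient_pqq ltxx.
Qed.

Lemma ccw_val K a b c : ccw K a b c -> val K = [set a; b; c]%SET.
Proof. by case/andP=> /eqP. Qed.

Lemma ccw_gt0 K a b c : ccw K a b c -> 0 < orient (pos a) (pos b) (pos c).
Proof. by case/andP. Qed.

Lemma ccw_rot K a b c : ccw K a b c -> ccw K b c a.
Proof.
case/andP=> /eqP KE D0; rewrite /ccw orientC D0 andbT KE; apply/eqP/setP => x.
by rewrite !inE; case: (x == a); case: (x == b); case: (x == c).
Qed.

Lemma ccw_mem K a b c : ccw K a b c -> [/\ a \in val K, b \in val K & c \in val K].
Proof. by move/ccw_val => ->; rewrite !inE !eqxx ?orbT. Qed.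

Lemma mem_ccw K a b c x : ccw K a b c -> x \in val K -> [\/ x = a, x = b | x = c].
Proof.
move/ccw_val => ->; rewrite !inE => /orP[/orP[]|] /eqP ->.
- exact: Or31.
- exact: Or32.
- exact: Or33.
Qed.

Lemma ccw_edge K a b : a != b -> a \in val K -> b \in val K ->
  exists c, ccw K a b c \/ ccw K b a c.
Proof.
move=> ab aK bK; have K3 := card_triangle (valP K).
have : #|val K :\: [set a; b]%SET| == 1%N.
  rewrite cardsD (finset.setIidPr _) ?cards2 ?ab ?K3//.
  by apply/fintype.subsetP => x; rewrite !inE => /orP[] /eqP ->.
case/cards1P => c cE; exists c.
have : c \in val K :\: [set a; b]%SET by rewrite cE inE.
rewrite !inE negb_or => /andP[/andP[ca cb] cK].
have KE : val K = [set a; b; c]%SET.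
  apply/setP => x; rewrite !inE.
  have /setP/(_ x) := cE; rewrite !inE.
  have [->|/=] := eqVneq x a; first by rewrite aK.
  by have [->|/= _ _ ->] := eqVneq x b; first by rewrite bK.
have := orient_neq0 KE ab; rewrite eq_sym ca eq_sym cb => /(_ isT isT) D0.
have [|] := ltP 0 (orient (pos a) (pos b) (pos c)) => D.
  by left; rewrite /ccw KE eqxx.
right; rewrite /ccw orient_swap12 oppr_gt0 lt_neqAle D0 D /= andbT.
by rewrite KE [X in X :|: _]finset.setUC.
Qed.

Lemma ccw_of K a : a \in val K -> exists b c, ccw K a b c.
Proof.
move=> aK; have K3 := card_triangle (valP K).
have : (0 < #|val K :\ a|)%N by have := cardsD1 a (val K); rewrite aK K3 add1n => -[<-].
case/card_gt0P => b; rewrite !inE => /andP[ba bK].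
rewrite eq_sym in ba; have [c [H|H]] := ccw_edge ba aK bK; first by exists b, c.
by exists c, b; apply: ccw_rot.
Qed.

Lemma ccw_exists K : exists a b c, ccw K a b c.
Proof.
have : (0 < #|val K|)%N by rewrite (card_triangle (valP K)).
by case/card_gt0P => a /ccw_of [b [c H]]; exists a, b, c.
Qed.

Lemma leftP K a b : reflect (exists c, ccw K a b c) (left K a b).
Proof. exact: existsP. Qed.

Lemma left_edge K a b : left K a b -> edge_of a b K.
Proof. by case/leftP => c H; have [] := ccw_neq H; have [] := ccw_mem H. Qed.

Lemma edge_left K a b : edge_of a b K -> left K a b \/ left K b a.
Proof.
by case=> ab aK bK; have [c []] := ccw_edge ab aK bK; [left|right]; apply/leftP; exists c.
Qed.

Lemma edge_of_sym K a b : edge_of a b K -> edge_of b a K.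
Proof. by case=> ab aK bK; split; rewrite // eq_sym. Qed.

Lemma ccw_uniq K a b c d : ccw K a b c -> ccw K a b d -> c = d.
Proof.
move=> H H'; have [ab ac bc] := ccw_neq H.
have [_ _ cK] := ccw_mem H.
by have [E|E|//] := mem_ccw H' cK; rewrite E eqxx in ac bc.
Qed.

Lemma left_asym K a b : left K a b -> ~~ left K b a.
Proof.
case/leftP=> c H; apply/negP => /leftP[d H'].
have [ab ac bc] := ccw_neq H; have [_ _ cK] := ccw_mem H.
have [E|E|E] := mem_ccw H' cK; [by rewrite E eqxx in bc|by rewrite E eqxx in ac|].
have := ccw_gt0 H; have := ccw_gt0 H'; rewrite -E orient_swap12; lra.
Qed.

Lemma left_ccw K a b c x y : ccw K a b c -> left K x y =
  [|| (x == a) && (y == b), (x == b) && (y == c) | (x == c) && (y == a)].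
Proof.
move=> H; have H1 := ccw_rot H; have H2 := ccw_rot H1.
have [ab ac bc] := ccw_neq H.
apply/idP/idP; last first.
  by case/or3P=> /andP[/eqP-> /eqP->]; apply/leftP; [exists c|exists a|exists b].
move=> L; have [xy xK yK] := left_edge L; have LL := left_asym L.
have L1 : left K a b by apply/leftP; exists c.
have L2 : left K b c by apply/leftP; exists a.
have L3 : left K c a by apply/leftP; exists b.
by move: xy LL; case: (mem_ccw H xK) => ->; case: (mem_ccw H yK) => ->;
  rewrite ?eqxx ?L1 ?L2 ?L3 ?orbT.
Qed.

(** Circulations become sums over all ordered pairs of vertices, so that a sum over triangles can be
    exchanged with one over edges. *)
Lemma sum_left K a b c (F : V -> V -> R) : ccw K a b c ->
  \sum_x \sum_y (left K x y)%:R * F x y = F a b + F b c + F c a.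
Proof.
move=> H; have [ab ac bc] := ccw_neq H.
have pick1 (u v : V) : \sum_x \sum_y ((x == u) && (y == v))%:R * F x y = F u v.
  rewrite (bigD1 u)//= [X in _ + X]big1 ?addr0; last first.
    by move=> x /negbTE xu; rewrite big1// => y _; rewrite xu mul0r.
  rewrite (bigD1 v)//= [X in _ + X]big1 ?addr0 ?eqxx ?mul1r//.
  by move=> y /negbTE yv; rewrite yv andbF mul0r.
rewrite -(pick1 a b) -(pick1 b c) -(pick1 c a) -!big_split /=.
apply: eq_bigr => x _; rewrite -!big_split /=; apply: eq_bigr => y _.
rewrite (left_ccw x y H) -!mulrDl -!natrD; congr (_%:R * _).
have [->|xa] := eqVneq x a; first by rewrite (negbTE ab) (negbTE ac) /= orbF !addn0.
have [->|xb] := eqVneq x b; first by rewrite (negbTE bc) /= orbF addn0.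
by rewrite /= add0n.
Qed.

Lemma cell_setE K a b c : ccw K a b c ->
  cell_set K = tri (pos a) (pos b) (pos c).
Proof.
move=> H; have [ab ac bc] := ccw_neq H; have D0 := ccw_gt0 H.
rewrite /cell_set (ccw_val H); apply/seteqP; split=> x.
  case=> l [l0]; rewrite !sum_set3// => l1 ->.
  have la : l a = 1 - l b - l c by lra.
  split; apply: mulr_ge0; try exact: ltW.
  - rewrite (_ : orient _ _ _ = l a * orient (pos a) (pos b) (pos c)).
      by rewrite mulr_ge0// ltW.
    by rewrite la /orient /=; ring.
  - rewrite (_ : orient _ _ _ = l b * orient (pos a) (pos b) (pos c)).
      by rewrite mulr_ge0// ltW.
    by rewrite la /orient /=; ring.
  - rewrite (_ : orient _ _ _ = l c * orient (pos a) (pos b) (pos c)).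
      by rewrite mulr_ge0// ltW.
    by rewrite la /orient /=; ring.
case; rewrite !pmulr_lge0// => h1 h2 h3.
set D := orient (pos a) (pos b) (pos c) in D0 *.
pose l y := if y == a then orient x (pos b) (pos c) / D
  else if y == b then orient (pos a) x (pos c) / D
  else if y == c then orient (pos a) (pos b) x / D else 0.
have la : l a = orient x (pos b) (pos c) / D by rewrite /l eqxx.
have lb : l b = orient (pos a) x (pos c) / D.
  by rewrite /l eq_sym (negbTE ab) eqxx.
have lc : l c = orient (pos a) (pos b) x / D.
  by rewrite /l eq_sym (negbTE ac) eq_sym (negbTE bc) eqxx.
exists l; split.
- by move=> y; rewrite /l; do 3?case: ifP => _ //; rewrite divr_ge0// ltW.
- rewrite !sum_set3// la lb lc -!mulrDl -[RHS](@divff _ D) ?gt_eqF//.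
  by congr (_ / _); rewrite /D /orient; ring.
- rewrite [LHS]surjective_pairing !sum_set3// la lb lc; congr (_, _);
    rewrite -[LHS](@mulfK _ D) ?gt_eqF// !(mulrAC _ D^-1) -!mulrDl;
    by congr (_ / _); rewrite /D /orient; ring.
Qed.

(** Up to the factor [orient a b c], [orient x b c] is the barycentric coordinate of [x] at [a]; a
    convex combination that omits [a] lies on the line [bc], where this vanishes. *)
Lemma hull_carrier K a b c x (S : {set V}) : ccw K a b c -> S \subset val K ->
  hull (@pos R Th) S x -> orient x (pos b) (pos c) != 0 -> a \in S.
Proof.
move=> H SK [l [l0 l1 ->]]; apply: contraR => aS; have [ab ac bc] := ccw_neq H.
pose l' y := if y \in S then l y else 0.
have sumE (f : V -> R) : \sum_(y in S) l y * f y = l' b * f b + l' c * f c.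
  rewrite -[LHS](_ : \sum_(y in val K) l' y * f y = _).
    by rewrite (ccw_val H) sum_set3// {1}/l' (negbTE aS) mul0r add0r.
  rewrite [RHS]big_mkcond [LHS]big_mkcond /=; apply: eq_bigr => y _.
  rewrite /l'; case: ifP => yK; case: ifP => yS; rewrite ?mul0r//.
  by rewrite (fintype.subsetP SK _ yS) in yK.
have sum1 : l' b + l' c = 1.
  rewrite -[l' b]mulr1 -[l' c]mulr1 -(sumE (fun=> 1)) -[RHS]l1.
  by apply: eq_bigr => y _; rewrite mulr1.
apply/eqP; rewrite !sumE (_ : l' b = 1 - l' c); last by lra.
by rewrite /orient /=; ring.
Qed.

(** The main use of conformity: a common point is a convex combination of common vertices, so every
    vertex at which it has a nonzero coordinate is common. *)
Lemma carrier K K' a b c x : ccw K a b c -> cell_set K x -> cell_set K' x ->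
  orient x (pos b) (pos c) != 0 -> a \in val K'.
Proof.
move=> H xK xK' D0; have : hull (@pos R Th) (val K :&: val K') x.
  by rewrite -(conforming (valP K) (valP K')); split.
by move=> /(hull_carrier H (subsetIl _ _))/(_ D0); rewrite inE => /andP[].
Qed.

Lemma vertex_cell K a : a \in val K -> cell_set K (pos a).
Proof.
case/ccw_of => b [c H]; rewrite (cell_setE H); have D := ccw_gt0 H.
by split; rewrite ?orient_pp ?orient_pqp ?mul0r// -expr2 sqr_ge0.
Qed.

Lemma vertex_in_cell K a : cell_set K (pos a) -> a \in val K.
Proof.
move=> aK; have [K' K't aK'] := @vertex_used _ Th a.
have [b [c H]] := @ccw_of (exist _ K' K't) a aK'.
apply: (carrier H _ aK); first exact: vertex_cell.
by rewrite gt_eqF// (ccw_gt0 H).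
Qed.

(** Conformity, through [vertex_in_cell], would put two vertices at the same place into one
    triangle, which would then be degenerate. *)
Lemma pos_inj : injective (@pos R Th).
Proof.
move=> a b abE; apply/eqP/negP => /negP ab.
have [K Kt aK] := @vertex_used _ Th a; pose K' : cell Th := exist _ K Kt.
have bK : b \in val K'.
  by apply: vertex_in_cell; rewrite -abE; exact: vertex_cell.
have [c [] H] := @ccw_edge K' a b ab aK bK;
  by have := ccw_gt0 H; rewrite abE orient_pp ltxx.
Qed.

(* Otherwise a point near the midpoint of the edge would lie in both triangles
   but not on the edge. *)
Lemma left_uniq K K' a b : left K a b -> left K' a b -> K = K'.
Proof.
move=> /leftP[c H] /leftP[d H'].
suff dK : d \in val K.
  have [ad bd] : a != d /\ b != d by have [] := ccw_neq H'.
  have dc : d = c.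
    by case: (mem_ccw H dK) => // E; rewrite E eqxx in ad bd.
  by apply: val_inj; rewrite (ccw_val H) (ccw_val H') dc.
set D := orient (pos a) (pos b) (pos c); have D0 : 0 < D := ccw_gt0 H.
set D' := orient (pos a) (pos b) (pos d); have D'0 : 0 < D' := ccw_gt0 H'.
pose E1 := `|orient (pos d) (pos b) (pos c)|; pose E2 := `|orient (pos a) (pos d) (pos c)|.
have E10 : 0 <= E1 by exact: normr_ge0.
have E20 : 0 <= E2 by exact: normr_ge0.
(* So small that moving from the midpoint towards [d] keeps the coordinates at [a] and [b]
   nonnegative: they start from [(1 - e) / 2 * D], at least [3 / 8 * D], and lose at most
   [D / 4]. *)
pose e := D / (4 * (D + E1 + E2)).
have T0 : 0 < D + E1 + E2 by lra.
have e0 : 0 < e by rewrite divr_gt0// mulr_gt0.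
have eD : e * (D + E1 + E2) = D / 4 by rewrite /e; field; rewrite gt_eqF.
have e1 : e <= 1 / 4.
  rewrite -(ler_pM2r T0) eD; nra.
have eE1 : e * E1 <= D / 4 by rewrite -eD; nra.
have eE2 : e * E2 <= D / 4 by rewrite -eD; nra.
have F1 : - (e * E1) <= e * orient (pos d) (pos b) (pos c).
  by rewrite -mulrN ler_pM2l// lerNl; have := ler_norm (- orient (pos d) (pos b) (pos c)); rewrite normrN.
have F2 : - (e * E2) <= e * orient (pos a) (pos d) (pos c).
  by rewrite -mulrN ler_pM2l// lerNl; have := ler_norm (- orient (pos a) (pos d) (pos c)); rewrite normrN.
pose m := along (pos a) (pos b) (1 / 2); pose x := along m (pos d) e.
have oa : orient x (pos b) (pos c) = (1 - e) / 2 * D + e * orient (pos d) (pos b) (pos c).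
  by rewrite /x /m /along /D /orient /=; field.
have ob : orient (pos a) x (pos c) = (1 - e) / 2 * D + e * orient (pos a) (pos d) (pos c).
  by rewrite /x /m /along /D /orient /=; field.
have oc : orient (pos a) (pos b) x = e * D'.
  by rewrite /x /m /along /D' /orient /=; field.
have oa' : orient x (pos b) (pos d) = (1 - e) / 2 * D'.
  by rewrite /x /m /along /D' /orient /=; field.
have ob' : orient (pos a) x (pos d) = (1 - e) / 2 * D'.
  by rewrite /x /m /along /D' /orient /=; field.
have xK : cell_set K x.
  rewrite (cell_setE H); split; apply: mulr_ge0; rewrite -/D ?(ltW D0)//.
  - by rewrite oa; nra.
  - by rewrite ob; nra.
  - by rewrite oc mulr_ge0// ltW.
have xK' : cell_set K' x.
  rewrite (cell_setE H'); split; apply: mulr_ge0; rewrite -/D' ?(ltW D'0)//.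
  - by rewrite oa'; nra.
  - by rewrite ob'; nra.
  - by rewrite oc mulr_ge0// ltW.
apply: (carrier (ccw_rot (ccw_rot H')) xK' xK).
by rewrite -orientC oc mulf_neq0// gt_eqF.
Qed.

Lemma edge_uniq K K' a b : edge_of a b K -> edge_of a b K' ->
  left K a b = left K' a b -> K = K'.
Proof.
move=> e e' LL; have [L|L] := edge_left e; first by apply: left_uniq (L) _; rewrite -LL.
have L' : ~~ left K' a b by rewrite -LL; exact: left_asym.
have [L''|L''] := edge_left e'; first by rewrite L'' in L'.
exact: left_uniq L L''.
Qed.

Lemma along_segment_orient (p q r : pt) t : 0 <= t <= 1 ->
  orient (along p q t) q r = (1 - t) * orient p q r /\
  orient p (along p q t) r = t * orient p q r /\
  orient p q (along p q t) = 0.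
Proof. by move=> _; rewrite /orient /along /=; split; [|split]; ring. Qed.

Lemma along_cell K a b t : edge_of a b K -> 0 <= t <= 1 ->
  cell_set K (along (pos a) (pos b) t).
Proof.
move=> [ab aK bK] t01; have [t0 t1] := andP t01.
have [c [{}H|{}H]] := ccw_edge ab aK bK; rewrite (cell_setE H);
    have D0 := ccw_gt0 H; split; apply: mulr_ge0; rewrite ?(ltW D0)//.
- by rewrite (_ : orient _ _ _ = (1 - t) * orient (pos a) (pos b) (pos c));
    [apply: mulr_ge0; [rewrite subr_ge0|exact: ltW]|rewrite /orient /along /=; ring].
- by rewrite (_ : orient _ _ _ = t * orient (pos a) (pos b) (pos c));
    [apply: mulr_ge0; [|exact: ltW]|rewrite /orient /along /=; ring].
- by rewrite (_ : orient _ _ _ = 0)//; rewrite /orient /along /=; ring.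
- by rewrite (_ : orient _ _ _ = t * orient (pos b) (pos a) (pos c));
    [apply: mulr_ge0; [|exact: ltW]|rewrite /orient /along /=; ring].
- by rewrite (_ : orient _ _ _ = (1 - t) * orient (pos b) (pos a) (pos c));
    [apply: mulr_ge0; [rewrite subr_ge0|exact: ltW]|rewrite /orient /along /=; ring].
- by rewrite (_ : orient _ _ _ = 0)//; rewrite /orient /along /=; ring.
Qed.

(** Both endpoints carry a nonzero barycentric coordinate at a point of the open edge, so [carrier]
    applies to each. *)
Lemma carrier_edge K K' a b t : edge_of a b K -> 0 < t < 1 ->
  cell_set K' (along (pos a) (pos b) t) -> a \in val K' /\ b \in val K'.
Proof.
move=> e /andP[t0 t1] xK'; have t01 : 0 <= t <= 1 by rewrite !ltW.
have xK := along_cell e t01; case: e => ab aK bK.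
have nt0 : 1 - t != 0 by rewrite subr_eq0 gt_eqF.
have [c [H|H]] := ccw_edge ab aK bK; have D0 := ccw_gt0 H; split.
- apply: (carrier H xK xK').
  by rewrite (along_segment_orient _ _ _ t01).1 mulf_neq0// gt_eqF.
- apply: (carrier (ccw_rot H) xK xK').
  by rewrite orientC (along_segment_orient _ _ _ t01).2.1 mulf_neq0// gt_eqF.
- apply: (carrier (ccw_rot H) xK xK').
  rewrite (_ : orient _ _ _ = (1 - t) * orient (pos b) (pos a) (pos c)).
    by rewrite mulf_neq0// gt_eqF.
  by rewrite /orient /along /=; ring.
- apply: (carrier H xK xK').
  rewrite (_ : orient _ _ _ = t * orient (pos b) (pos a) (pos c)).
    by rewrite mulf_neq0// gt_eqF.
  by rewrite /orient /along /=; ring.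
Qed.

(** Distinct triangles share at most two vertices, so the convex combination provided by conformity
    has at most two terms. *)
Lemma common_point K K' x : K != K' -> cell_set K x -> cell_set K' x ->
  (exists a, x = pos a /\ val K :&: val K' = [set a]%SET) \/
  (exists a b t, [/\ a != b, val K :&: val K' = [set a; b]%SET, 0 <= t <= 1
     & x = along (pos a) (pos b) t]).
Proof.
move=> KK' xK xK'.
have : hull (@pos R Th) (val K :&: val K') x.
  by rewrite -(conforming (valP K) (valP K')); split.
have : (#|val K :&: val K'| < 3)%N.
  have c3 : (#|val K :&: val K'| <= 3)%N.
    by have := subset_leq_card (subsetIl (val K) (val K')); rewrite (card_triangle (valP K)).
  rewrite ltn_neqAle c3 andbT.
  apply: contraNneq KK' => {}c3; apply/eqP/val_inj.
  have E1 : val K :&: val K' = val K.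
    by apply/eqP; rewrite eqEcard subsetIl c3 (card_triangle (valP K)).
  have E2 : val K :&: val K' = val K'.
    by apply/eqP; rewrite eqEcard subsetIr c3 (card_triangle (valP K')).
  by rewrite -E1 {1}E2.
case c : #|val K :&: val K'| => [|[|[|//]]] _.
- move/eqP: c; rewrite cards_eq0 => /eqP ->; case=> l [_].
  by rewrite big_set0 => /eqP; rewrite eq_sym oner_eq0.
- move/eqP: c => /cards1P [a aE]; rewrite aE => -[l [_]]; rewrite !big_set1 => l1 ->.
  by left; exists a; split=> //; rewrite l1 !mul1r -surjective_pairing.
- move/eqP: c => /cards2P [a [b [ab abE]]]; rewrite abE => -[l [l0]].
  rewrite !big_setU1 ?inE//= !big_set1 => l1 ->.
  right; exists a, b, (l b); split=> //.
    by rewrite l0 -l1 lerDr l0.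
  by rewrite /along -l1 addrK.
Qed.

Lemma closed_cell K : closed (cell_set K).
Proof.
have [a [b [c H]]] := ccw_exists K; rewrite (cell_setE H).
have cl (c0 c1 c2 : R) : closed [set p : pt | 0 <= c0 + c1 * p.1 + c2 * p.2].
  rewrite (_ : mkset _ = (fun p : pt => c0 + c1 * p.1 + c2 * p.2) @^-1` [set y | 0 <= y]); last by [].
  apply: closed_comp; last exact: closed_ge.
  move=> p _; apply: cvgD; [apply: cvgD|]; try exact: cvg_cst.
    by apply: cvgM; [exact: cvg_cst|exact: cvg_fst].
  by apply: cvgM; [exact: cvg_cst|exact: cvg_snd].
set D := orient (pos a) (pos b) (pos c).
rewrite (_ : tri _ _ _ =
  [set p | 0 <= ((pos b).1 * (pos c).2 - (pos b).2 * (pos c).1) * D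
    + (((pos b).2 - (pos c).2) * D) * p.1 + (((pos c).1 - (pos b).1) * D) * p.2]
  `&` [set p | 0 <= ((pos c).1 * (pos a).2 - (pos c).2 * (pos a).1) * D
    + (((pos c).2 - (pos a).2) * D) * p.1 + (((pos a).1 - (pos c).1) * D) * p.2]
  `&` [set p | 0 <= ((pos a).1 * (pos b).2 - (pos a).2 * (pos b).1) * D
    + (((pos a).2 - (pos b).2) * D) * p.1 + (((pos b).1 - (pos a).1) * D) * p.2]).
  by apply: closedI; [apply: closedI|]; exact: cl.
have E1 p (E : R) : orient p (pos b) (pos c) * E = ((pos b).1 * (pos c).2 - (pos b).2 * (pos c).1) * E
    + (((pos b).2 - (pos c).2) * E) * p.1 + (((pos c).1 - (pos b).1) * E) * p.2.
  by rewrite /orient; ring.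
have E2 p (E : R) : orient (pos a) p (pos c) * E = ((pos c).1 * (pos a).2 - (pos c).2 * (pos a).1) * E
    + (((pos c).2 - (pos a).2) * E) * p.1 + (((pos a).1 - (pos c).1) * E) * p.2.
  by rewrite /orient; ring.
have E3 p (E : R) : orient (pos a) (pos b) p * E = ((pos a).1 * (pos b).2 - (pos a).2 * (pos b).1) * E
    + (((pos a).2 - (pos b).2) * E) * p.1 + (((pos b).1 - (pos a).1) * E) * p.2.
  by rewrite /orient; ring.
by apply/seteqP; split=> p; rewrite /tri /= -/D E1 E2 E3; [case|case=> -[]].
Qed.

(** There are finitely many triangles and they are closed: a small ball meets only those that
    contain its centre. *)
Lemma near_cells (x : pt) : exists2 r, 0 < r &
  forall y K, ball x r y -> cell_set K y -> cell_set K x.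
Proof.
have H K : \forall y \near x, cell_set K y -> cell_set K x.
  have [xK|xK] := pselect (cell_set K x); first by near=> y.
  have : open (~` cell_set K) by apply: closed_openC; exact: closed_cell.
  rewrite openE => /(_ x xK); apply: filterS => y yK yK'.
  by exfalso; exact: yK.
have : \forall y \near x, forall K, cell_set K y -> cell_set K x.
  exact: (@filter_forall _ (cell Th) (fun K y => cell_set K y -> cell_set K x) (nbhs x) _ H).
by case/nbhs_ballP => r r0 rP; exists r => // y K /rP /(_ K).
Unshelve. all: by end_near.
Qed.

Definition inside K (x : pt) := exists a b c, [/\ ccw K a b c,
  0 < orient x (pos b) (pos c), 0 < orient (pos a) x (pos c)
  & 0 < orient (pos a) (pos b) x].

Lemma inside_cell K x : inside K x -> cell_set K x.
Proof.
case=> a [b [c [H h1 h2 h3]]]; rewrite (cell_setE H); have D := ccw_gt0 H.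
by split; rewrite mulr_ge0// ltW.
Qed.

(** All three barycentric coordinates are nonzero, so [carrier] puts all three vertices into
    [K']. *)
Lemma inside_uniq K K' x : inside K x -> cell_set K' x -> K' = K.
Proof.
move=> xK xK'; have := inside_cell xK; case: xK => a [b [c [H h1 h2 h3]]] xK.
have aK : a \in val K' by apply: (carrier H xK xK'); rewrite gt_eqF.
have bK : b \in val K'.
  by apply: (carrier (ccw_rot H) xK xK'); rewrite orientC gt_eqF.
have cK : c \in val K'.
  apply: (carrier (ccw_rot (ccw_rot H)) xK xK').
  by rewrite -orientC gt_eqF.
apply/esym/val_inj/eqP; rewrite eqEcard !card_triangle ?(valP K) ?(valP K')// leqnn andbT.
by rewrite (ccw_val H); apply/fintype.subsetP => y; rewrite !inE => /orP[/orP[]|] /eqP ->.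
Qed.

Lemma inside_along K x y t : inside K x -> inside K y -> 0 <= t <= 1 ->
  inside K (along x y t).
Proof.
case=> a [b [c [H h1 h2 h3]]] [a' [b' [c' [H' k1 k2 k3]]]] t01.
have [l1 l2 l3] : [/\ 0 < orient y (pos b) (pos c), 0 < orient (pos a) y (pos c)
    & 0 < orient (pos a) (pos b) y].
  have L : left K a' b' by apply/leftP; exists c'.
  move: L; rewrite (left_ccw a' b' H) => /or3P[] /andP[/eqP Ea /eqP Eb]; subst a' b'.
  - by have Ec := ccw_uniq H H'; subst c'.
  - have Ec := ccw_uniq (ccw_rot H) H'; subst c'.
    by rewrite -(orientC y) -(orientC (pos a) y) -(orientC (pos a) (pos b)).
  - have Ec := ccw_uniq (ccw_rot (ccw_rot H)) H'; subst c'.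
    by rewrite (orientC (pos c) y) (orientC (pos c) (pos a)) (orientC y (pos a)).
have mix (u v : R) : 0 < u -> 0 < v -> 0 < (1 - t) * u + t * v.
  by have [s|s] := leP t (1 / 2) => *; nra.
exists a, b, c; split=> //.
- by rewrite (_ : orient _ _ _ = (1 - t) * orient x (pos b) (pos c)
    + t * orient y (pos b) (pos c)); [exact: mix|rewrite /orient /along /=; ring].
- by rewrite (_ : orient _ _ _ = (1 - t) * orient (pos a) x (pos c)
    + t * orient (pos a) y (pos c)); [exact: mix|rewrite /orient /along /=; ring].
- by rewrite (_ : orient _ _ _ = (1 - t) * orient (pos a) (pos b) x
    + t * orient (pos a) (pos b) y); [exact: mix|rewrite /orient /along /=; ring].
Qed.

Lemma inside_near_edge K a b c t e : ccw K a b c -> 0 < t < 1 -> 0 < e < 1 ->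
  inside K (along (along (pos a) (pos b) t) (pos c) e).
Proof.
move=> H /andP[t0 t1] /andP[e0 e1]; exists a, b, c; have D := ccw_gt0 H.
split=> //.
- rewrite (_ : orient _ _ _ = (1 - e) * (1 - t) * orient (pos a) (pos b) (pos c)).
    by do !apply: mulr_gt0; rewrite // subr_gt0.
  by rewrite /orient /along /=; ring.
- rewrite (_ : orient _ _ _ = (1 - e) * t * orient (pos a) (pos b) (pos c)).
    by do !apply: mulr_gt0; rewrite // subr_gt0.
  by rewrite /orient /along /=; ring.
- rewrite (_ : orient _ _ _ = e * orient (pos a) (pos b) (pos c)).
    by do !apply: mulr_gt0.
  by rewrite /orient /along /=; ring.
Qed.

Lemma inside_exists K : exists x, inside K x.
Proof.
have [a [b [c H]]] := ccw_exists K.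
by exists (along (along (pos a) (pos b) (1 / 2)) (pos c) (1 / 2)); apply: inside_near_edge => //; lra.
Qed.

Lemma inside_open K x : inside K x -> nbhs x (cell_set K).
Proof.
move=> xK; have := inside_cell xK => xK0; case: xK => a [b [c [H h1 h2 h3]]].
rewrite (cell_setE H); have D := ccw_gt0 H.
have op (c0 c1 c2 : R) : 0 < c0 + c1 * x.1 + c2 * x.2 ->
    \forall p \near x, 0 < c0 + c1 * p.1 + c2 * p.2.
  have : open [set p : pt | 0 < c0 + c1 * p.1 + c2 * p.2].
    rewrite (_ : mkset _ = (fun p : pt => c0 + c1 * p.1 + c2 * p.2) @^-1` [set y | 0 < y]); last by [].
    apply: open_comp; last exact: open_gt.
    move=> p _; apply: cvgD; [apply: cvgD|]; try exact: cvg_cst.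
      by apply: cvgM; [exact: cvg_cst|exact: cvg_fst].
    by apply: cvgM; [exact: cvg_cst|exact: cvg_snd].
  by rewrite openE => oP; exact: oP.
have E1 p : orient p (pos b) (pos c) = ((pos b).1 * (pos c).2 - (pos b).2 * (pos c).1)
    + ((pos b).2 - (pos c).2) * p.1 + ((pos c).1 - (pos b).1) * p.2.
  by rewrite /orient; ring.
have E2 p : orient (pos a) p (pos c) = ((pos c).1 * (pos a).2 - (pos c).2 * (pos a).1)
    + ((pos c).2 - (pos a).2) * p.1 + ((pos a).1 - (pos c).1) * p.2.
  by rewrite /orient; ring.
have E3 p : orient (pos a) (pos b) p = ((pos a).1 * (pos b).2 - (pos a).2 * (pos b).1)
    + ((pos a).2 - (pos b).2) * p.1 + ((pos b).1 - (pos a).1) * p.2.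
  by rewrite /orient; ring.
rewrite E1 in h1; rewrite E2 in h2; rewrite E3 in h3.
near=> p; split; rewrite mulr_ge0 ?(ltW D)// ltW//.
- by rewrite E1; near: p; exact: op.
- by rewrite E2; near: p; exact: op.
- by rewrite E3; near: p; exact: op.
Unshelve. all: by end_near.
Qed.

End Cells.

(** * Cohomology of the dual graph *)

Lemma along_near {R : realType} (y z : R * R) (t r : R) : 0 < r ->
  exists2 e, 0 < e & forall s, `|t - s| < e -> ball (along y z t) r (along y z s).
Proof.
move=> r0; have /nbhs_ballP [e e0 eP] := @along_continuous R y z t _
  (nbhsx_ballx (along y z t) r r0).
by exists e => // s ts; exact: eP.
Qed.

Lemma small_step {R : realType} (d1 d2 : R) : 0 < d1 -> 0 < d2 ->
  exists d, [/\ 0 < d, d < 1, `|0 - d| < d1 & `|0 - d| < d2].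
Proof.
move=> d10 d20; pose m := Num.min d1 d2.
have m0 : 0 < m by rewrite lt_min d10.
have [m1 m2] : m <= d1 /\ m <= d2 by rewrite !ge_min !lexx orbT.
pose d := Num.min (1 / 2) (m / 2).
have d0 : 0 < d by rewrite lt_min; apply/andP; split; lra.
have [h1 h2] : d <= 1 / 2 /\ d <= m / 2 by rewrite !ge_min !lexx orbT.
by exists d; rewrite sub0r normrN gtr0_norm//; split; lra.
Qed.

Section TriangulatedDomain.
Context {R : realType} {Omega : set (R * R)} {Th : triangulation R}.
Local Notation pt := (R * R)%type.
Local Notation V := (vertex Th).
Implicit Types (K : cell Th) (a b c : V) (p : pt).
Hypotheses (Oopen : open Omega) (Oreg : interior (closure Omega) = Omega)
  (Otri : triangulates Omega Th) (Osc : simply_connected Omega).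

Lemma cell_closure K x : cell_set K x -> closure Omega x.
Proof. by move=> xK; rewrite Otri; exists K. Qed.

Lemma Omega_cell x : Omega x -> exists K : cell Th, cell_set K x.
Proof.
by move=> /subset_closure; rewrite Otri => -[K _ xK]; exists K.
Qed.

(** Regularity of the domain enters here: the interior of a triangle is open in the closure of
    [Omega], hence contained in [Omega]. *)
Lemma inside_Omega K x : inside K x -> Omega x.
Proof.
move=> xK; rewrite -Oreg; apply: filterS (inside_open xK) => y; exact: cell_closure.
Qed.

Lemma boundaryN x : closure Omega x -> (boundary Omega x <-> ~ Omega x).
Proof. by move=> cx; rewrite /boundary (interior_id _).1//; split=> [[]|]. Qed.

Lemma Omega_int_edge K a b t : edge_of a b K -> 0 <= t <= 1 ->
  Omega (along (pos a) (pos b) t) -> int_edge Omega a b.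
Proof.
move=> e t01 Ot; split; first by exists K.
move=> /(_ (along (pos a) (pos b) t)) H.
have : boundary Omega (along (pos a) (pos b) t).
  by apply: H; exists t => //; rewrite /= in_itv.
by move/boundaryN; apply => //; exact: cell_closure (along_cell e t01).
Qed.

(** By definition an interior edge leaves the boundary somewhere, possibly only at an endpoint;
    openness of [Omega] allows the point to be moved into the open edge. *)
Lemma int_edge_point a b : int_edge Omega a b ->
  exists2 t, 0 < t < 1 & Omega (along (pos a) (pos b) t).
Proof.
move=> [[K e] nb].
have [t0 t01 Ot0] : exists2 t, 0 <= t <= 1 & Omega (along (pos a) (pos b) t).
  apply: contra_notP nb => nO _ [t + <-]; rewrite /= in_itv /= => t01.
  apply/boundaryN; first exact: cell_closure (along_cell e t01).
  by move=> Ot; apply: nO; exists t.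
have := Oopen; rewrite openE => /(_ _ Ot0) /nbhs_ballP [r r0 rO].
have [d d0 dP] := along_near (pos a) (pos b) t0 r0.
pose d' := Num.min (d / 2) (1 / 4).
have [d'1 d'2] : d' <= d / 2 /\ d' <= 1 / 4 by rewrite /d' !ge_min !lexx orbT.
have d'0 : 0 < d' by rewrite /d' lt_min; apply/andP; split; lra.
have [t2|t2] := leP t0 (1 / 2).
  exists (t0 + d'); first by lra.
  by apply: rO; apply: dP; rewrite opprD addNKr normrN gtr0_norm//; lra.
exists (t0 - d'); first by lra.
by apply: rO; apply: dP; rewrite opprB addrC subrK gtr0_norm//; lra.
Qed.

Lemma int_edge_sym a b : int_edge Omega a b -> int_edge Omega b a.
Proof.
move=> ie; have [t t01 Ot] := int_edge_point ie; case: ie => -[K e] _.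
apply: (@Omega_int_edge K b a (1 - t) (edge_of_sym e)); first by lra.
rewrite (_ : along _ _ _ = along (pos a) (pos b) t)//.
by rewrite /along subKr ![(1 - t) * _ + _]addrC.
Qed.

Lemma edge_cases K a b : edge_of a b K -> int_edge Omega a b \/ bdry_edge Omega a b.
Proof.
move=> e; have [H|H] := pselect (segment (pos a) (pos b) `<=` boundary Omega).
  by right; split=> //; exists K.
by left; split=> //; exists K.
Qed.

(** If the known triangle is on the right, a point slightly across the edge still lies in [Omega],
    hence in some triangle. By closedness that triangle contains the point of the open edge, hence
    the edge, and it cannot be on the right again. *)
Lemma int_edge_left a b : int_edge Omega a b -> exists K, left K a b.
Proof.
move=> ie; have [t t01 Ot] := int_edge_point ie; have [[K e] _] := ie.
have [L|/leftP [c H]] := edge_left e; first by exists K.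
have D := ccw_gt0 H; set x := along (pos a) (pos b) t in Ot.
have := Oopen; rewrite openE => /(_ _ Ot) /nbhs_ballP [r r0 rO].
have [r' r'0 r'P] := near_cells (Th := Th) x.
have m0 : 0 < Num.min r r' by rewrite lt_min r0 r'0.
have [d d0 dP] := along_near x (pos c) 0 m0.
(* The negative parameter moves away from [c], to the other side of the edge. *)
pose y := along x (pos c) (- (d / 2)).
have : ball x (Num.min r r') y.
  by rewrite -[x in ball x](along0 x (pos c)); apply: dP; rewrite sub0r opprK gtr0_norm; lra.
move=> yb; have yr : ball x r y by apply: le_ball yb; rewrite ge_min lexx.
have yr' : ball x r' y by apply: le_ball yb; rewrite ge_min lexx orbT.
have [K' yK'] := Omega_cell (rO _ yr).
have xK' := r'P _ _ yr' yK'.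
have [aK' bK'] := carrier_edge e t01 xK'.
have e' : edge_of a b K' by case: e.
have [L|L] := edge_left e'; first by exists K'.
have KK' : K' = K by apply: left_uniq L _; apply/leftP; exists c.
move: yK'; rewrite KK' (cell_setE H) => -[_ _].
rewrite pmulr_lge0// (_ : orient _ _ _ = - (d / 2) * orient (pos b) (pos a) (pos c)).
  by rewrite pmulr_lge0//; lra.
by rewrite /y /x /orient /along /=; ring.
Qed.

Lemma cell_choice (K0 : cell Th) : exists kp : pt -> cell Th,
  forall x, Omega x -> cell_set (kp x) x.
Proof.
have H x : exists K, Omega x -> cell_set K x.
  have [/Omega_cell [K xK]|nO] := pselect (Omega x); first by exists K.
  by exists K0.
by have [kp kpP] := choice H; exists kp.
Qed.

(* At a vertex x, two triangles are joined by a segment near x that misses x. *)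
Lemma local_connect (u : cell Th -> R) x : Omega x ->
  (forall K K' a b t, edge_of a b K -> edge_of a b K' -> 0 <= t <= 1 ->
     x = along (pos a) (pos b) t -> u K = u K') ->
  forall K K', cell_set K x -> cell_set K' x -> u K = u K'.
Proof.
move=> Ox uP K K' xK xK'.
have [->//|KK'] := eqVneq K K'.
have [[a [xa aE]]|[a [b [t [ab abE t01 xE]]]]] := common_point KK' xK xK'; last first.
  have : a \in val K :&: val K' by rewrite abE !inE eqxx.
  have : b \in val K :&: val K' by rewrite abE !inE eqxx orbT.
  rewrite !inE => /andP[bK bK'] /andP[aK aK'].
  by apply: (uP _ _ a b t).
have := Oopen; rewrite openE => /(_ _ Ox) /nbhs_ballP [r1 r10 r1O].
have [r2 r20 r2P] := near_cells (Th := Th) x.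
pose r := Num.min r1 r2; have r0 : 0 < r by rewrite lt_min r10.
pose A : set pt := [set p | ball x r p /\ p <> x].
have AO p : A p -> Omega p.
  by move=> [px _]; apply: r1O; apply: le_ball px; rewrite ge_min lexx.
have Ax p L : A p -> cell_set L p -> a \in val L.
  move=> [px _] pL; apply: vertex_in_cell; rewrite -xa; apply: r2P pL.
  by apply: le_ball px; rewrite ge_min lexx orbT.
(* Near [x] but off it, two distinct triangles that meet share an edge with endpoint [a]; this edge
   contains [x], so the hypothesis on [u] applies. *)
have uA p L L' : A p -> cell_set L p -> cell_set L' p -> u L = u L'.
  move=> Ap pL pL'; have [->//|LL'] := eqVneq L L'.
  have aL := Ax _ _ Ap pL; have aL' := Ax _ _ Ap pL'.
  have aLL : a \in val L :&: val L' by rewrite inE aL aL'.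
  have [[e [pe eE]]|[e [f [t [ef efE t01 pE]]]]] := common_point LL' pL pL'.
    by move: aLL; rewrite eE inE => /eqP ae; case: Ap => _; rewrite pe -ae xa.
  have : e \in val L :&: val L' by rewrite efE !inE eqxx.
  have : f \in val L :&: val L' by rewrite efE !inE eqxx orbT.
  rewrite !inE => /andP[fL fL'] /andP[eL eL'].
  move: aLL; rewrite efE !inE => /orP[] /eqP ae.
    by apply: (uP _ _ e f 0); rewrite ?lexx ?ler01// along0 xa ae.
  by apply: (uP _ _ e f 1); rewrite ?lexx ?ler01// along1 xa ae.
have [b [c H]] : exists b c, ccw K a b c by apply: ccw_of; apply: vertex_in_cell; rewrite -xa.
have [b1 [c1 H1]] : exists b c, ccw K' a b c by apply: ccw_of; apply: vertex_in_cell; rewrite -xa.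
have [ab ac bc] := ccw_neq H; have [aK bK cK] := ccw_mem H.
have [ab1 ac1 bc1] := ccw_neq H1; have [aK' b1K' c1K'] := ccw_mem H1.
(* One of the other two vertices of [K'] is off the line [ab], since otherwise [K'] would be
   degenerate. Then the segment joining the edges [ab] and [ab'] avoids [x]. *)
have [b' [e' D0]] : exists b', edge_of a b' K' /\ orient (pos a) (pos b) (pos b') != 0.
  have [D1|D1] := eqVneq (orient (pos a) (pos b) (pos b1)) 0; last by exists b1.
  have [D2|D2] := eqVneq (orient (pos a) (pos b) (pos c1)) 0; last by exists c1.
  exfalso; have := ccw_gt0 H1; have := ccw_gt0 H.
  move: D1 D2; rewrite /orient => D1 D2 D3 D4.
  set p1 := (pos b).1 - (pos a).1 in D1 D2 D3; set p2 := (pos b).2 - (pos a).2 in D1 D2 D3.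
  set q1 := (pos b1).1 - (pos a).1 in D1 D4; set q2 := (pos b1).2 - (pos a).2 in D1 D4.
  set s1 := (pos c1).1 - (pos a).1 in D2 D4; set s2 := (pos c1).2 - (pos a).2 in D2 D4.
  have E1 : p1 * (q1 * s2 - q2 * s1) = 0.
    have -> : p1 * (q1 * s2 - q2 * s1) = q1 * (p1 * s2 - p2 * s1) - s1 * (p1 * q2 - p2 * q1) by ring.
    by rewrite D1 D2 !mulr0 subrr.
  have E2 : p2 * (q1 * s2 - q2 * s1) = 0.
    have -> : p2 * (q1 * s2 - q2 * s1) = q2 * (p1 * s2 - p2 * s1) - s2 * (p1 * q2 - p2 * q1) by ring.
    by rewrite D1 D2 !mulr0 subrr.
  move/eqP: E1; rewrite mulf_eq0 (gt_eqF D4) orbF => /eqP p10.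
  move/eqP: E2; rewrite mulf_eq0 (gt_eqF D4) orbF => /eqP p20.
  by move: D3; rewrite p10 p20 !mul0r subrr ltxx.
have e : edge_of a b K by [].
have [d1 d10 d1P] := along_near (pos a) (pos b) 0 r0.
have [d2 d20 d2P] := along_near (pos a) (pos b') 0 r0.
have [d [d0 dh dd1 dd2]] := small_step d10 d20.
have d01 : 0 <= d <= 1 by rewrite !ltW.
pose Y := along (pos a) (pos b) d; pose Z := along (pos a) (pos b') d.
have bY : ball x r Y.
  by rewrite xa -[x in ball x](along0 (pos a) (pos b)); exact: d1P.
have bZ : ball x r Z.
  by rewrite xa -[x in ball x](along0 (pos a) (pos b')); exact: d2P.
have YK : cell_set K Y by exact: along_cell.
have ZK' : cell_set K' Z by exact: along_cell.
have YZA t : 0 <= t <= 1 -> A (along Y Z t).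
  move=> t01; split; first exact: ball_along.
  rewrite xa => E.
  have E1 : orient (pos a) Y (along Y Z t) = t * d ^+ 2 * orient (pos a) (pos b) (pos b').
    by rewrite /orient /Y /Z /along /=; ring.
  have E2 : orient (pos a) (along Y Z t) Z = (1 - t) * d ^+ 2 * orient (pos a) (pos b) (pos b').
    by rewrite /orient /Y /Z /along /=; ring.
  move: E1 E2; rewrite E orient_pqp orient_pp => /esym/eqP; rewrite !mulf_eq0 (negbTE D0).
  rewrite (gt_eqF d0) !orbF => /eqP t0 /esym/eqP.
  by rewrite t0 subr0 mul1r !mulf_eq0 (negbTE D0) (gt_eqF d0).
have YZp : path_in A (along Y Z).
  split; first by apply: continuous_subspaceT; exact: along_continuous.
  by move=> _ [t + <-]; rewrite /= in_itv /=; exact: YZA.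
have [kp kpP] := cell_choice K.
have := path_locally_constant (f := u \o kp) YZp.
rewrite along0 along1 /= => /(_ _) kYZ.
have AY : A Y by rewrite -(along0 Y Z); apply: YZA; rewrite lexx ler01.
have AZ : A Z by rewrite -(along1 Y Z); apply: YZA; rewrite lexx ler01.
rewrite (uA Y K (kp Y))//; last exact/kpP/AO.
rewrite (uA Z K' (kp Z))//; last exact/kpP/AO.
apply: kYZ => p Ap; have [s s0 sP] := near_cells (Th := Th) p.
exists s => // q Aq pq; apply: (uA p) => //; last exact/kpP/AO.
by apply: sP pq _; exact/kpP/AO.
Qed.

(** The value of [u] on a triangle containing the point is a well-defined, locally constant function
    on [Omega], and paths in [Omega] join the interiors of any two triangles. *)
Lemma global_connect (u : cell Th -> R) :
  (forall K K' a b, int_edge Omega a b -> edge_of a b K -> edge_of a b K' -> u K = u K') ->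
  forall K K', u K = u K'.
Proof.
move=> uP K K'.
have loc x L L' : Omega x -> cell_set L x -> cell_set L' x -> u L = u L'.
  move=> Ox; apply: local_connect => // M M' a b t e e' t01 xE.
  by apply: (uP _ _ a b) => //; apply: (Omega_int_edge e t01); rewrite -xE.
have [kp kpP] := cell_choice K.
have [y yK] := inside_exists K; have [z zK'] := inside_exists K'.
have Oy := inside_Omega yK; have Oz := inside_Omega zK'.
have [g [pg g0 g1]] := Osc.1 y z Oy Oz.
rewrite (loc y K (kp y))//; [|exact: inside_cell|exact: kpP].
rewrite (loc z K' (kp z))//; [|exact: inside_cell|exact: kpP].
rewrite -g0 -g1; apply: (path_locally_constant (f := u \o kp) pg) => p Op.
have [s s0 sP] := near_cells (Th := Th) p.
exists s => // q Oq pq; apply: (loc p) => //; last exact: kpP.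
by apply: sP pq _; exact: kpP.
Qed.

(* By duality, from the connectedness of the star of the vertex. *)
Lemma star_potential (t : V -> V -> R) a : Omega (pos a) ->
  (forall b, t a b != 0 -> int_edge Omega a b) -> \sum_b t a b = 0 ->
  exists psi : cell Th -> R, forall b K K', left K a b -> left K' b a ->
    t a b = psi K - psi K'.
Proof.
move=> Oa supp t0.
pose g K b : R := (left K a b)%:R - (left K b a)%:R.
have [u uP|psi psiP] := @dual_solve R _ _ g (t a).
  have gE K b1 b2 : ccw K a b1 b2 -> \sum_b g K b * u b = u b1 - u b2.
    move=> H; have [n1 n2 n3] := ccw_neq H.
    rewrite (bigD1 b1)//= (bigD1 b2) 1?eq_sym//= big1 ?addr0.
      rewrite /g !(left_ccw _ _ H) !eqxx (negbTE n1) (negbTE n2) (negbTE n3).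
      rewrite ![b1 == a]eq_sym ![b2 == a]eq_sym ![b2 == b1]eq_sym.
      by rewrite (negbTE n1) (negbTE n2) (negbTE n3) /= subr0 sub0r mul1r mulN1r.
    move=> b /andP[bb1 bb2]; rewrite /g !(left_ccw _ _ H).
    rewrite (negbTE bb1) (negbTE bb2) (negbTE n1) (negbTE n2) !andbF /=.
    by rewrite subrr mul0r.
  (* For a triangle at [a], the dual condition says that [u] agrees on its two edges at [a]; [U] is
     this common value. The default 0 concerns only triangles away from [a]. *)
  pose U K := if [pick b | left K a b] is Some b then u b else 0.
  have UE K b : edge_of a b K -> U K = u b.
    move=> [ab aK bK]; have [b1 [b2 H]] := ccw_of aK.
    have u12 : u b1 = u b2 by apply/eqP; rewrite -subr_eq0 -(gE _ _ _ H) uP.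
    have L1 : left K a b1 by apply/leftP; exists b2.
    rewrite /U; case: pickP => [b' L|/(_ b1)]; last by rewrite L1.
    have u1 : u b1 = u b.
      by case: (mem_ccw H bK) => E; rewrite E ?eqxx // in ab *.
    rewrite -u1; move: L; rewrite (left_ccw _ _ H).
    have [n1 n2 n3] := ccw_neq H; rewrite eqxx (negbTE n1) (negbTE n2) /= orbF.
    by move/eqP ->.
  have Uc := @local_connect U _ Oa.
  have {}Uc K K' : a \in val K -> a \in val K' -> U K = U K'.
    move=> aK aK'; apply: Uc; [|exact: vertex_cell|exact: vertex_cell].
    move=> L L' e f s eL eL' s01 aE.
    have [ef eeL fL] := eL; have [_ eeL' fL'] := eL'.
    have aL : a \in val L by apply: vertex_in_cell; rewrite aE; exact: along_cell.
    have aL' : a \in val L' by apply: vertex_in_cell; rewrite aE; exact: along_cell.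
    have [ae|ae] := eqVneq a e; first by rewrite (UE L f) ?(UE L' f)// /edge_of ae.
    by rewrite (UE L e) ?(UE L' e).
  have [[b0 t0b]|nt] := pselect (exists b, t a b != 0); last first.
    rewrite big1// => b _; have [->|tb] := eqVneq (t a b) 0; first by rewrite mul0r.
    by case: nt; exists b.
  have [[K0 e0] _] := supp _ t0b; have [_ aK0 _] := e0.
  rewrite (eq_bigr (fun b => t a b * U K0)).
    by rewrite -mulr_suml t0 mul0r.
  move=> b _; have [->|tb] := eqVneq (t a b) 0; first by rewrite !mul0r.
  have [[K e] _] := supp _ tb; have [_ aK _] := e.
  by rewrite -(UE K b e) (Uc K K0).
exists psi => b K K' L L'; rewrite psiP /g.
have sumE (P : pred (cell Th)) M : P M -> (forall N, P N -> N = M) ->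
    \sum_N psi N * (P N)%:R = psi M.
  move=> PM PN; rewrite (bigD1 M)//= PM mulr1 big1 ?addr0// => N NM.
  case PNe : (P N); last by rewrite mulr0.
  by rewrite (PN _ PNe) eqxx in NM.
rewrite -(sumE (fun M => left M a b) K L); last by move=> N LN; exact: left_uniq LN L.
rewrite -(sumE (fun M => left M b a) K' L'); last by move=> N LN; exact: left_uniq LN L'.
by rewrite -sumrB; apply: eq_bigr => M _; rewrite mulrBr.
Qed.

(* The jumps define a local cocycle d(y, z) = D (kp y) (kp z) on Omega, where
   [kp y] is some triangle containing y; its primitive is constant inside each
   triangle. *)
Lemma dual_potential (t : V -> V -> R) :
  (forall a b, t b a = - t a b) -> (forall a b, t a b != 0 -> int_edge Omega a b) ->
  (forall a, Omega (pos a) -> \sum_b t a b = 0) ->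
  exists c : cell Th -> R, forall a b K K', int_edge Omega a b ->
    left K a b -> left K' b a -> t a b = c K - c K'.
Proof.
move=> tN supp t0.
have [[K0 _]|nK] := pselect (exists K : cell Th, True); last first.
  by exists (fun=> 0) => a b K; case: nK; exists K.
have [kp kpP] := cell_choice K0.
have psiE a : exists psi : cell Th -> R, Omega (pos a) ->
    forall b K K', left K a b -> left K' b a -> t a b = psi K - psi K'.
  have [Oa|nOa] := pselect (Omega (pos a)); last by exists (fun=> 0).
  by have [psi psiP] := star_potential Oa (supp a) (t0 a Oa); exists psi.
have [psi psiP] := choice psiE.
(* [De] is the jump across a common edge. [D] replaces it by a difference of the star potential when
   the triangles meet in exactly one vertex. The sign is that of [c K' - c K]. *)
pose De K K' := \sum_x \sum_y (left K' x y)%:R * ((left K y x)%:R * t x y).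
pose D K K' := if [pick a | val K :&: val K' == [set a]%SET] is Some a
  then psi a K' - psi a K else De K K'.
have De_edge K K' a b : left K' a b -> left K b a -> De K K' = t a b.
  move=> L' L; have [c H] := leftP _ _ _ L'; rewrite /De (sum_left _ H) L mul1r.
  have [n1 n2 n3] := ccw_neq H.
  have other e f : left K f e -> e = c \/ f = c -> False.
    move=> L2 ec; have cK : c \in val K.
      by have [_ ? ?] := left_edge L2; case: ec => <-.
    have [_ bK aK] := left_edge L.
    have KK' : K = K'.
      apply: val_inj; apply/eqP; rewrite eq_sym eqEcard (card_triangle (valP K)).
      rewrite (card_triangle (valP K')) leqnn andbT (ccw_val H).
      by apply/fintype.subsetP => x; rewrite !inE => /orP[/orP[]|] /eqP ->.
    by have := left_asym L'; rewrite -KK' L.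
  have -> : left K c b = false.
    by case L2 : (left K c b) => //; case: (other b c L2); right.
  have -> : left K a c = false.
    by case L2 : (left K a c) => //; case: (other c a L2); left.
  by rewrite !mul0r !addr0.
have De_anti K K' : De K' K = - De K K'.
  rewrite /De -sumrN exchange_big /=; apply: eq_bigr => y _.
  rewrite -sumrN; apply: eq_bigr => x _.
  by rewrite mulrCA tN mulrN mulrN.
have D_anti K K' : D K' K = - D K K'.
  rewrite /D finset.setIC; case: pickP => [a _|_]; first by rewrite opprB.
  exact: De_anti.
have D_diag K : D K K = 0 by have := D_anti K K; lra.
have D_star a K K' : Omega (pos a) -> a \in val K -> a \in val K' ->
    D K K' = psi a K' - psi a K.
  move=> Oa aK aK'; have [->|KK'] := eqVneq K K'; first by rewrite D_diag subrr.
  have aKK : a \in val K :&: val K' by rewrite inE aK.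
  rewrite /D; case: pickP => [e /eqP eE|n1].
    by move: aKK; rewrite eE inE => /eqP ->.
  have [[e [_ eE]]|[e [f [s [ef efE _ _]]]]] :=
      common_point KK' (vertex_cell aK) (vertex_cell aK').
    by have := n1 e; rewrite eE eqxx.
  have [b [eK eK']] : exists b, edge_of a b K /\ edge_of a b K'.
    have : e \in val K :&: val K' by rewrite efE !inE eqxx.
    have : f \in val K :&: val K' by rewrite efE !inE eqxx orbT.
    rewrite !inE => /andP[fK fK'] /andP[eK eK'].
    move: aKK; rewrite efE !inE => /orP[] /eqP ae; subst a; first by exists f.
    by exists e; rewrite /edge_of eq_sym.
  have [L|L] := edge_left eK.
    have L' : left K' b a.
      by have [L'|//] := edge_left eK'; case/eqP: KK'; exact: left_uniq L L'.
    by rewrite (De_edge _ _ _ _ L' L) tN (psiP a Oa b K K' L L') opprB.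
  have L' : left K' a b.
    by have [//|L'] := edge_left eK'; case/eqP: KK'; exact: left_uniq L L'.
  by rewrite (De_edge _ _ _ _ L' L) (psiP a Oa b K' K L' L).
(* At a vertex the star potential trivialises [D]. At any other point at most two distinct triangles
   meet, because three would share one edge, which has only two sides. *)
have D_cocycle x K1 K2 K3 : Omega x -> cell_set K1 x -> cell_set K2 x ->
    cell_set K3 x -> D K1 K2 + D K2 K3 = D K1 K3.
  move=> Ox x1 x2 x3.
  have [[a xa]|nv] := pselect (exists a, x = pos a).
    rewrite xa in Ox x1 x2 x3.
    by rewrite !(D_star a)//; try exact: vertex_in_cell; lra.
  have [E|n12] := eqVneq K1 K2; first by rewrite E D_diag add0r.
  have [E|n23] := eqVneq K2 K3; first by rewrite E D_diag addr0.
  have [E|n13] := eqVneq K1 K3; first by rewrite E D_diag (D_anti K2 K3) addNr.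
  exfalso; have [[a [xa _]]|[a [b [s [ab abE s01 xE]]]]] := common_point n12 x1 x2.
    by apply: nv; exists a.
  have : a \in val K1 :&: val K2 by rewrite abE !inE eqxx.
  have : b \in val K1 :&: val K2 by rewrite abE !inE eqxx orbT.
  rewrite !inE => /andP[b1 b2] /andP[a1 a2].
  have s01' : 0 < s < 1.
    move/andP: s01 => [s0 s1]; rewrite !lt_neqAle s0 s1 !andbT; apply/andP; split.
      by apply/eqP => s0'; apply: nv; exists a; rewrite xE -s0' along0.
    by apply/eqP => s1'; apply: nv; exists b; rewrite xE s1' along1.
  have e1 : edge_of a b K1 by [].
  have e2 : edge_of a b K2 by [].
  have [a3 b3] : a \in val K3 /\ b \in val K3.
    by apply: (carrier_edge e1 s01'); rewrite -xE.
  have e3 : edge_of a b K3 by [].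
  case L1 : (left K1 a b); case L2 : (left K2 a b); case L3 : (left K3 a b);
    first [by case/eqP: n12; apply: (edge_uniq e1 e2); rewrite L1 L2
         | by case/eqP: n23; apply: (edge_uniq e2 e3); rewrite L2 L3
         | by case/eqP: n13; apply: (edge_uniq e1 e3); rewrite L1 L3].
have [x Ox|f fP] := @simply_connected_primitive R Omega (fun y z => D (kp y) (kp z)) _ Osc.
  have := Oopen; rewrite openE => /(_ _ Ox) /nbhs_ballP [r r0 rO].
  have [s s0 sP] := near_cells (Th := Th) x.
  exists (Num.min r s); first by rewrite lt_min r0.
  have BO y : ball x (Num.min r s) y -> Omega y.
    by move=> xy; apply: rO; apply: le_ball xy; rewrite ge_min lexx.
  have Bs y : ball x (Num.min r s) y -> cell_set (kp y) x.
    move=> xy; have Oy := BO _ xy; apply: sP (kpP _ Oy).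
    by apply: le_ball xy; rewrite ge_min lexx orbT.
  by split=> // p q w xp xq xw; apply: (D_cocycle x) => //; exact: Bs.
have bcP K : exists x, inside K x by exact: inside_exists.
have [bc bcP'] := choice bcP.
have kp_in K x : inside K x -> kp x = K.
  by move=> xK; apply: (inside_uniq xK); apply: kpP; exact: inside_Omega xK.
have f_in K y : inside K y -> f y = f (bc K).
  move=> yK.
  have pg : path_in (inside K) (along y (bc K)).
    split; first by apply: continuous_subspaceT; exact: along_continuous.
    by move=> _ [s + <-]; rewrite /= in_itv /=; exact: inside_along.
  rewrite -{1}(along0 y (bc K)) -{2}(along1 y (bc K)).
  apply: (path_locally_constant pg) => p pK.
  have [r r0 [_ fr]] := fP _ (inside_Omega pK).
  exists r => // q qK pq; apply/eqP; rewrite -subr_eq0 (fr p q)//; last exact: ballxx.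
  by rewrite (kp_in _ _ pK) (kp_in _ _ qK) D_diag.
exists (fun K => f (bc K)) => a b K K' ie L L'.
have [s s01 Os] := int_edge_point ie.
have [c H] := leftP _ _ _ L; have [c' H'] := leftP _ _ _ L'.
set x := along (pos a) (pos b) s in Os.
have xE : x = along (pos b) (pos a) (1 - s).
  by rewrite /x /along subKr ![(1 - s) * _ + _]addrC.
have [r r0 [_ fr]] := fP _ Os.
have [d1 d10 d1P] := along_near x (pos c) 0 r0.
have [d2 d20 d2P] := along_near x (pos c') 0 r0.
have [d [d0 dh dd1 dd2]] := small_step d10 d20.
have yK : inside K (along x (pos c) d) by apply: inside_near_edge; rewrite ?d0.
have zK : inside K' (along x (pos c') d).
  by rewrite xE; apply: inside_near_edge; rewrite ?d0// subr_gt0 gtrBl andbC.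
have by_ : ball x r (along x (pos c) d).
  by rewrite -[x in ball x](along0 x (pos c)); exact: d1P.
have bz : ball x r (along x (pos c') d).
  by rewrite -[x in ball x](along0 x (pos c')); exact: d2P.
rewrite -(f_in _ _ yK) -(f_in _ _ zK) (fr _ _ bz by_) (kp_in _ _ yK) (kp_in _ _ zK).
rewrite /D; case: pickP => [e /eqP eE|_]; last by rewrite (De_edge _ _ _ _ L L').
have [ab aK bK] := left_edge L; have [_ bK' aK'] := left_edge L'.
have : a \in val K' :&: val K by rewrite inE aK aK'.
have : b \in val K' :&: val K by rewrite inE bK bK'.
by rewrite eE !inE => /eqP be /eqP ae; rewrite be ae eqxx in ab.
Qed.

(** The unknowns of the linear system are the values at vertices in [Omega], its equations the
    interior edges. A test vector, once antisymmetrised, has zero sum at each of these vertices, so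
    [dual_potential] makes it a difference of some [c] on triangles. Its pairing with [s] regroups
    into [c K] times the circulation of [s] around [K], which is 0. *)
Lemma gradient_of_closed (s : V -> V -> R) : (forall a b, s b a = - s a b) ->
  (forall a b, bdry_edge Omega a b -> s a b = 0) ->
  (forall K a b c, ccw K a b c -> s a b + s b c + s c a = 0) ->
  exists psi : V -> R, (forall a, bdry_vertex Omega a -> psi a = 0) /\
    forall K a b, edge_of a b K -> s a b = psi b - psi a.
Proof.
move=> sN s0 scl.
pose E a b : bool := `[< int_edge Omega a b >].
pose O a : bool := `[< Omega (pos a) >].
have EC a b : E a b = E b a by apply/asboolP/asboolP; exact: int_edge_sym.
have sE K a b : edge_of a b K -> (E a b)%:R * s a b = s a b.
  move=> e; rewrite /E; case: asboolP => ie; first by rewrite mul1r.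
  by rewrite mul0r s0//; have [//|] := edge_cases e.
pose g (a : V) (xy : V * V) : R :=
  (O a)%:R * (E xy.1 xy.2)%:R * ((xy.2 == a)%:R - (xy.1 == a)%:R).
have [t tP|psi psiP] := @dual_solve R _ _ g (fun xy => (E xy.1 xy.2)%:R * s xy.1 xy.2).
  pose t' a b : R := (E a b)%:R * (t (a, b) - t (b, a)).
  have [|||c cP] := @dual_potential t'.
  - by move=> a b; rewrite /t' EC; ring.
  - move=> a b; rewrite /t' /E; case: asboolP => //.
    by rewrite mul0r eqxx.
  - move=> a Oa; have := tP a.
    have -> : \sum_xy g a xy * t xy = \sum_x \sum_y g a (x, y) * t (x, y).
      by rewrite pair_bigA /=; apply: eq_bigr => -[].
    have -> : \sum_x \sum_y g a (x, y) * t (x, y) =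
       \sum_x (E x a)%:R * t (x, a) - \sum_y (E a y)%:R * t (a, y).
      have Oa' : O a by apply/asboolP.
      rewrite /g /= Oa'.
      under eq_bigr => x _ do under eq_bigr => y _ do
        rewrite mul1r mulrBr mulrBl (mulrAC (E x y)%:R) (mulrAC (E x y)%:R (x == a)%:R).
      under eq_bigr => x _ do rewrite sumrB.
      rewrite sumrB; congr (_ - _).
        apply: eq_bigr => x _; rewrite (bigD1 a)//= eqxx mulr1 big1 ?addr0//.
        by move=> y /negbTE ->; rewrite mulr0.
      rewrite exchange_big; apply: eq_bigr => y _.
      rewrite (bigD1 a)//= eqxx mulr1 big1 ?addr0//.
      by move=> x /negbTE ->; rewrite mulr0.
    move/eqP; rewrite subr_eq0 => /eqP H.
    rewrite /t'; under eq_bigr do rewrite mulrBr.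
    rewrite sumrB -H; apply/eqP; rewrite subr_eq0; apply/eqP.
    by apply: eq_bigr => x _; rewrite EC.
  have -> : \sum_xy (E xy.1 xy.2)%:R * s xy.1 xy.2 * t xy =
      \sum_x \sum_y (E x y)%:R * s x y * t (x, y).
    by rewrite pair_bigA /=; apply: eq_bigr => -[].
  pose S := \sum_x \sum_y (E x y)%:R * s x y * t (x, y).
  (* Doubling compensates for antisymmetrisation: every edge occurs in both directions. *)
  have S2 : S + S = \sum_x \sum_y s x y * t' x y.
    rewrite {2}/S exchange_big /S -big_split; apply: eq_bigr => x _.
    rewrite -big_split; apply: eq_bigr => y _.
    by rewrite /t' /= (EC y x) (sN x y); ring.
  suff S0 : S + S = 0 by rewrite -/S; lra.
  have st x y : s x y * t' x y =
      \sum_K c K * (((left K x y)%:R - (left K y x)%:R) * s x y).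
    have [ie|nie] := pselect (int_edge Omega x y).
      have [K L] := int_edge_left ie; have [K' L'] := int_edge_left (int_edge_sym ie).
      rewrite (cP _ _ _ _ ie L L') (bigD1 K)//= (bigD1 K') /=; last first.
        by apply/eqP => KK; have := left_asym L; rewrite -KK L'.
      rewrite big1 ?addr0.
        by rewrite L L' (negbTE (left_asym L)) (negbTE (left_asym L')) /=; ring.
      move=> M /andP[MK MK'].
      case: (boolP (left M x y)) => [LM|_]; first by rewrite (left_uniq LM L) eqxx in MK.
      case: (boolP (left M y x)) => [LM|_]; first by rewrite (left_uniq LM L') eqxx in MK'.
      by rewrite subrr mul0r mulr0.
    rewrite /t' /E; case: asboolP => // _; rewrite mul0r mulr0 big1// => K _.
    have bdry : edge_of x y K -> s x y = 0.
      by move=> e; apply: s0; have [] := edge_cases e.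
    case: (boolP (left K x y)) => [/left_edge/bdry ->|_]; first by rewrite !mulr0.
    case: (boolP (left K y x)) => [/left_edge/edge_of_sym/bdry ->|_]; first by rewrite !mulr0.
    by rewrite subrr mul0r mulr0.
  rewrite S2; under eq_bigr => x _ do under eq_bigr => y _ do rewrite st.
  under eq_bigr => x _ do rewrite exchange_big.
  rewrite exchange_big big1// => K _.
  under eq_bigr => x _ do rewrite -mulr_sumr.
  rewrite -mulr_sumr; have [a [b [d H]]] := ccw_exists K.
  have sl := sum_left s H; rewrite (scl _ _ _ _ H) in sl.
  suff -> : \sum_x \sum_y ((left K x y)%:R - (left K y x)%:R) * s x y = 0 by rewrite mulr0.
  under eq_bigr => x _ do under eq_bigr => y _ do rewrite mulrBl.
  under eq_bigr => x _ do rewrite sumrB.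
  rewrite sumrB sl sub0r exchange_big /=.
  under eq_bigr => x _ do under eq_bigr => y _ do rewrite sN mulrN.
  under eq_bigr => x _ do rewrite sumrN.
  by rewrite sumrN sl !oppr0.
exists (fun a => (O a)%:R * psi a); split.
  move=> a; rewrite /bdry_vertex /O; case: asboolP => [Oa|_ _]; last by rewrite mul0r.
  by move/(boundaryN (subset_closure Oa)).
move=> K a b e; have [ie|be] := edge_cases e; last first.
  rewrite s0// /O; have bO x : segment (pos a) (pos b) x -> ~ Omega x.
    move=> sx; have bx := be.2 _ sx; apply/boundaryN => //; exact: bx.1.
  case: asboolP => [Ob|_].
    case: (bO (pos b)) => //; exists 1; last by rewrite along1.
    by rewrite /= in_itv /= lexx ler01.
  case: asboolP => [Oa|_]; last by rewrite !mul0r subrr.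
  case: (bO (pos a)) => //; exists 0; last by rewrite along0.
  by rewrite /= in_itv /= lexx ler01.
rewrite -(sE _ _ _ e) (psiP (a, b)) /g /=.
have -> : E a b by apply/asboolP.
have [ab _ _] := e.
rewrite (bigD1 a)//= (bigD1 b) 1?eq_sym//= big1 ?addr0.
  by rewrite !eqxx (negbTE ab) /=; ring.
move=> d /andP[da db]; rewrite ![_ == d]eq_sym (negbTE da) (negbTE db).
by rewrite subrr !mulr0.
Qed.

End TriangulatedDomain.

(** * The spaces in terms of edge moments *)

Section EdgeMoments.
Context {R : realType} {Omega : set (R * R)} {Th : triangulation R}.
Local Notation V := (vertex Th).
Implicit Types (K : cell Th) (a b c : V) (F G : V -> V -> cell Th -> {poly R})
  (f : V -> V -> cell Th -> R -> R) (Q : {poly R} -> Prop) (w : pw Th)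
  (v : pw Th * pw Th).

(** [Q] selects the weights, all of [P1edge] or the constant 1 alone, so that the two kinds of jump
    condition are treated at once. The edge length is divided out, and the trivial case [K = K'] is
    included. *)
Definition pjump Q F := forall a b, int_edge Omega a b -> forall K K',
  edge_of a b K -> edge_of a b K' -> forall p, Q p ->
  int01 (p * F a b K) = int01 (p * F a b K').

Definition pbdry Q F := forall a b, bdry_edge Omega a b -> forall K,
  edge_of a b K -> forall p, Q p -> int01 (p * F a b K) = 0.

Lemma edge_pos_neq K a b : edge_of a b K -> pos a <> pos b.
Proof. by case=> ab _ _ /pos_inj E; rewrite E eqxx in ab. Qed.

Lemma jump1E f F : (forall a b K t, f a b K t = (F a b K).[t]) ->
  jump1 Omega f <-> pjump (@P1edge R) F.
Proof.
move=> fE; split=> H a b ie K K' e e'.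
  move=> p pQ; have [->//|KK'] := eqVneq K K'.
  apply/eqP; rewrite -subr_eq0 -int01B -mulrBr; apply/eqP.
  apply/(edge_int_eq0 (edge_pos_neq e)); last exact: (H a b ie K K' e e' KK' p pQ).
  by move=> t /=; rewrite !fE !hornerE.
move=> KK' p pQ; apply/(edge_int_eq0 (p := p * (F a b K - F a b K')) (edge_pos_neq e)).
  by move=> t /=; rewrite !fE !hornerE.
by rewrite mulrBr int01B (H a b ie K K' e e' p pQ) subrr.
Qed.

Lemma jump0E f F : (forall a b K t, f a b K t = (F a b K).[t]) ->
  jump0 Omega f <-> pjump (eq 1) F.
Proof.
move=> fE; split=> H a b ie K K' e e'.
  move=> _ <-; have [->//|KK'] := eqVneq K K'.
  apply/eqP; rewrite -subr_eq0 -int01B -mulrBr mul1r; apply/eqP.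
  apply/(edge_int_eq0 (edge_pos_neq e)); last exact: (H a b ie K K' e e' KK').
  by move=> t /=; rewrite !fE !hornerE.
move=> KK'; apply/(edge_int_eq0 (p := F a b K - F a b K') (edge_pos_neq e)).
  by move=> t /=; rewrite !fE !hornerE.
have := H a b ie K K' e e' 1 erefl.
by rewrite !mul1r int01B => ->; rewrite subrr.
Qed.

Lemma bdry1E f F : (forall a b K t, f a b K t = (F a b K).[t]) ->
  bdry1 Omega f <-> pbdry (@P1edge R) F.
Proof.
move=> fE; split=> H a b be K e p pQ.
  apply/(edge_int_eq0 (edge_pos_neq e)); last exact: (H a b be K e p pQ).
  by move=> t /=; rewrite !fE !hornerE.
apply/(edge_int_eq0 (p := p * F a b K) (edge_pos_neq e)); last exact: H.
by move=> t /=; rewrite !fE !hornerE.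
Qed.

Lemma bdry0E f F : (forall a b K t, f a b K t = (F a b K).[t]) ->
  bdry0 Omega f <-> pbdry (eq 1) F.
Proof.
move=> fE; split=> H a b be K e.
  move=> _ <-; rewrite mul1r.
  by apply/(edge_int_eq0 (edge_pos_neq e)); last exact: (H a b be K e).
apply/(edge_int_eq0 (p := F a b K) (edge_pos_neq e)) => //.
by rewrite -[F a b K]mul1r; apply: H.
Qed.

Lemma pjump_eq Q F G : (forall a b K, edge_of a b K -> F a b K = G a b K) ->
  pjump Q F -> pjump Q G.
Proof. by move=> FG FQ a b ie K K' e e' p pQ; rewrite -!FG//; exact: FQ. Qed.

Lemma pbdry_eq Q F G : (forall a b K, edge_of a b K -> F a b K = G a b K) ->
  pbdry Q F -> pbdry Q G.
Proof. by move=> FG FQ a b be K e p pQ; rewrite -FG//; exact: FQ. Qed.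

Lemma pjump_lin Q F G (k l : V -> V -> R) : pjump Q F -> pjump Q G ->
  pjump Q (fun a b K => k a b *: F a b K + l a b *: G a b K).
Proof.
move=> FQ GQ a b ie K K' e e' p pQ.
rewrite !mulrDr !int01D -!scalerAr !int01Z.
by rewrite (FQ a b ie K K' e e' p pQ) (GQ a b ie K K' e e' p pQ).
Qed.

Lemma pbdry_lin Q F G (k l : V -> V -> R) : pbdry Q F -> pbdry Q G ->
  pbdry Q (fun a b K => k a b *: F a b K + l a b *: G a b K).
Proof.
move=> FQ GQ a b be K e p pQ.
rewrite !mulrDr !int01D -!scalerAr !int01Z.
by rewrite (FQ a b be K e p pQ) (GQ a b be K e p pQ) !mulr0 addr0.
Qed.

Lemma pjump0 Q F : (forall a b K, F a b K = 0) -> pjump Q F.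
Proof. by move=> F0 a b ie K K' e e' p pQ; rewrite !F0. Qed.

Lemma pbdry0 Q F : (forall a b K, F a b K = 0) -> pbdry Q F.
Proof. by move=> F0 a b be K e p pQ; rewrite F0 mulr0 int01_0. Qed.

Definition edge_trace w a b K : {poly R} := etrace (w K) (pos a) (pos b).
Definition ut a b : R * R := utangent (pos a) (pos b).

Definition tangential_trace v a b K := (ut a b).1 *: edge_trace v.1 a b K + (ut a b).2 *: edge_trace v.2 a b K.
Definition normal_trace v a b K := (ut a b).2 *: edge_trace v.1 a b K + - (ut a b).1 *: edge_trace v.2 a b K.

Lemma traceE w a b K t : trace w a b K t = (edge_trace w a b K).[t].
Proof. exact: etraceE. Qed.

Lemma trace_tE v a b K t : trace_t v a b K t = (tangential_trace v a b K).[t].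
Proof. by rewrite /trace_t !traceE /tangential_trace hornerD !hornerZ /ut mulrC [X in _ + X = _]mulrC. Qed.

Lemma trace_dnE w a b K t : trace_dn w a b K t = (normal_trace (grad_h w) a b K).[t].
Proof. by rewrite /trace_dn !traceE /normal_trace !hornerE /ut /unormal /=; ring. Qed.

Lemma ut_norm K a b : edge_of a b K -> (ut a b).1 ^+ 2 + (ut a b).2 ^+ 2 = 1.
Proof.
move=> /edge_pos_neq /edist_gt0; rewrite /ut /utangent /= => d0.
have d2 : edist (pos a) (pos b) ^+ 2 =
    ((pos b).1 - (pos a).1) ^+ 2 + ((pos b).2 - (pos a).2) ^+ 2.
  by rewrite sqr_sqrtr// addr_ge0 ?sqr_ge0.
by rewrite !expr_div_n -mulrDl -d2 divff// expf_neq0// gt_eqF.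
Qed.

Lemma tr1E v a b K : edge_of a b K ->
  (ut a b).1 *: tangential_trace v a b K + (ut a b).2 *: normal_trace v a b K = edge_trace v.1 a b K.
Proof.
move=> /ut_norm n1; rewrite /tangential_trace /normal_trace !scalerDr !scalerA addrACA -!scalerDl.
by rewrite -!expr2 n1 scale1r mulrN mulrC subrr scale0r addr0.
Qed.

Lemma tr2E v a b K : edge_of a b K ->
  (ut a b).2 *: tangential_trace v a b K + - (ut a b).1 *: normal_trace v a b K = edge_trace v.2 a b K.
Proof.
move=> /ut_norm n1; rewrite /tangential_trace /normal_trace !scalerDr !scalerA addrACA -!scalerDl.
by rewrite mulNr mulrC subrr scale0r add0r mulrNN -!expr2 addrC n1 scale1r.
Qed.

(** The frame of an edge is orthonormal and the same from both sides, so moments of the components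
    and moments of the tangential and normal traces determine each other linearly. *)
Lemma G2E v : G2 Omega Th v <-> [/\ Pk Th 2 v.1, Pk Th 2 v.2,
  pjump (@P1edge R) (tangential_trace v) & pjump (@P1edge R) (normal_trace v)].
Proof.
split=> -[k1 k2].
  move=> /(jump1E (fun a b K => traceE v.1 a b K)) j1.
  move=> /(jump1E (fun a b K => traceE v.2 a b K)) j2.
  by split=> //; apply: pjump_lin.
move=> jt jn; split=> //.
  apply/(jump1E (fun a b K => traceE v.1 a b K)).
  by apply: pjump_eq (pjump_lin _ _ jt jn) => a b K; exact: tr1E.
apply/(jump1E (fun a b K => traceE v.2 a b K)).
by apply: pjump_eq (pjump_lin _ _ jt jn) => a b K; exact: tr2E.
Qed.

Lemma G2tE v : G2t Omega Th v <-> [/\ Pk Th 2 v.1, Pk Th 2 v.2,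
  pjump (@P1edge R) (tangential_trace v), pjump (@P1edge R) (normal_trace v)
  & pbdry (@P1edge R) (tangential_trace v)].
Proof.
split=> [[/G2E[k1 k2 jt jn] /(bdry1E (fun a b K => trace_tE v a b K)) bt]|[k1 k2 jt jn bt]] //.
by split; [exact/G2E|exact/(bdry1E (fun a b K => trace_tE v a b K))].
Qed.

Lemma G20E v : G20 Omega Th v <-> [/\ Pk Th 2 v.1, Pk Th 2 v.2,
  pjump (@P1edge R) (tangential_trace v), pjump (@P1edge R) (normal_trace v)
  & pbdry (@P1edge R) (tangential_trace v) /\ pbdry (@P1edge R) (normal_trace v)].
Proof.
split=> [[/G2E[k1 k2 jt jn]]|[k1 k2 jt jn [bt bn]]].
  move=> /(bdry1E (fun a b K => traceE v.1 a b K)) b1.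
  move=> /(bdry1E (fun a b K => traceE v.2 a b K)) b2.
  by split=> //; split; apply: pbdry_lin.
split; first exact/G2E.
  apply/(bdry1E (fun a b K => traceE v.1 a b K)).
  by apply: pbdry_eq (pbdry_lin _ _ bt bn) => a b K; exact: tr1E.
apply/(bdry1E (fun a b K => traceE v.2 a b K)).
by apply: pbdry_eq (pbdry_lin _ _ bt bn) => a b K; exact: tr2E.
Qed.

Lemma B3tE w : B3t Omega Th w <-> [/\ Pk Th 3 w, vertex_continuous w,
  forall a K, bdry_vertex Omega a -> a \in val K -> ev (w K) (pos a) = 0,
  pjump (eq 1) (edge_trace w) /\ pbdry (eq 1) (edge_trace w) & pjump (@P1edge R) (normal_trace (grad_h w))].
Proof.
split=> [[[k3 vc] j0 j1 va b0]|[k3 vc va [j0 b0] j1]].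
  split=> //; last exact/(jump1E (fun a b K => trace_dnE w a b K)).
  split; first exact/(jump0E (fun a b K => traceE w a b K)).
  exact/(bdry0E (fun a b K => traceE w a b K)).
split; [split=> //| by []|].
- exact/(jump0E (fun a b K => traceE w a b K)).
- exact/(jump1E (fun a b K => trace_dnE w a b K)).
- exact/(bdry0E (fun a b K => traceE w a b K)).
Qed.

Lemma B30E w : B30 Omega Th w <-> B3t Omega Th w /\ pbdry (@P1edge R) (normal_trace (grad_h w)).
Proof.
by split=> -[Bw] => [/(bdry1E (fun a b K => trace_dnE w a b K))|bn]; split=> //;
  exact/(bdry1E (fun a b K => trace_dnE w a b K)).
Qed.

Lemma G20_G2t v : G20 Omega Th v -> G2t Omega Th v.
Proof. by move=> /G20E[k1 k2 jt jn [bt bn]]; exact/G2tE. Qed.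

Lemma tr_lin (k : R) w w' a b K : edge_trace (k *: w + w') a b K = k *: edge_trace w a b K + edge_trace w' a b K.
Proof. by rewrite /edge_trace !ffunE etraceD etraceZ. Qed.

Lemma tr0 a b K : edge_trace 0 a b K = 0.
Proof. by rewrite /edge_trace ffunE /etrace mmap0. Qed.

Lemma tr_t_lin (k : R) v v' a b K :
  k *: tangential_trace v a b K + 1 *: tangential_trace v' a b K = tangential_trace (k *: v + v') a b K.
Proof.
rewrite /tangential_trace /= !tr_lin -!mul_polyC; ring.
Qed.

Lemma tr_n_lin (k : R) v v' a b K :
  k *: normal_trace v a b K + 1 *: normal_trace v' a b K = normal_trace (k *: v + v') a b K.
Proof.
rewrite /normal_trace /= !tr_lin -!mul_polyC; ring.
Qed.

Lemma tr_t0 a b K : tangential_trace 0 a b K = 0.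
Proof. by rewrite /tangential_trace !tr0 !scaler0 addr0. Qed.

Lemma tr_n0 a b K : normal_trace 0 a b K = 0.
Proof. by rewrite /normal_trace !tr0 !scaler0 addr0. Qed.

Lemma Pk_0 k : Pk Th k 0.
Proof. by move=> K; rewrite ffunE msize0. Qed.

Lemma Pk_lin k (l : R) w w' : Pk Th k w -> Pk Th k w' -> Pk Th k (l *: w + w').
Proof.
move=> wk wk' K; rewrite !ffunE; apply: leq_trans (msizeD_le _ _) _.
by rewrite geq_max wk' andbT; apply: leq_trans (msizeZ_le _ _) _.
Qed.

Lemma G2t_subspace : subspace (G2t Omega Th).
Proof.
split; first by apply/G2tE; split; try exact: Pk_0;
  [apply: pjump0; exact: tr_t0|apply: pjump0; exact: tr_n0|apply: pbdry0; exact: tr_t0].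
move=> l u v /G2tE[k1 k2 jt jn bt] /G2tE[k1' k2' jt' jn' bt']; apply/G2tE; split.
- exact: Pk_lin.
- exact: Pk_lin.
- apply: pjump_eq (pjump_lin (fun _ _ => l) (fun _ _ => 1) jt jt') => a b K _.
  exact: tr_t_lin.
- apply: pjump_eq (pjump_lin (fun _ _ => l) (fun _ _ => 1) jn jn') => a b K _.
  exact: tr_n_lin.
- apply: pbdry_eq (pbdry_lin (fun _ _ => l) (fun _ _ => 1) bt bt') => a b K _.
  exact: tr_t_lin.
Qed.

Lemma G20_subspace : subspace (G20 Omega Th).
Proof.
split.
  apply/G20E; split; try exact: Pk_0; first by apply: pjump0; exact: tr_t0.
    by apply: pjump0; exact: tr_n0.
  by split; apply: pbdry0; [exact: tr_t0|exact: tr_n0].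
move=> l u v /G20E[k1 k2 jt jn [bt bn]] /G20E[k1' k2' jt' jn' [bt' bn']].
apply/G20E; split.
- exact: Pk_lin.
- exact: Pk_lin.
- apply: pjump_eq (pjump_lin (fun _ _ => l) (fun _ _ => 1) jt jt') => a b K _.
  exact: tr_t_lin.
- apply: pjump_eq (pjump_lin (fun _ _ => l) (fun _ _ => 1) jn jn') => a b K _.
  exact: tr_n_lin.
- split.
    apply: pbdry_eq (pbdry_lin (fun _ _ => l) (fun _ _ => 1) bt bt') => a b K _.
    exact: tr_t_lin.
  apply: pbdry_eq (pbdry_lin (fun _ _ => l) (fun _ _ => 1) bn bn') => a b K _.
  exact: tr_n_lin.
Qed.

Lemma B3t_subspace : subspace (B3t Omega Th).
Proof.
split.
  apply/B3tE; split; [exact: Pk_0|by move=> *; rewrite !ffunE !ev0| | |].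
  - by move=> *; rewrite ffunE ev0.
  - by split; [apply: pjump0|apply: pbdry0]; exact: tr0.
  - by apply: pjump0 => a b K; rewrite linear0 tr_n0.
move=> l u v /B3tE[k3 vc va [j0 b0] j1] /B3tE[k3' vc' va' [j0' b0'] j1'].
apply/B3tE; split.
- exact: Pk_lin.
- move=> a K K' aK aK'; rewrite !ffunE !evD !evZ.
  by rewrite (vc a K K')// (vc' a K K').
- by move=> a K ba aK; rewrite !ffunE evD evZ (va a K)// (va' a K)// mulr0 addr0.
- split.
    apply: pjump_eq (pjump_lin (fun _ _ => l) (fun _ _ => 1) j0 j0') => a b K _.
    by rewrite tr_lin scale1r.
  apply: pbdry_eq (pbdry_lin (fun _ _ => l) (fun _ _ => 1) b0 b0') => a b K _.
  by rewrite tr_lin scale1r.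
- apply: pjump_eq (pjump_lin (fun _ _ => l) (fun _ _ => 1) j1 j1') => a b K _.
  by rewrite tr_n_lin -linearP.
Qed.

Lemma B30_subspace : subspace (B30 Omega Th).
Proof.
have [t0 tlin] := B3t_subspace.
split.
  by apply/B30E; split=> //; apply: pbdry0 => a b K; rewrite linear0 tr_n0.
move=> l u v /B30E[Bu bu] /B30E[Bv bv]; apply/B30E; split; first exact: tlin.
apply: pbdry_eq (pbdry_lin (fun _ _ => l) (fun _ _ => 1) bu bv) => a b K _.
by rewrite tr_n_lin -linearP.
Qed.

Lemma cell_integral K a b c (p : mpoly 2 R) : ccw K a b c -> (msize p <= 2)%N ->
  area_int (cell_set K) (ev p) = orient (pos a) (pos b) (pos c) / 6 *
    (ev p (pos a) + ev p (pos b) + ev p (pos c)).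
Proof.
move=> H /affineP[c0 [c1 [c2 ->]]]; have D0 := ccw_gt0 H.
have evE' x : ev (quad c0 c1 c2 0 0 0) x = c0 + c1 * x.1 + c2 * x.2.
  by rewrite ev_quad; ring.
rewrite (_ : ev _ = fun x => c0 + c1 * x.1 + c2 * x.2); last exact/funext.
rewrite (cell_setE H) area_int_affine; last by rewrite gt_eqF.
by rewrite gtr0_norm.
Qed.

(** Linearity is read off [cell_integral], the vertex rule being exact for affine functions. *)
Lemma int_Omega_lin (l : R) (u w : pw Th) : Pk Th 1 u -> Pk Th 1 w ->
  int_Omega (l *: u + w) = l * int_Omega u + int_Omega w.
Proof.
move=> u1 w1; rewrite /int_Omega mulr_sumr -big_split; apply: eq_bigr => K _ /=.
have [a [b [c H]]] := ccw_exists K.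
rewrite !(cell_integral H) ?u1 ?w1//; last exact: (Pk_lin _ u1 w1).
by rewrite !ffunE !evD !evZ; ring.
Qed.

Lemma Pk0_subspace : subspace (Pk0 Th 1).
Proof.
split.
  split; first exact: Pk_0.
  have := int_Omega_lin 1 (Pk_0 1) (Pk_0 1); rewrite scaler0 addr0; lra.
move=> l u v [u1 u0] [v1 v0]; split; first exact: Pk_lin.
by rewrite int_Omega_lin// u0 v0 mulr0 addr0.
Qed.

End EdgeMoments.

(** * Barycentric coordinates and quadratic bubbles as polynomials *)

Section Bubbles.
Context {R : realType}.

Definition affine_poly (c0 c1 c2 : R) : mpoly 2 R := quad c0 c1 c2 0 0 0.

Definition bary (x y z : R * R) : mpoly 2 R :=
  affine_poly ((y.1 * z.2 - y.2 * z.1) / orient x y z) ((y.2 - z.2) / orient x y z)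
    ((z.1 - y.1) / orient x y z).

Lemma ev_affp c0 c1 c2 x : ev (affine_poly c0 c1 c2) x = c0 + c1 * x.1 + c2 * x.2.
Proof. by rewrite ev_quad; ring. Qed.

Lemma ev_bary x y z p : ev (bary x y z) p = orient p y z / orient x y z.
Proof. by rewrite ev_affp /orient; ring. Qed.

Lemma etrace_affine (p : mpoly 2 R) (x y : R * R) : (msize p <= 2)%N ->
  etrace p x y = ev p x *: (1 - 'X) + ev p y *: 'X.
Proof.
move=> /affineP[c0 [c1 [c2 ->]]]; rewrite -/(affine_poly c0 c1 c2) !ev_affp /affine_poly /quad.
rewrite !scale0r !addr0 !etraceD !etraceZ etraceC etraceX etraceY -!mul_polyC.
by rewrite !polyCD !polyCM polyCN; ring.
Qed.

Lemma affpM (c0 c1 c2 d0 d1 d2 : R) : affine_poly c0 c1 c2 * affine_poly d0 d1 d2 =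
  quad (c0 * d0) (c0 * d1 + c1 * d0) (c0 * d2 + c2 * d0) (c1 * d1)
    (c1 * d2 + c2 * d1) (c2 * d2).
Proof.
rewrite /affine_poly /quad !scale0r !addr0 -!mul_mpolyC !mpolyCD !mpolyCM; ring.
Qed.

Lemma quadZ k (c0 c1 c2 c3 c4 c5 : R) :
  k *: quad c0 c1 c2 c3 c4 c5 = quad (k * c0) (k * c1) (k * c2) (k * c3) (k * c4) (k * c5).
Proof. by rewrite /quad -!mul_mpolyC !mpolyCM; ring. Qed.

(* The quadratic that vanishes at the two Gauss points of every edge. *)
Definition bubble (x y z : R * R) : mpoly 2 R :=
  mpolyC 2 2 + (- 3) *: (bary x y z * bary x y z)
  + (- 3) *: (bary y z x * bary y z x) + (- 3) *: (bary z x y * bary z x y).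

Lemma quadB (c0 c1 c2 c3 c4 c5 d0 d1 d2 d3 d4 d5 : R) :
  quad c0 c1 c2 c3 c4 c5 - quad d0 d1 d2 d3 d4 d5 =
  quad (c0 - d0) (c1 - d1) (c2 - d2) (c3 - d3) (c4 - d4) (c5 - d5).
Proof. by rewrite /quad -!mul_mpolyC !mpolyCB; ring. Qed.

(** The gradient of the bubble is -6 times the sum of the products of each barycentric coordinate
    with its constant gradient. Hence the rotation of a constant vector times the bubble is affine,
    and it suffices to match its values at the three vertices. *)
Lemma bubble_rot x y z (r0 r1 r2 : R) : let D := orient x y z in
  D != 0 -> r0 + r1 * (x.1 + y.1 + z.1) / 3 + r2 * (x.2 + y.2 + z.2) / 3 = 0 ->
  exists g1 g2, dx (g2 *: bubble x y z) - dy (g1 *: bubble x y z) = affine_poly r0 r1 r2.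
Proof.
move=> D D0 mean0.
pose rho (p : R * R) := r0 + r1 * p.1 + r2 * p.2.
(* The product of the gradient of the i-th coordinate with the j-th vertex is 1 or 0, according as i
   = j or not, minus a term independent of j. Weighting by [rho] cancels that term, since the vertex
   values of [rho] sum to 0; the 6 comes from the gradient of the bubble. *)
exists ((rho x * x.2 + rho y * y.2 + rho z * z.2) / 6).
exists (- (rho x * x.1 + rho y * y.1 + rho z * z.1) / 6).
have r0E : r0 = - (r1 * (x.1 + y.1 + z.1) / 3 + r2 * (x.2 + y.2 + z.2) / 3) by lra.
have C2 : mpolyC 2 2 = quad 2 0 0 0 0 0 :> mpoly 2 R.
  by rewrite /quad !scale0r !addr0.
rewrite /bubble /bary !affpM C2 !quadZ !quadD !quadZ dx_quad dy_quad.
rewrite quadB /affine_poly (orientC x) (orient_rot2 x) /rho r0E /D /orient.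
move: D0; rewrite /D /orient => D0.
by congr quad; field.
Qed.

(** On the edge the bubble is -1 + 6t - 6t^2, a multiple of the second Legendre polynomial of the
    unit interval, hence orthogonal to affine weights. *)
Lemma bubble_edge x y z (p : {poly R}) : orient x y z != 0 -> P1edge p ->
  int01 (p * etrace (bubble x y z) x y) = 0.
Proof.
move=> D0 p2.
have aff (u v w : R * R) : (msize (bary u v w) <= 2)%N by exact: msize_affine.
rewrite /bubble !etraceD !etraceZ !etraceM etraceC !etrace_affine// !ev_bary.
rewrite !(orient_pp, orient_pqp, orient_pqq) (orientC x) !divff// !mul0r.
have pE t : p.[t] = p`_0 + p`_1 * t.
  rewrite (horner_coef_wide t p2) big_ord_recl big_ord1 /= expr0 mulr1 expr1.
  by rewrite /bump /=.
rewrite /int01 (@int01_cubic _ (- p`_0) (6 * p`_0 - p`_1) (6 * p`_1 - 6 * p`_0) (- 6 * p`_1)).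
  by field.
by move=> t; rewrite !hornerE pE /=; ring.
Qed.

Lemma bubble_cyc x y z : bubble y z x = bubble x y z.
Proof. by rewrite /bubble; ring. Qed.

Lemma bary_swap x y z : bary x z y = bary x y z.
Proof.
rewrite /bary orient_swap23 invrN !mulrN -!mulNr; congr affine_poly; congr (_ / _); ring.
Qed.

Lemma bubble_swap x y z : bubble y x z = bubble x y z.
Proof.
by rewrite /bubble (bary_swap y z x) (bary_swap x y z) (bary_swap z x y); ring.
Qed.

Lemma bubble_size x y z : (msize (bubble x y z) <= 3)%N.
Proof.
have C2 : mpolyC 2 2 = quad 2 0 0 0 0 0 :> mpoly 2 R.
  by rewrite /quad !scale0r !addr0.
by rewrite /bubble /bary !affpM C2 !quadZ !quadD; exact: msize_quad.
Qed.

End Bubbles.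

(** * Exactness *)

Section Exactness.
Context {R : realType} {Omega : set (R * R)} {Th : triangulation R}.
Local Notation V := (vertex Th).
Implicit Types (K : cell Th) (a b c : V) (w : pw Th) (v : pw Th * pw Th).
Hypotheses (Oopen : open Omega) (Oreg : interior (closure Omega) = Omega)
  (Otri : triangulates Omega Th) (Osc : simply_connected Omega).

Lemma deriv_tr w a b K : edge_of a b K ->
  (edge_trace w a b K)^`() = edist (pos a) (pos b) *: tangential_trace (grad_h w) a b K.
Proof.
move=> /edge_pos_neq/edist_gt0 d0; rewrite /edge_trace deriv_etrace /tangential_trace /edge_trace /grad_h !ffunE.
rewrite scalerDr !scalerA /ut /utangent /=.
by congr (_ *: _ + _ *: _); rewrite mulrC divfK ?gt_eqF.
Qed.

Lemma tr_end w a b K : (edge_trace w a b K).[0] = ev (w K) (pos a) /\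
  (edge_trace w a b K).[1] = ev (w K) (pos b).
Proof. by rewrite /edge_trace -!etraceE along0 along1. Qed.

Lemma P1edge_1 : P1edge (1 : {poly R}).
Proof. by rewrite /P1edge size_poly1. Qed.

Lemma P1edge_X : P1edge ('X : {poly R}).
Proof. by rewrite /P1edge size_polyX. Qed.

(** The length times the tangential derivative is the derivative in the edge parameter. For an
    affine weight [p] the last term is a multiple of the edge mean, so the tangential moments match
    exactly the vertex and mean conditions on [w]. *)
Lemma tangential_trace_parts w a b K (p : {poly R}) : edge_of a b K ->
  edist (pos a) (pos b) * int01 (p * tangential_trace (grad_h w) a b K) =
  p.[1] * ev (w K) (pos b) - p.[0] * ev (w K) (pos a)
  - int01 (p^`() * edge_trace w a b K).
Proof.
move=> e; rewrite -int01Z scalerAr -deriv_tr// int01_parts.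
by have [-> ->] := tr_end w a b K.
Qed.

Lemma deriv_P1edge (p : {poly R}) : P1edge p -> p^`() = ((p^`())`_0)%:P.
Proof.
move=> p2; apply: size1_polyC; have [->|p0] := eqVneq p 0.
  by rewrite deriv0 size_poly0.
by have := leq_trans (lt_size_deriv p0) p2; rewrite ltnS.
Qed.

Lemma bdry_edge_vertex a b : bdry_edge Omega a b ->
  bdry_vertex Omega a /\ bdry_vertex Omega b.
Proof.
move=> [_ H]; split; apply: H.
  by exists 0; [rewrite /= in_itv /= lexx ler01|exact: along0].
by exists 1; [rewrite /= in_itv /= lexx ler01|exact: along1].
Qed.

Lemma grad_Pk w k : Pk Th k.+1 w -> Pk Th k (grad_h w).1 /\ Pk Th k (grad_h w).2.
Proof. by move=> wk; split=> K; rewrite ffunE; apply: msize_mderiv; exact: wk. Qed.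

Lemma grad_B3t w : B3t Omega Th w -> G2t Omega Th (grad_h w).
Proof.
move=> /B3tE[k3 vc va [j0 b0] j1]; have [k1 k2] := grad_Pk k3.
apply/G2tE; split=> //.
  move=> a b ie K K' e e' p pQ; have d0 := edist_gt0 (edge_pos_neq e).
  apply: (mulfI (x := edist (pos a) (pos b))); first by rewrite gt_eqF.
  rewrite !tangential_trace_parts//; have [_ aK bK] := e; have [_ aK' bK'] := e'.
  rewrite (vc a K K')// (vc b K K')// (deriv_P1edge pQ) !mul_polyC !int01Z.
  by have := j0 a b ie K K' e e' 1 erefl; rewrite !mul1r => ->.
move=> a b be K e p pQ; have d0 := edist_gt0 (edge_pos_neq e).
apply: (mulfI (x := edist (pos a) (pos b))); first by rewrite gt_eqF.
rewrite tangential_trace_parts//; have [_ aK bK] := e; have [ba bb] := bdry_edge_vertex be.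
rewrite (va a K)// (va b K)// (deriv_P1edge pQ) mul_polyC int01Z.
by have := b0 a b be K e 1 erefl; rewrite mul1r => ->; rewrite !mulr0 !subrr.
Qed.

Lemma grad_B30 w : B30 Omega Th w -> G20 Omega Th (grad_h w).
Proof.
by move=> /B30E[/grad_B3t/G2tE[k1 k2 jt jn bt] bn]; apply/G20E; split.
Qed.

Lemma rot_grad w : rot_h (grad_h w) = 0.
Proof.
apply/ffunP => K; rewrite !ffunE /dx /dy mderiv_comm.
by rewrite subrr.
Qed.

Definition edge_circulation v K a b : R := circ (v.1 K, v.2 K) (pos a) (pos b).

Lemma ecircE v K a b : edge_of a b K ->
  edge_circulation v K a b = edist (pos a) (pos b) * int01 (tangential_trace v a b K).
Proof.
move=> /edge_pos_neq/edist_gt0 d0; rewrite /edge_circulation /circ /tangential_trace int01D !int01Z /edge_trace.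
rewrite /ut /utangent /=; field; rewrite gt_eqF//.
Qed.

Lemma edge_circ_exists v : G2t Omega Th v -> exists s : V -> V -> R,
  [/\ forall a b, s b a = - s a b, forall a b, bdry_edge Omega a b -> s a b = 0
    & forall K a b, edge_of a b K -> edge_circulation v K a b = s a b].
Proof.
move=> /G2tE[k1 k2 jt jn bt].
have agree K K' a b : edge_of a b K -> edge_of a b K' -> edge_circulation v K a b = edge_circulation v K' a b.
  move=> e e'; rewrite !ecircE//; congr (_ * _).
  have [ie|be] := edge_cases (Omega := Omega) e.
    by have := jt a b ie K K' e e' 1 P1edge_1; rewrite !mul1r.
  have := bt a b be K e 1 P1edge_1; have := bt a b be K' e' 1 P1edge_1.
  by rewrite !mul1r => -> ->.
have anti K a b : edge_circulation v K b a = - edge_circulation v K a b by rewrite /edge_circulation circC ?k1 ?k2.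
(* Any triangle at the edge serves, by [agree]; pairs that are not edges get 0, which keeps [s]
   antisymmetric. *)
pose s a b := if [pick K : cell Th | [&& a != b, a \in val K & b \in val K]] is Some K
  then edge_circulation v K a b else 0.
have sE K a b : edge_of a b K -> edge_circulation v K a b = s a b.
  move=> e; rewrite /s; case: pickP => [K' /and3P[ab aK bK]|/(_ K)].
    by apply: agree.
  by case: e => -> -> ->.
have s_none a b : (forall K, ~ edge_of a b K) -> s a b = 0.
  move=> ne; rewrite /s; case: pickP => // K /and3P[ab aK bK].
  by case: (ne K).
exists s; split=> //.
  move=> a b; have [[K e]|ne] := pselect (exists K, edge_of a b K).
    by rewrite -(sE _ _ _ e) -(sE _ _ _ (edge_of_sym e)).
  rewrite (s_none a b); last by move=> K e; apply: ne; exists K.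
  by rewrite s_none ?oppr0// => K e; apply: ne; exists K; exact: edge_of_sym.
move=> a b be; have [[K e] _] := be; rewrite -(sE _ _ _ e) ecircE//.
by have := bt a b be K e 1 P1edge_1; rewrite mul1r => ->; rewrite mulr0.
Qed.

Lemma cell_rot v K a b c : Pk Th 2 v.1 -> Pk Th 2 v.2 -> ccw K a b c ->
  area_int (cell_set K) (ev (rot_h v K)) = edge_circulation v K a b + edge_circulation v K b c + edge_circulation v K c a.
Proof.
move=> k1 k2 H; rewrite ffunE (cell_setE H) green ?k1 ?k2//.
  by rewrite gtr0_sg ?mul1r// (ccw_gt0 H).
by rewrite gt_eqF// (ccw_gt0 H).
Qed.

Lemma rot_Pk v : Pk Th 2 v.1 -> Pk Th 2 v.2 -> Pk Th 1 (rot_h v).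
Proof.
move=> k1 k2 K; rewrite ffunE -scaleN1r addrC; apply: leq_trans (msizeD_le _ _) _.
rewrite geq_max; apply/andP; split; last exact/msize_mderiv/k2.
by apply: leq_trans (msizeZ_le _ _) _; exact/msize_mderiv/k1.
Qed.

(** By Green, the integral sums circulations over directed edges, [n x y] being the number of
    triangles to the left. An interior edge is counted once in each direction and cancels; a
    boundary edge has circulation 0. *)
Lemma rot_G2t v : G2t Omega Th v -> Pk0 Th 1 (rot_h v).
Proof.
move=> Gv; have [s [sN s0 sE]] := edge_circ_exists Gv.
have /G2tE[k1 k2 _ _ _] := Gv; split; first exact: rot_Pk.
pose n (x y : V) : R := \sum_(K : cell Th) (left K x y)%:R.
have -> : int_Omega (rot_h v) = \sum_x \sum_y n x y * s x y.
  rewrite /int_Omega (eq_bigr (fun K => \sum_x \sum_y (left K x y)%:R * s x y)).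
    rewrite exchange_big; apply: eq_bigr => x _; rewrite exchange_big.
    by apply: eq_bigr => y _; rewrite mulr_suml.
  move=> K _; have [a [b [c H]]] := ccw_exists K.
  rewrite (cell_rot k1 k2 H) (sum_left _ H).
  have H' := ccw_rot H; have H'' := ccw_rot H'.
  by rewrite !(sE K)//; apply: left_edge; apply/leftP; eexists; eassumption.
have n1 x y : int_edge Omega x y -> n x y = 1.
  move=> ie; have [K L] := int_edge_left Oopen Otri ie.
  rewrite /n (bigD1 K)//= L big1 ?addr0// => K' KK'.
  by case: (boolP (left K' x y)) => // L'; rewrite (left_uniq L' L) eqxx in KK'.
have n0 x y : (forall K, ~ edge_of x y K) -> n x y = 0.
  move=> ne; rewrite /n big1// => K _.
  by case: (boolP (left K x y)) => // /left_edge /ne.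
have nC x y : n x y * s x y = n y x * s x y.
  have [[K e]|ne] := pselect (exists K, edge_of x y K).
    have [ie|be] := edge_cases (Omega := Omega) e; last by rewrite s0// !mulr0.
    by rewrite !n1//; exact: int_edge_sym.
  rewrite !n0// => K e; apply: ne; exists K => //; exact: edge_of_sym.
have : \sum_x \sum_y n x y * s x y = - (\sum_x \sum_y n x y * s x y).
  rewrite {1}exchange_big -sumrN; apply: eq_bigr => x _.
  by rewrite -sumrN; apply: eq_bigr => y _; rewrite nC sN mulrN.
lra.
Qed.

Lemma potential_B3t v : G2t Omega Th v -> rot_h v = 0 ->
  exists2 w, B3t Omega Th w & grad_h w = v.
Proof.
move=> Gv rv; have [s [sN s0 sE]] := edge_circ_exists Gv.
have /G2tE[k1 k2 jt jn bt] := Gv.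
have scl K a b c : ccw K a b c -> s a b + s b c + s c a = 0.
  move=> H; have H' := ccw_rot H; have H'' := ccw_rot H'.
  rewrite -!(sE K); try by apply: left_edge; apply/leftP; eexists; eassumption.
  rewrite -(cell_rot k1 k2 H) rv ffunE (cell_integral H) ?msize0//.
  by rewrite !ev0 !addr0 mulr0.
have [psi [psi0 psiE]] := gradient_of_closed Oopen Oreg Otri Osc sN s0 scl.
have wE K : exists p : mpoly 2 R, [/\ (msize p <= 4)%N, dx p = v.1 K, dy p = v.2 K
    & forall a, a \in val K -> ev p (pos a) = psi a].
  have cf : dx (v.2 K) = dy (v.1 K).
    have /ffunP/(_ K) := rv; rewrite !ffunE => /eqP.
    by rewrite subr_eq0 => /eqP.
  have [p [p4 px py]] := potential_exists (k1 K) (k2 K) cf.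
  have [a [b [c H]]] := ccw_exists K; have [aK bK cK] := ccw_mem H.
  (* The constant fits [psi] at one vertex. The other two follow, since the increment of the
     potential along an edge is the circulation, which is the increment of [psi]. *)
  exists (p + mpolyC 2 (psi a - ev p (pos a))); split.
  - apply: leq_trans (msizeD_le _ _) _; rewrite geq_max p4 msizeC.
    by case: (_ != _).
  - by rewrite dxD dxC addr0.
  - by rewrite dyD dyC addr0.
  - move=> d dK; rewrite evD evC; have [->|ad] := eqVneq d a; first by rewrite addrC subrK.
    have e : edge_of a d K by rewrite /edge_of eq_sym.
    have := psiE _ _ _ e; rewrite -(sE _ _ _ e) /edge_circulation /circ -px -py /= -!int01Z -int01D.
    rewrite -deriv_etrace int01_deriv -!etraceE along0 along1; lra.
have [w0 w0P] := choice wE; pose w : pw Th := [ffun K => w0 K].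
have wv : grad_h w = v.
  rewrite /grad_h [RHS]surjective_pairing; congr pair; apply/ffunP => K; rewrite !ffunE;
  by have [] := w0P K.
exists w => //; apply/B3tE; split.
- by move=> K; rewrite ffunE; have [] := w0P K.
- move=> a K K' aK aK'; rewrite !ffunE.
  by have [_ _ _ ->] := w0P K => //; have [_ _ _ ->] := w0P K'.
- by move=> a K ba aK; rewrite ffunE; have [_ _ _ ->] := w0P K; rewrite ?psi0.
(* The weight ['X] in the integration by parts gives the edge mean of [w] from [psi b] and a first
   moment of [v], neither of which depends on the side of the edge. *)
- have E K a b : edge_of a b K -> int01 (edge_trace w a b K) =
      psi b - edist (pos a) (pos b) * int01 ('X * tangential_trace v a b K).
    move=> e; have := tangential_trace_parts w 'X e.
    rewrite derivX !hornerX !mul1r mul0r subr0 wv !ffunE.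
    have [_ aK bK] := e; have [_ _ _ ->] := w0P K => //; lra.
  split=> a b ee K e.
    move=> e1 e2 _ <-; rewrite !mul1r (E _ _ _ e1) (E _ _ _ e2); congr (_ - _ * _).
    exact: (jt a b ee _ _ e1 e2 'X P1edge_X).
  move=> _ <-; rewrite mul1r (E _ _ _ e) (bt a b ee K e 'X P1edge_X) mulr0 subr0.
  by rewrite psi0//; have [] := bdry_edge_vertex ee.
- by rewrite wv.
Qed.

Lemma potential_B30 v : G20 Omega Th v -> rot_h v = 0 ->
  exists2 w, B30 Omega Th w & grad_h w = v.
Proof.
move=> Gv rv; have [w Bw wv] := potential_B3t (G20_G2t Gv) rv.
by exists w => //; apply/B30E; rewrite wv; split=> //; have /G20E[_ _ _ _ []] := Gv.
Qed.

(** Take a vertex of largest abscissa. If it lay in [Omega], so would some point to its right, yet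
    every point of [Omega] is a convex combination of vertices. *)
Lemma bdry_vertex_exists (K0 : cell Th) : exists a : V, bdry_vertex Omega a.
Proof.
have [a0 [_ [_ /ccw_mem [a0K _ _]]]] := ccw_exists K0.
pose a := [arg max_(i > a0) (pos i).1]%O.
have amax b : (pos b).1 <= (pos a).1.
  by rewrite /a; case: arg_maxP => // i _ H; exact: H.
exists a; have [K Kt aK] := @vertex_used _ Th a; pose K' : cell Th := exist _ K Kt.
have aK' : cell_set K' (pos a) by exact: vertex_cell.
apply/(boundaryN Oopen (cell_closure Otri aK')) => Oa.
have := Oopen; rewrite openE => /(_ _ Oa) /nbhs_ballP [r /= r0 rO].
have : Omega ((pos a).1 + r / 2, (pos a).2).
  apply: rO; split; rewrite -ball_normE /=; last by rewrite subrr normr0.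
  by rewrite opprD addNKr normrN gtr0_norm ?divr_gt0//; lra.
move=> /(Omega_cell Otri) [L [l [l0 l1 []]]] E _.
have : \sum_(b in val L) l b * (pos b).1 <= \sum_(b in val L) l b * (pos a).1.
  by apply: ler_sum => b _; apply: ler_wpM2l.
rewrite -mulr_suml l1 mul1r => H.
have : (pos a).1 + r / 2 <= (pos a).1 by rewrite E.
lra.
Qed.

(** The difference is constant on each triangle; vertex continuity and connectedness make it one
    constant, which vanishes at a boundary vertex. *)
Lemma grad_inj : set_inj (B3t Omega Th) (@grad_h R Th).
Proof.
move=> u w; rewrite !inE => /B3tE[_ uc uv _ _] /B3tE[_ wc wv _ _] uw.
have cE K : exists c : R, u K - w K = mpolyC 2 c.
  exists (mcoeff (@mnm0 2) (u K - w K)); apply: grad_eq0.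
    have /(congr1 (fun v : pw Th * pw Th => v.1 K)) := uw; rewrite !ffunE /dx => E.
    by rewrite mderivB E subrr.
  have /(congr1 (fun v : pw Th * pw Th => v.2 K)) := uw; rewrite !ffunE /dy => E.
  by rewrite mderivB E subrr.
have [c cP] := choice cE.
have cv K a : a \in val K -> ev (u K) (pos a) - ev (w K) (pos a) = c K.
  by move=> aK; rewrite -evB cP evC.
have cc : forall K K', c K = c K'.
  apply: (global_connect Oopen Oreg Otri Osc) => K K' a b _ [_ aK _] [_ aK' _].
  by rewrite -(cv K a)// -(cv K' a)// (uc a K K')// (wc a K K').
apply/ffunP => K; have [a ba] := bdry_vertex_exists K.
have [L Lt aL] := @vertex_used _ Th a; pose L' : cell Th := exist _ L Lt.
apply/eqP; rewrite -subr_eq0 cP (cc K L') -(cv L' a)// uv// wv// subrr.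
by rewrite mpolyC0.
Qed.

(** * Surjectivity of the rotation *)

Definition barycentric K a : mpoly 2 R :=
  if [pick bc : V * V | ccw K a bc.1 bc.2] is Some bc
  then bary (pos a) (pos bc.1) (pos bc.2) else 0.

Lemma lamE K a b c : ccw K a b c -> barycentric K a = bary (pos a) (pos b) (pos c).
Proof.
move=> H; rewrite /barycentric; case: pickP => [[b' c'] /= H'|/(_ (b, c))]; last by rewrite /= H.
have L' : left K a b' by apply/leftP; exists c'.
have [ab ac _] := ccw_neq H.
have bb : b' = b.
  by move: L'; rewrite (left_ccw _ _ H) eqxx (negbTE ab) (negbTE ac) /= orbF => /eqP.
by rewrite bb in H' *; rewrite (ccw_uniq H' H).
Qed.

(** This default lets the sums in [edge_bubbles] range over all vertices. *)
Lemma lam_out K a : a \notin val K -> barycentric K a = 0.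
Proof.
move=> aK; rewrite /barycentric; case: pickP => // -[b c] /= /ccw_mem[aK'].
by rewrite aK' in aK.
Qed.

Lemma lam_affine K a : (msize (barycentric K a) <= 2)%N.
Proof.
by rewrite /barycentric; case: pickP => [[b c] _|_]; [exact: msize_affine|rewrite msize0].
Qed.

Lemma ev_lam K x y : y \in val K -> ev (barycentric K x) (pos y) = (x == y)%:R.
Proof.
move=> yK; have [xK|xK] := boolP (x \in val K); last first.
  by rewrite lam_out// ev0; case: eqP => // E; rewrite -E (negbTE xK) in yK.
have [b [c H]] := ccw_of xK; have [xb xc _] := ccw_neq H.
rewrite (lamE H) ev_bary; case: (mem_ccw H yK) => ->.
- by rewrite eqxx divff// gt_eqF// (ccw_gt0 H).
- by rewrite orient_pp mul0r (negbTE xb).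
- by rewrite orient_pqp mul0r (negbTE xc).
Qed.

Lemma tr_lam K a b x : edge_of a b K -> etrace (barycentric K x) (pos a) (pos b) =
  (x == a)%:R *: (1 - 'X) + (x == b)%:R *: 'X.
Proof.
by case=> _ aK bK; rewrite etrace_affine ?lam_affine// !ev_lam.
Qed.

Lemma sum_pair (A : nmodType) a b (f : V -> A) : a != b ->
  (forall x, x != a -> x != b -> f x = 0) -> \sum_x f x = f a + f b.
Proof.
move=> ab f0; rewrite (bigD1 a)//= (bigD1 b) 1?eq_sym//= big1 ?addr0//.
by move=> x /andP[xa xb]; exact: f0.
Qed.

(** To each directed edge belongs the product of its two barycentric coordinates times the edge
    vector. On a given edge only its own product survives, so the trace is the same from both sides.
    Reversing a direction changes the sign, so only the antisymmetric part of [al] counts. *)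
Definition edge_bubbles (al : V -> V -> R) : pw Th * pw Th :=
  ([ffun K => \sum_x \sum_y (al x y * ((pos y).1 - (pos x).1)) *: (barycentric K x * barycentric K y)],
   [ffun K => \sum_x \sum_y (al x y * ((pos y).2 - (pos x).2)) *: (barycentric K x * barycentric K y)]).

Lemma etrace_bubbles K a b (k : V -> V -> R) : edge_of a b K -> (forall x, k x x = 0) ->
  etrace (\sum_x \sum_y k x y *: (barycentric K x * barycentric K y)) (pos a) (pos b) =
  (k a b + k b a) *: ((1 - 'X) * 'X).
Proof.
move=> e k0; have [ab _ _] := e; pose T (p : mpoly 2 R) := etrace p (pos a) (pos b).
have TD : {morph T : p q / p + q} by move=> p q; exact: etraceD.
have T0 : T 0 = 0 by rewrite /T -mpolyC0 etraceC.
rewrite -/(T _) (big_morph T TD T0).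
under eq_bigr => x _ do rewrite (big_morph T TD T0).
rewrite /T; under eq_bigr => x _ do under eq_bigr => y _ do
  rewrite etraceZ etraceM !(tr_lam _ e).
have inner x : \sum_y k x y *: (((x == a)%:R *: (1 - 'X) + (x == b)%:R *: 'X) *
    ((y == a)%:R *: (1 - 'X) + (y == b)%:R *: 'X)) =
    ((x == a)%:R *: (1 - 'X) + (x == b)%:R *: 'X) *
    (k x a *: (1 - 'X) + k x b *: 'X).
  rewrite (sum_pair ab); last first.
    by move=> y /negbTE -> /negbTE ->; rewrite !scale0r addr0 mulr0 scaler0.
  rewrite !eqxx [b == a]eq_sym (negbTE ab) !scale0r !scale1r addr0 add0r.
  by rewrite -!mul_polyC; ring.
rewrite (eq_bigr _ (fun x _ => inner x)) (sum_pair ab); last first.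
  by move=> x /negbTE -> /negbTE ->; rewrite !scale0r addr0 mul0r.
rewrite !eqxx [b == a]eq_sym (negbTE ab) !scale0r !scale1r addr0 add0r !k0.
by rewrite !scale0r addr0 add0r -!mul_polyC polyCD; ring.
Qed.

Lemma int01_bump : int01 ((1 - 'X) * 'X : {poly R}) = 1 / 6.
Proof.
rewrite /int01 (@int01_cubic _ 0 1 (- 1) 0); first by field.
by move=> t; rewrite !hornerE /=; ring.
Qed.

Lemma edge_bubbles_tr al K a b : edge_of a b K ->
  edge_trace (edge_bubbles al).1 a b K =
    ((al a b - al b a) * ((pos b).1 - (pos a).1)) *: ((1 - 'X) * 'X) /\
  edge_trace (edge_bubbles al).2 a b K =
    ((al a b - al b a) * ((pos b).2 - (pos a).2)) *: ((1 - 'X) * 'X).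
Proof.
move=> e; rewrite /edge_trace !ffunE; split.
  rewrite (etrace_bubbles (k := fun x y => al x y * ((pos y).1 - (pos x).1)) e).
    by congr (_ *: _); ring.
  by move=> x; rewrite subrr mulr0.
rewrite (etrace_bubbles (k := fun x y => al x y * ((pos y).2 - (pos x).2)) e).
  by congr (_ *: _); ring.
by move=> x; rewrite subrr mulr0.
Qed.

Lemma lamM_size K x y : (msize (barycentric K x * barycentric K y) <= 3)%N.
Proof.
have [c0 [c1 [c2 ->]]] := affineP (lam_affine K x).
have [d0 [d1 [d2 ->]]] := affineP (lam_affine K y).
by rewrite -/(affine_poly c0 c1 c2) -/(affine_poly d0 d1 d2) affpM; exact: msize_quad.
Qed.

Lemma edge_bubbles_Pk al : Pk Th 2 (edge_bubbles al).1 /\ Pk Th 2 (edge_bubbles al).2.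
Proof.
have H (k : V -> V -> R) K : (msize (\sum_x \sum_y k x y *: (barycentric K x * barycentric K y)) <= 3)%N.
  apply: leq_trans (msize_sum _ _ _) _; apply/bigmax_leqP => x _.
  apply: leq_trans (msize_sum _ _ _) _; apply/bigmax_leqP => y _.
  by apply: leq_trans (msizeZ_le _ _) _; exact: lamM_size.
split=> K; rewrite ffunE.
  exact: (H (fun x y => al x y * ((pos y).1 - (pos x).1))).
exact: (H (fun x y => al x y * ((pos y).2 - (pos x).2))).
Qed.

Lemma edge_bubbles_G20 al : (forall a b, bdry_edge Omega a b -> al a b = al b a) ->
  G20 Omega Th (edge_bubbles al).
Proof.
move=> al0; have [k1 k2] := edge_bubbles_Pk al.
have j1 : pjump (Omega := Omega) (@P1edge R) (edge_trace (edge_bubbles al).1).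
  by move=> a b ie K K' e e' p _; rewrite (edge_bubbles_tr al e).1 (edge_bubbles_tr al e').1.
have j2 : pjump (Omega := Omega) (@P1edge R) (edge_trace (edge_bubbles al).2).
  by move=> a b ie K K' e e' p _; rewrite (edge_bubbles_tr al e).2 (edge_bubbles_tr al e').2.
have b1 : pbdry (Omega := Omega) (@P1edge R) (edge_trace (edge_bubbles al).1).
  move=> a b be K e p _; rewrite (edge_bubbles_tr al e).1 al0// subrr mul0r scale0r mulr0.
  exact: int01_0.
have b2 : pbdry (Omega := Omega) (@P1edge R) (edge_trace (edge_bubbles al).2).
  move=> a b be K e p _; rewrite (edge_bubbles_tr al e).2 al0// subrr mul0r scale0r mulr0.
  exact: int01_0.
by apply/G20E; split=> //; [exact: pjump_lin|exact: pjump_lin|split; exact: pbdry_lin].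
Qed.

Lemma ecirc_bubbles al K a b : edge_of a b K -> edge_circulation (edge_bubbles al) K a b =
  (al a b - al b a) * edist (pos a) (pos b) ^+ 2 / 6.
Proof.
move=> e; have [E1 E2] := edge_bubbles_tr al e.
rewrite /edge_circulation /circ -[etrace _ _ _]/(edge_trace (edge_bubbles al).1 a b K).
rewrite -[etrace _ _ _]/(edge_trace (edge_bubbles al).2 a b K) E1 E2 !int01Z int01_bump.
by rewrite sqr_sqrtr ?addr_ge0 ?sqr_ge0//; field.
Qed.

(* By duality, from the connectedness of the dual graph. *)
Lemma cell_integrals_onto (s : cell Th -> R) : \sum_K s K = 0 ->
  exists2 v, G20 Omega Th v & forall K, area_int (cell_set K) (ev (rot_h v K)) = s K.
Proof.
move=> s0; pose E a b : bool := `[< int_edge Omega a b >].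
have EC a b : E a b = E b a by apply/asboolP/asboolP; exact: int_edge_sym.
pose g (xy : V * V) K : R := (E xy.1 xy.2)%:R * ((left K xy.1 xy.2)%:R - (left K xy.2 xy.1)%:R).
have [u uP|be beP] := @dual_solve R _ _ g s.
  have uc : forall K K', u K = u K'.
    apply: (global_connect Oopen Oreg Otri Osc) => K K' a b ie e e'.
    have [->//|KK'] := eqVneq K K'.
    wlog L : K K' e e' KK' / left K a b.
      move=> W; have [|L] := edge_left e; first exact: W.
      have [L'|L'] := edge_left e'; first by apply/esym/W; rewrite // eq_sym.
      by case/eqP: KK'; exact: left_uniq L L'.
    have L' : left K' b a.
      by have [L'|//] := edge_left e'; case/eqP: KK'; exact: left_uniq L L'.
    have := uP (a, b); rewrite (bigD1 K)//= (bigD1 K') 1?eq_sym//= big1 ?addr0.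
      rewrite /g /= L L' (negbTE (left_asym L)) (negbTE (left_asym L')).
      have -> : E a b by apply/asboolP.
      rewrite /=; lra.
    move=> M /andP[MK MK']; rewrite /g /=.
    case: (boolP (left M a b)) => [LM|_]; first by rewrite (left_uniq LM L) eqxx in MK.
    case: (boolP (left M b a)) => [LM|_]; first by rewrite (left_uniq LM L') eqxx in MK'.
    by rewrite subrr mulr0 mul0r.
  have [[K0 _]|nK] := pselect (exists K0 : cell Th, True); last first.
    by rewrite big1// => K; case: nK; exists K.
  by rewrite (eq_bigr (fun K => s K * u K0)) -?mulr_suml ?s0 ?mul0r// => K _; rewrite (uc K K0).
(* The factors 6 and squared length invert [ecirc_bubbles], so that the circulation along an
   interior edge is [be (a, b) - be (b, a)]. *)
pose al a b : R := (E a b)%:R * (6 * be (a, b) / edist (pos a) (pos b) ^+ 2).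
have edistC a b : edist (pos a) (pos b) ^+ 2 = edist (pos b) (pos a) ^+ 2.
  by rewrite !sqr_sqrtr ?addr_ge0 ?sqr_ge0//; ring.
have al0 a b : bdry_edge Omega a b -> al a b = al b a.
  move=> bd; rewrite /al (EC b a); suff -> : E a b = false by rewrite !mul0r.
  by apply/asboolP => -[_]; apply; exact: bd.2.
exists (edge_bubbles al); first exact: edge_bubbles_G20.
move=> K; have [a [b [c H]]] := ccw_exists K; have [k1 k2] := edge_bubbles_Pk al.
rewrite (cell_rot k1 k2 H) -(sum_left _ H) beP.
transitivity (\sum_x \sum_y (left K x y)%:R * ((E x y)%:R * (be (x, y) - be (y, x)))).
  apply: eq_bigr => x _; apply: eq_bigr => y _.
  have [L|_] := boolP (left K x y); last by rewrite !mul0r.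
  have e := left_edge L; rewrite (ecirc_bubbles al e) /al EC (edistC y x).
  have := edist_gt0 (edge_pos_neq e) => d0.
  by congr (_ * _); field; rewrite gt_eqF.
have -> : \sum_i be i * g i K = \sum_x \sum_y be (x, y) * g (x, y) K.
  by rewrite pair_bigA /=; apply: eq_bigr => -[].
under [RHS]eq_bigr => x _ do under eq_bigr => y _ do rewrite /g /= mulrBr mulrBr.
under [RHS]eq_bigr => x _ do rewrite sumrB.
rewrite sumrB [X in _ = _ - X]exchange_big -sumrB; apply: eq_bigr => x _.
by rewrite -sumrB; apply: eq_bigr => y _; rewrite (EC y x); ring.
Qed.

Lemma ccw_bubble K a b c x y z : ccw K a b c -> ccw K x y z ->
  bubble (pos x) (pos y) (pos z) = bubble (pos a) (pos b) (pos c).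
Proof.
move=> H H'; have H1 := ccw_rot H; have H2 := ccw_rot H1.
have L : left K x y by apply/leftP; exists z.
move: L; rewrite (left_ccw _ _ H) => /or3P[] /andP[/eqP Ex /eqP Ey]; subst x y.
- by rewrite (ccw_uniq H' H).
- by rewrite (ccw_uniq H' H1) bubble_cyc.
- by rewrite (ccw_uniq H' H2) -bubble_cyc.
Qed.

(** The fields produced by [bubble_rot] have vanishing affine moments on the edges of their
    triangle, so they are glued freely and meet every jump and boundary condition. *)
Lemma mean_zero_onto (q : pw Th) : Pk Th 1 q ->
  (forall K, area_int (cell_set K) (ev (q K)) = 0) ->
  exists2 v, G20 Omega Th v & rot_h v = q.
Proof.
move=> q1 q0.
have locP K : exists p : mpoly 2 R * mpoly 2 R,
    [/\ (msize p.1 <= 3)%N, (msize p.2 <= 3)%N, dx p.2 - dy p.1 = q K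
      & forall a b, edge_of a b K -> forall r, P1edge r ->
        int01 (r * etrace p.1 (pos a) (pos b)) = 0 /\
        int01 (r * etrace p.2 (pos a) (pos b)) = 0].
  have [a [b [c H]]] := ccw_exists K; have D := ccw_gt0 H.
  set B := bubble (pos a) (pos b) (pos c).
  have [r0 [r1 [r2 qE]]] := affineP (q1 K).
  have := q0 K; rewrite (cell_integral H (q1 K)) qE -/(affine_poly r0 r1 r2) !ev_affp => /eqP.
  have D6 : orient (pos a) (pos b) (pos c) / 6 != 0.
    by rewrite mulf_neq0 ?invr_eq0 ?pnatr_eq0// gt_eqF.
  rewrite mulf_eq0 (negbTE D6) /= => /eqP mean0.
  have [||g1 [g2 gE]] := @bubble_rot R (pos a) (pos b) (pos c) r0 r1 r2.
  - by rewrite gt_eqF.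
  - by lra.
  have Bs : (msize B <= 3)%N by exact: bubble_size.
  have Be x y : edge_of x y K -> forall r, P1edge r ->
      int01 (r * etrace B (pos x) (pos y)) = 0.
    move=> /edge_left[] /leftP[z H'] r rP; rewrite /B -(ccw_bubble H H').
      by apply: bubble_edge => //; rewrite gt_eqF// (ccw_gt0 H').
    rewrite -bubble_swap; apply: bubble_edge => //.
    by rewrite orient_swap12 oppr_eq0 gt_eqF// (ccw_gt0 H').
  exists (g1 *: B, g2 *: B); split.
  - by apply: leq_trans (msizeZ_le _ _) _.
  - by apply: leq_trans (msizeZ_le _ _) _.
  - exact: gE.
  - move=> x y e r rP; rewrite !etraceZ -!scalerAr !int01Z.
    by rewrite (Be x y e r rP) !mulr0.
have [p pP] := choice locP.
pose v : pw Th * pw Th := ([ffun K => (p K).1], [ffun K => (p K).2]).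
exists v; last by apply/ffunP => K; rewrite !ffunE; have [] := pP K.
have m1 K a b : edge_of a b K -> forall r, P1edge r ->
    int01 (r * edge_trace v.1 a b K) = 0 /\ int01 (r * edge_trace v.2 a b K) = 0.
  by move=> e r rP; rewrite /edge_trace !ffunE; have [_ _ _ H] := pP K; exact: H.
have j1 : pjump (Omega := Omega) (@P1edge R) (edge_trace v.1).
  by move=> a b ie K K' e e' r rP; rewrite (m1 K a b e r rP).1 (m1 K' a b e' r rP).1.
have j2 : pjump (Omega := Omega) (@P1edge R) (edge_trace v.2).
  by move=> a b ie K K' e e' r rP; rewrite (m1 K a b e r rP).2 (m1 K' a b e' r rP).2.
have b1 : pbdry (Omega := Omega) (@P1edge R) (edge_trace v.1).
  by move=> a b be K e r rP; rewrite (m1 K a b e r rP).1.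
have b2 : pbdry (Omega := Omega) (@P1edge R) (edge_trace v.2).
  by move=> a b be K e r rP; rewrite (m1 K a b e r rP).2.
apply/G20E; split.
- by move=> K; rewrite ffunE; have [] := pP K.
- by move=> K; rewrite ffunE; have [] := pP K.
- exact: pjump_lin.
- exact: pjump_lin.
- by split; exact: pbdry_lin.
Qed.

Lemma rot_onto (q : pw Th) : Pk0 Th 1 q -> exists2 v, G20 Omega Th v & rot_h v = q.
Proof.
move=> [q1 q0].
have [v0 Gv0 v0q] := cell_integrals_onto (s := fun K => area_int (cell_set K) (ev (q K))) q0.
have [k1 k2] : Pk Th 2 v0.1 /\ Pk Th 2 v0.2 by have /G20E[] := Gv0.
have d1 : Pk Th 1 (- 1 *: rot_h v0 + q) by apply: Pk_lin => //; exact: rot_Pk.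
have [K|v1 Gv1 v1q] := mean_zero_onto d1.
  have [a [b [c H]]] := ccw_exists K.
  rewrite (cell_integral H (d1 K)); have := v0q K.
  rewrite (cell_integral H (q1 K)) (cell_integral H (rot_Pk k1 k2 K)).
  have -> : (- 1 *: rot_h v0 + q) K = - 1 *: rot_h v0 K + q K.
    by move: (rot_h v0) => r; rewrite !ffunE.
  by rewrite !evD !evZ; lra.
exists (1 *: v0 + v1); first exact: (G20_subspace (Omega := Omega) (Th := Th)).2.
by rewrite linearP /= v1q scale1r scaleN1r addrA subrr add0r.
Qed.

End Exactness.

Local Close Scope ring_scope.
Local Close Scope classical_set_scope.

Theorem theorem10 (R : realType) (Omega : set (R * R)) (Th : triangulation R)
    (kappa : R)
    (hpoly : polygonal_domain Omega)
    (hsimply : simply_connected Omega)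
    (hTh : triangulates Omega Th)
    (hreg : shape_regular Th kappa) :
  [/\ short_exact R (pw Th) (pw Th * pw Th)%type (pw Th)
        (B30 Omega Th) (G20 Omega Th) (Pk0 Th 1) (@grad_h R Th) (@rot_h R Th),
      short_exact R (pw Th) (pw Th * pw Th)%type (pw Th)
        (B3t Omega Th) (G2t Omega Th) (Pk0 Th 1) (@grad_h R Th) (@rot_h R Th)
    & forall q : pw Th, Pk0 Th 1 q -> int_Omega q = 0%R].
Proof.
have [[_ Oopen _ _] [Oreg _]] := hpoly.
split; last by move=> q [].
- split.
    by split; [exact: B30_subspace|exact: G20_subspace|exact: Pk0_subspace].
  split.
  + split=> _ [w Bw <-]; first exact: grad_B30.
    by apply: (rot_G2t Oopen hTh); exact: G20_G2t.
  + move=> u w uB wB; apply: (grad_inj Oopen Oreg hTh hsimply).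
      by move: uB; rewrite !inE => /B30E[].
    by move: wB; rewrite !inE => /B30E[].
  + apply/seteqP; split=> [_ [w Bw <-]|v [Gv rv]].
      by split; [exact: grad_B30|exact: rot_grad].
    by have [w Bw <-] := potential_B30 Oopen Oreg hTh hsimply Gv rv; exists w.
  + apply/seteqP; split=> [_ [v Gv <-]|q Pq].
      by apply: (rot_G2t Oopen hTh); exact: G20_G2t.
    by have [v Gv <-] := rot_onto Oopen Oreg hTh hsimply Pq; exists v.
- split.
    by split; [exact: B3t_subspace|exact: G2t_subspace|exact: Pk0_subspace].
  split.
  + split=> _ [w Bw <-]; first exact: grad_B3t.
    exact: (rot_G2t Oopen hTh).
  + exact: (grad_inj Oopen Oreg hTh hsimply).
  + apply/seteqP; split=> [_ [w Bw <-]|v [Gv rv]].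
      by split; [exact: grad_B3t|exact: rot_grad].
    by have [w Bw <-] := potential_B3t Oopen Oreg hTh hsimply Gv rv; exists w.
  + apply/seteqP; split=> [_ [v Gv <-]|q Pq].
      exact: (rot_G2t Oopen hTh).
    have [v Gv <-] := rot_onto Oopen Oreg hTh hsimply Pq.
    by exists v => //; exact: G20_G2t.
Qed.
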